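(* Let $d\geq 2$ be an integer and let $\Omega\subset\mathbb{R}^d\times\mathbb{R}^d$ be a measurable set with $0<\mathcal{L}^{2d}(\Omega)<\infty$. Then for every $p\in[1,p_*(d))$ the functional \[ J_{\mathrm{BJ}}^p: L^2(\mathbb{R}^d)\to[0,\infty),\qquad f\mapsto \|W_{\mathrm{BJ}}f\|_{L^p(\Omega)} \] is sequentially weakly continuous in $L^2(\mathbb{R}^d)$ (i.e. if $f^{(n)}\rightharpoonup f$ weakly in $L^2(\mathbb{R}^d)$ then $J_{\mathrm{BJ}}^p(f^{(n)})\to J_{\mathrm{BJ}}^p(f)$). As a consequence, the supremum \[ \sup_{f\in L^2(\mathbb{R}^d)\setminus\{0\}}\frac{\|W_{\mathrm{BJ}}f\|_{L^p(\Omega)}}{\|f\|_{L^2(\mathbb{R}^d)}^2}<\infty \] is finite and is attained by some $f\in L^2(\mathbb{R}^d)\setminus\{0\}$.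
   Context: Functions in $L^2(\mathbb{R}^d)$ are complex-valued, and $\mathcal{L}^{2d}$ is Lebesgue measure on $\mathbb{R}^{2d}$. For $f\in L^2(\mathbb{R}^d)$, $\tau\in(0,1)$ and $z=(x,\xi)\in\mathbb{R}^d\times\mathbb{R}^d$, the $\tau$-Wigner distribution is \[ W_\tau f(z)=\int_{\mathbb{R}^d}e^{-2\pi i\xi\cdot y}f(x+\tau y)\,\overline{f(x-(1-\tau)y)}\,dy, \] and the Born--Jordan distribution is $W_{\mathrm{BJ}}f(z)=\int_0^1 W_\tau f(z)\,d\tau$ (the integral in $\tau$ converges absolutely for a.e. $z$ and $W_{\mathrm{BJ}}f\in L^2(\mathbb{R}^{2d})$). The critical exponent is $p_*(1)=p_*(2)=\infty$ and $p_*(d)=\left(\frac12-\frac1d\right)^{-1}=\frac{2d}{d-2}$ for $d\ge3$. *)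

(* Defs.v *)
From HB Require Import structures.
From mathcomp Require Import all_boot all_order all_algebra.
From mathcomp Require Import complex.
From mathcomp Require Import all_classical all_reals all_analysis.

Set Implicit Arguments.
Unset Strict Implicit.
Unset Printing Implicit Defensive.
Import Order.TTheory GRing.Theory Num.Theory.
Import numFieldNormedType.Exports.

Local Open Scope classical_set_scope.
Local Open Scope ring_scope.

(* R^n with its Borel sigma-algebra: measurableTypeR R is R with its Borel
   sets, and tuples carry the product sigma-algebra. *)
Notation euclidean R n := (n.-tuple (measurableTypeR R)).

Section lebesgue_cons.
Context {R : realType} {n : nat}.
Variable mu : {sigma_finite_measure set (euclidean R n) -> \bar R}.

Definition tuple_cons (x : measurableTypeR R * euclidean R n) :
  euclidean R n.+1 := [tuple of x.1 :: x.2].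

Lemma measurable_tuple_cons : measurable_fun [set: _] tuple_cons.
Proof.
exact: (@measurable_cons _ _ _ _ fst n snd measurable_fst measurable_snd).
Qed.

(* The image of the product measure dx0 (x) mu(dx1, ..., dxn) on R x R^n under
   the identification of R x R^n with R^(n+1). *)
Definition lebesgue_cons : set (euclidean R n.+1) -> \bar R :=
  pushforward (lebesgue_measure \x mu)%E tuple_cons.

Let nu : {measure set _ -> \bar R} :=
  measure_function_pushforward__canonical__measure_function_Measure
    (lebesgue_measure \x mu)%E measurable_tuple_cons.

HB.instance Definition _ := isMeasure.Build _ _ _ lebesgue_cons
  (measure0 nu) (measure_ge0 nu) (@measure_semi_sigma_additive _ _ _ nu).

Lemma lebesgue_cons_sigma_finite : sigma_finite setT lebesgue_cons.
Proof.
have /sigma_finiteP[F [FT ndF Foo]] := sigma_finiteT (@lebesgue_measure R).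
have /sigma_finiteP[G [GT ndG Goo]] := sigma_finiteT mu.
pose uncons (x : euclidean R n.+1) : measurableTypeR R * euclidean R n :=
  (tnth x ord0, [tuple of behead x]).
have consK : cancel tuple_cons uncons.
  by move=> [a x]; congr pair; apply/val_inj.
have munc : measurable_fun setT uncons.
  apply/measurable_fun_pairP; split; first exact: measurable_tnth.
  exact: measurable_behead.
exists (fun i => uncons @^-1` (F i `*` G i)).
  rewrite -preimage_bigcup; apply/esym/seteqP; split=> // x _ /=.
  have [i _ Fi] : (\bigcup_i F i) (uncons x).1 by rewrite -FT.
  have [j _ Gj] : (\bigcup_i G i) (uncons x).2 by rewrite -GT.
  exists (maxn i j) => //; split.
    by move: Fi; apply/subsetPset/ndF/leq_maxl.
  by move: Gj; apply/subsetPset/ndG/leq_maxr.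
move=> i; have [mF Fi] := Foo i; have [mG Gi] := Goo i; split.
  by rewrite -[X in measurable X]setTI; apply: munc => //; exact: measurableX.
rewrite /lebesgue_cons /pushforward -comp_preimage.
rewrite (_ : uncons \o tuple_cons = id); last first.
  by apply/funext => x /=; rewrite consK.
by rewrite preimage_id product_measure1E// lte_mul_pinfty// ge0_fin_numE.
Qed.

HB.instance Definition _ :=
  Measure_isSigmaFinite.Build _ _ _ lebesgue_cons lebesgue_cons_sigma_finite.

End lebesgue_cons.

(* n-dimensional Lebesgue measure on the Borel sets; for n = 0 it is the unit
   mass at the only point of R^0. *)
Fixpoint leb (R : realType) (n : nat) :
    {sigma_finite_measure set (euclidean R n) -> \bar R} :=
  match n with
  | 0 => dirac [tuple of [::]]
  | m.+1 => lebesgue_cons (leb R m)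
  end.


(* Consistency check: the measure of a box is the product of the lengths of its
   sides. *)
Lemma leb_box (R : realType) (n : nat) (A : 'I_n -> set (measurableTypeR R)) :
  (forall i, measurable (A i)) ->
  leb R n [set x | forall i, A i (tnth x i)] =
  (\prod_(i < n) lebesgue_measure (A i))%E.
Proof.
elim: n A => [|n IHn] A mA.
  by rewrite big_ord0 /= diracE mem_set//= => -[].
have mtail : measurable [set x : euclidean R n |
    forall i, A (lift ord0 i) (tnth x i)].
  rewrite (_ : mkset _ = \bigcap_(i in [set: 'I_n])
      ((fun x => tnth x i) @^-1` A (lift ord0 i))); last first.
    by apply/seteqP; split=> x /= Ax i; [move=> _|]; exact: Ax.
  apply: fin_bigcap_measurable => // i _.
  by rewrite -[X in measurable X]setTI; exact: measurable_tnth.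
rewrite big_ord_recl -IHn => [|i]; last exact: mA.
rewrite /= /lebesgue_cons /pushforward -product_measure1E//.
congr product_measure1; apply/seteqP; split=> -[a x] /= Ax.
  split; first exact: (Ax ord0).
  by move=> i; have := Ax (lift ord0 i); rewrite tnthS.
move=> i; have [j ->|->] := unliftP ord0 i; last exact: Ax.1.
by rewrite tnthS; exact: Ax.2.
Qed.

(* Lebesgue measure on the Lebesgue measurable subsets of R^d x R^d = R^(2d).
   Caratheodory's sigma-algebra for the outer measure of leb R d \x leb R d is
   that of the Lebesgue measurable sets, i.e. the completion of the Borel
   sigma-algebra. *)
Notation phase_space R d := (caratheodory_type (leb R d \x leb R d)%E^*%mu).

Definition leb_phase (R : realType) (d : nat) :
    {measure set (phase_space R d) -> \bar R} :=
  @completed_measure_extension _ _ _ (leb R d \x leb R d)%E.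

Section complex_Lp.
Context {disp : measure_display} {T : measurableType disp} {R : realType}.
Variables (mu : {measure set T -> \bar R}) (D : set T).
Implicit Types g : T -> R[i].

Definition integralC g : R[i] :=
  (\int[mu]_(x in D) complex.Re (g x) +i* \int[mu]_(x in D) complex.Im (g x))%C.

Definition normLp (p : R) g : \bar R :=
  Lnorm mu p%:E ((fun x => (Normc.normc (g x))%:E) \_ D).

Definition inLp (p : R) g : Prop :=
  [/\ measurable_fun D (fun x => complex.Re (g x)),
      measurable_fun D (fun x => complex.Im (g x))
    & (normLp p g < +oo)%E].

End complex_Lp.

Section born_jordan.
Context {R : realType} {d : nat}.
Implicit Types (f g : euclidean R d -> R[i]) (x y xi : euclidean R d).

(* Elements of L^2(R^d) are represented by Borel functions: every class of
   Lebesgue measurable functions contains one, and nothing below depends on the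
   choice of the representative. *)
Definition inL2 f : Prop := inLp (leb R d) setT 2 f.

Definition normL2 f : \bar R := normLp (leb R d) setT 2 f.

Definition nonzeroL2 f : Prop := ~ {ae leb R d, forall x, f x = 0}.

Definition innerL2 f g : R[i] :=
  integralC (leb R d) setT (fun x => f x * conjc (g x)).

Definition weakly_converges (f_ : nat -> euclidean R d -> R[i]) f : Prop :=
  forall g, inL2 g ->
    (innerL2 (f_ n) g : R[i]^o) @[n --> \oo] --> (innerL2 f g : R[i]^o).

Definition dot xi y : R := \sum_(i < d) (tnth xi i : R) * (tnth y i : R).

Definition add_scaled x (t : R) y : euclidean R d :=
  [tuple (tnth x i : R) + t * (tnth y i : R) | i < d].

Definition expi (t : R) : R[i] := (cos t +i* sin t)%C.

Definition wigner (tau : R) f (z : euclidean R d * euclidean R d) : R[i] :=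
  integralC (leb R d) setT (fun y =>
    expi (- (2 * pi * dot z.2 y)) * f (add_scaled z.1 tau y) *
    conjc (f (add_scaled z.1 (- (1 - tau)) y))).

Definition born_jordan f (z : euclidean R d * euclidean R d) : R[i] :=
  integralC lebesgue_measure `]0, 1[ (fun tau => wigner tau f z).

Variables (Omega : set (phase_space R d)) (p : R).

Definition J_BJ f : \bar R := normLp (leb_phase R d) Omega p (born_jordan f).

Definition BJ_quotient f : \bar R := (J_BJ f / normL2 f ^+ 2)%E.

Definition BJ_quotients : set (\bar R) :=
  [set BJ_quotient f | f in [set f | inL2 f /\ nonzeroL2 f]].

End born_jordan.

Definition critical_exponent (R : realType) (d : nat) : \bar R :=
  if (d <= 2)%N then +oo%E else ((2^-1 - d%:R^-1)^-1)%:E.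

(* Main.v *)
Require Import Defs.
From HB Require Import structures.
From mathcomp Require Import all_boot all_order all_algebra.
From mathcomp Require Import complex.
From mathcomp Require Import all_classical all_reals all_analysis.
From mathcomp Require Import measurable_realfun gauss_integral.
From mathcomp Require Import ring lra.
Set Implicit Arguments.
Unset Strict Implicit.
Unset Printing Implicit Defensive.
Import Order.TTheory GRing.Theory Num.Theory.
Import numFieldNormedType.Exports.
Local Open Scope classical_set_scope.
Local Open Scope ring_scope.

(** The theorem rests on a compactness phenomenon: each tau-Wigner distribution
    is an isometric image of f (x) conj f and has no compactness by itself, but
    averaging over tau creates compactness: a weakly convergent
    sequence f_n -> f has W_BJ f_n -> W_BJ f strongly in L^2 of every set of
    finite measure ([born_jordan_strong]).

    The reason is almost orthogonality in tau. Dually, testing W_tau f against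
    a function G on phase space is testing f (x) conj f against a kernel K_tau,
    the partial Fourier transform of G read in sheared coordinates
    ([wigner_pairing]). Averaging over tau therefore gives
    |<W_BJ f, G>|^2 <= |f|^4 times the double average of the Gram kernel
    Q (tau, sigma) = <K_tau, K_sigma> ([pairing_gram_bound]). For tau <> sigma a
    change of variables turns Q into an oscillatory form, the integral of
    conj G (z') k (z', z) G (z) with a unimodular kernel k
    ([twisted_form]). Take G = G_n, the conjugate of W_BJ f_n - W_BJ f cut to a
    set A of finite measure. Each tau-form is Hilbert-Schmidt, hence continuous
    along the weakly convergent sequence ([hs_form_cvg]), so W_BJ f_n - W_BJ f
    tends to zero against fixed test functions, in particular against
    k (z', .) 1_A; thus the inner integrals of the oscillatory forms tend to zero
    pointwise, Q_n tends to zero off the diagonal, and by dominated convergence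
    the pairings of W_BJ f_n and W_BJ f with G_n tend to zero. Their difference is
    the squared norm of W_BJ f_n - W_BJ f on A.

    To pass from L^2 to L^p one interpolates with a uniform L^q bound, p < q.
    Since |W_tau f| <= (tau (1 - tau))^(-d/2) |f|^2 and W_tau is bounded from L^2
    to L^2 uniformly in tau, Hoelder's inequality in tau with a singular weight
    bounds W_BJ in L^q as soon as (tau (1 - tau))^(-(d/2)(1 - 2/q)) is integrable,
    that is q below the critical exponent ([born_jordan_Lq]). The L^2 bound for
    W_tau needs Bessel's inequality for the Fourier transform, obtained from an
    exponential weight whose transform is a positive approximate unit ([bessel]).

    For the maximizer, the quotient is invariant under scaling, so a maximizing
    sequence can be taken in the unit ball; it has a weakly convergent
    subsequence ([L2_weak_compactness]) and the functional passes to the limit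
    ([BJ_supremum]). Weakly convergent sequences are bounded by the uniform
    boundedness principle ([uniform_boundedness]). Both facts are proved for an
    abstract complete inner product space and applied to L^2, whose completeness
    is [L2_complete]. A Lebesgue measurable set Omega is replaced by a Borel set
    differing from it by a null set ([measurable_hull]). *)

Notation nc := Normc.normc.

(** * Complex-valued measurable and integrable functions *)

Section normc_lemmas.
Context {R : realType}.
Implicit Types z w : R[i].

Lemma nc_ge0 z : 0 <= nc z.
Proof. by case: z => a b; exact: sqrtr_ge0. Qed.

Lemma nc_sqr z : nc z ^+ 2 = complex.Re z ^+ 2 + complex.Im z ^+ 2.
Proof. by case: z => a b /=; rewrite sqr_sqrtr// addr_ge0// sqr_ge0. Qed.

Lemma nc_conj z : nc (conjc z) = nc z.
Proof. by case: z => a b /=; rewrite sqrrN. Qed.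

Lemma le_Re_nc z : `|complex.Re z| <= nc z.
Proof.
by rewrite -(ler_pXn2r (ltn0Sn 1)) ?nnegrE ?nc_ge0// nc_sqr real_normK ?num_real// lerDl sqr_ge0.
Qed.

Lemma le_Im_nc z : `|complex.Im z| <= nc z.
Proof.
by rewrite -(ler_pXn2r (ltn0Sn 1)) ?nnegrE ?nc_ge0// nc_sqr real_normK ?num_real// lerDr sqr_ge0.
Qed.

Lemma le_nc_ReIm z : nc z <= `|complex.Re z| + `|complex.Im z|.
Proof.
rewrite -(ler_pXn2r (ltn0Sn 1)) ?nnegrE ?nc_ge0 ?addr_ge0//.
rewrite nc_sqr sqrrD !real_normK ?num_real// -addrA lerD2l lerDr.
by rewrite mulrn_wge0// mulr_ge0.
Qed.

Lemma nc0 : nc (0 : R[i]) = 0.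
Proof. exact: Normc.normc0. Qed.

Lemma nc_eq0 z : nc z = 0 -> z = 0.
Proof. exact: Normc.eq0_normc. Qed.

Lemma nc_real (a : R) : nc (a%:C)%C = `|a|.
Proof. by rewrite /= expr0n/= addr0 sqrtr_sqr. Qed.

Lemma ReM z w : complex.Re (z * w) =
  complex.Re z * complex.Re w - complex.Im z * complex.Im w.
Proof. by case: z => a b; case: w. Qed.

Lemma ImM z w : complex.Im (z * w) =
  complex.Re z * complex.Im w + complex.Im z * complex.Re w.
Proof. by case: z => a b; case: w => c d /=; rewrite addrC. Qed.

Lemma ReD z w : complex.Re (z + w) = complex.Re z + complex.Re w.
Proof. by case: z => a b; case: w. Qed.

Lemma ImD z w : complex.Im (z + w) = complex.Im z + complex.Im w.
Proof. by case: z => a b; case: w. Qed.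

Lemma ReN z : complex.Re (- z) = - complex.Re z. Proof. by case: z. Qed.
Lemma ImN z : complex.Im (- z) = - complex.Im z. Proof. by case: z. Qed.
Lemma Re_conj z : complex.Re (conjc z) = complex.Re z. Proof. by case: z. Qed.
Lemma Im_conj z : complex.Im (conjc z) = - complex.Im z. Proof. by case: z. Qed.

Lemma complex_eqP z w : complex.Re z = complex.Re w ->
  complex.Im z = complex.Im w -> z = w.
Proof. by case: z => a b; case: w => c d /= -> ->. Qed.

Lemma mul_conj z : z * conjc z = ((nc z ^+ 2)%:C)%C.
Proof.
apply: complex_eqP; rewrite ?ReM ?ImM Re_conj Im_conj /= ?nc_sqr; ring.
Qed.

Lemma nc_phase z : exists2 c : R[i], nc c <= 1 & c * z = ((nc z)%:C)%C.
Proof.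
have [z0|z0] := eqVneq (nc z) 0.
  by exists 0; rewrite ?nc0// z0 mul0r.
exists (((nc z)^-1%:C)%C * conjc z).
  by rewrite Normc.normcM nc_conj nc_real ger0_norm ?invr_ge0 ?nc_ge0// mulVf.
rewrite -mulrA (mulrC (conjc z)) mul_conj.
by apply: complex_eqP; rewrite ?ReM ?ImM/= ?mul0r ?mulr0 ?subr0 ?addr0// expr2 mulKf.
Qed.

End normc_lemmas.

Section cmeas.
Context {d1 d2} {T : measurableType d1} {T' : measurableType d2} {R : realType}.
Implicit Types F G : T -> R[i].

Definition cmeas F : Prop := measurable_fun setT (fun x => complex.Re (F x)) /\
  measurable_fun setT (fun x => complex.Im (F x)).

Lemma cmeas_cst c : cmeas (fun=> c).
Proof. by split; exact: measurable_cst. Qed.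

Lemma cmeasD F G : cmeas F -> cmeas G -> cmeas (fun x => F x + G x).
Proof.
move=> [mF1 mF2] [mG1 mG2]; split.
  by under eq_fun do rewrite ReD; exact: measurable_funD.
by under eq_fun do rewrite ImD; exact: measurable_funD.
Qed.

Lemma cmeasN F : cmeas F -> cmeas (fun x => - F x).
Proof.
move=> [mF1 mF2]; split.
  by under eq_fun do rewrite ReN; exact: measurableT_comp.
by under eq_fun do rewrite ImN; exact: measurableT_comp.
Qed.

Lemma cmeasB F G : cmeas F -> cmeas G -> cmeas (fun x => F x - G x).
Proof. by move=> mF mG; apply: cmeasD => //; exact: cmeasN. Qed.

Lemma cmeasM F G : cmeas F -> cmeas G -> cmeas (fun x => F x * G x).
Proof.
move=> [mF1 mF2] [mG1 mG2]; split.
  by under eq_fun do rewrite ReM; apply: measurable_funB; exact: measurable_funM.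
by under eq_fun do rewrite ImM; apply: measurable_funD; exact: measurable_funM.
Qed.

Lemma cmeas_conj F : cmeas F -> cmeas (fun x => conjc (F x)).
Proof.
move=> [mF1 mF2]; split; first by under eq_fun do rewrite Re_conj.
by under eq_fun do rewrite Im_conj; exact: measurableT_comp.
Qed.

Lemma cmeas_comp F (phi : T' -> T) : measurable_fun setT phi -> cmeas F ->
  measurable_fun setT (fun x => complex.Re (F (phi x))) /\
  measurable_fun setT (fun x => complex.Im (F (phi x))).
Proof.
move=> mphi [mF1 mF2]; split.
  exact: (measurableT_comp mF1 mphi).
exact: (measurableT_comp mF2 mphi).
Qed.

Lemma measurable_nc F : cmeas F -> measurable_fun setT (fun x => nc (F x)).
Proof.
move=> [mF1 mF2].
rewrite (_ : (fun x => _) = (fun x => Num.sqrt (complex.Re (F x) ^+ 2 + complex.Im (F x) ^+ 2))).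
  apply: (measurableT_comp (continuous_measurable_fun (@sqrt_continuous R))).
  by apply: measurable_funD; exact: measurable_funX.
apply/funext => x; rewrite -nc_sqr sqrtr_sqr ger0_norm//; exact: nc_ge0.
Qed.

Lemma measurable_ncE F : cmeas F -> measurable_fun setT (fun x => (nc (F x))%:E).
Proof. by move=> mF; apply/measurable_EFinP; exact: measurable_nc. Qed.

Lemma measurable_nc2E F : cmeas F ->
  measurable_fun setT (fun x => (nc (F x) ^+ 2)%:E).
Proof.
by move=> mF; apply/measurable_EFinP; apply: measurable_funX; exact: measurable_nc.
Qed.

Lemma cmeas_eq F G : F =1 G -> cmeas F -> cmeas G.
Proof. by move=> /funext ->. Qed.

Lemma cmeas_real (f : T -> R) : measurable_fun setT f ->
  cmeas (fun x => ((f x)%:C)%C).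
Proof. by move=> mf; split => //=; exact: measurable_cst. Qed.

End cmeas.

Section cint.
Context {d1} {T : measurableType d1} {R : realType}.
Variable mu : {measure set T -> \bar R}.
Implicit Types F G : T -> R[i].

Definition cint F : Prop :=
  cmeas F /\ (\int[mu]_x (nc (F x))%:E < +oo)%E.

Local Notation intC := (integralC mu setT).

Lemma cint_meas F : cint F -> cmeas F. Proof. by case. Qed.

Lemma cint_nc F : cint F -> mu.-integrable setT (fun x => (nc (F x))%:E).
Proof.
move=> [mF iF]; apply/integrableP; split; first exact: measurable_ncE.
by under eq_integral do rewrite gee0_abs ?lee_fin ?nc_ge0//.
Qed.

Lemma cint_le F (g : T -> \bar R) : cmeas F -> measurable_fun setT g ->
  (forall x, (nc (F x))%:E <= g x)%E -> (\int[mu]_x g x < +oo)%E -> cint F.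
Proof.
move=> mF mg Fg ig; split=> //; apply: le_lt_trans ig.
apply: ge0_le_integral => //=; [by move=> x _; rewrite lee_fin nc_ge0|].
exact: measurable_ncE.
Qed.

Lemma cint_Re F : cint F -> mu.-integrable setT (EFin \o (fun x => complex.Re (F x))).
Proof.
move=> iF; apply: (le_integrable measurableT _ _ (cint_nc iF)).
  by apply/measurable_EFinP; case: iF => -[].
by move=> x _ /=; rewrite lee_fin (ger0_norm (nc_ge0 _)) le_Re_nc.
Qed.

Lemma cint_Im F : cint F -> mu.-integrable setT (EFin \o (fun x => complex.Im (F x))).
Proof.
move=> iF; apply: (le_integrable measurableT _ _ (cint_nc iF)).
  by apply/measurable_EFinP; case: iF => -[].
by move=> x _ /=; rewrite lee_fin (ger0_norm (nc_ge0 _)) le_Im_nc.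
Qed.

Lemma cintP F : mu.-integrable setT (EFin \o (fun x => complex.Re (F x))) ->
  mu.-integrable setT (EFin \o (fun x => complex.Im (F x))) -> cint F.
Proof.
move=> iR iI.
have mF : cmeas F.
  by split; apply/measurable_EFinP; [case/integrableP: iR|case/integrableP: iI].
have /integrableP[ms ims] := integrableD measurableT (integrable_abse iR) (integrable_abse iI).
apply: (cint_le mF _ _ _) => //.
- exact: ms.
- by move=> x /=; rewrite lee_fin le_nc_ReIm.
- move: ims; rewrite /mkset; congr (_ < _)%E; apply: eq_integral => x _.
  by rewrite gee0_abs//= adde_ge0.
Qed.

Lemma cintD F G : cint F -> cint G -> cint (fun x => F x + G x).
Proof.
move=> iF iG; apply: cintP.
  rewrite (_ : _ \o _ = (EFin \o (fun x => complex.Re (F x))) \+ (EFin \o (fun x => complex.Re (G x)))).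
    by apply: integrableD => //; exact: cint_Re.
  by apply/funext => x /=; rewrite ReD.
rewrite (_ : _ \o _ = (EFin \o (fun x => complex.Im (F x))) \+ (EFin \o (fun x => complex.Im (G x)))).
  by apply: integrableD => //; exact: cint_Im.
by apply/funext => x /=; rewrite ImD.
Qed.

Lemma cint_eq F G : F =1 G -> cint F -> cint G.
Proof. by move=> /funext ->. Qed.

Lemma cint_bM F G (k : R) : cmeas G -> (forall x, nc (G x) <= k) ->
  cint F -> cint (fun x => G x * F x).
Proof.
move=> mG Gk [mF iF]; have mGF := cmeasM mG mF; split=> //.
have ncG (x : T) : 0 <= k by apply: le_trans (Gk x); exact: nc_ge0.
apply: (@le_lt_trans _ _ (\int[mu]_x (k%:E * (nc (F x))%:E))%E).
  apply: ge0_le_integral => //=; [by move=> x _; rewrite lee_fin nc_ge0|exact: measurable_ncE| |].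
    by apply: emeasurable_funM; [exact: measurable_cst|exact: measurable_ncE].
  by move=> x _; rewrite -EFinM lee_fin Normc.normcM ler_wpM2r ?nc_ge0.
have [k0|k0] := leP 0 k.
  rewrite ge0_integralZl//=; [by rewrite lte_mul_pinfty| exact: measurable_ncE|].
  by move=> x _; rewrite lee_fin nc_ge0.
rewrite (_ : integral _ _ _ = 0%E)// integral0_eq// => x _.
by move: (lt_le_trans k0 (ncG x)); rewrite ltxx.
Qed.

Lemma cintZ F c : cint F -> cint (fun x => c * F x).
Proof. by move=> iF; apply: (cint_bM (k := nc c)) => //; exact: cmeas_cst. Qed.

Lemma cintN F : cint F -> cint (fun x => - F x).
Proof.
by move=> iF; apply: cint_eq (cintZ (-1) iF) => x; rewrite mulN1r.
Qed.

Lemma cintB F G : cint F -> cint G -> cint (fun x => F x - G x).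
Proof. by move=> iF iG; apply: cintD => //; exact: cintN. Qed.

Lemma cint_conj F : cint F -> cint (fun x => conjc (F x)).
Proof.
move=> [mF iF]; split; first exact: cmeas_conj.
by under eq_integral do rewrite nc_conj.
Qed.

Lemma intCD F G : cint F -> cint G ->
  intC (fun x => F x + G x) = intC F + intC G.
Proof.
move=> iF iG; apply: complex_eqP; rewrite ?ReD ?ImD /=.
  under eq_Rintegral do rewrite ReD.
  by rewrite RintegralD//; exact: cint_Re.
under eq_Rintegral do rewrite ImD.
by rewrite RintegralD//; exact: cint_Im.
Qed.

Lemma intCZ F c : cint F -> intC (fun x => c * F x) = c * intC F.
Proof.
move=> iF; have iR := cint_Re iF; have iI := cint_Im iF.
have Zi k f : mu.-integrable setT (EFin \o f) -> mu.-integrable setT (EFin \o (fun x => k * f x)).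
  move=> i; rewrite (_ : _ \o _ = (fun x => k%:E * (EFin \o f) x)%E); first exact: integrableZl.
  by apply/funext => x /=; rewrite EFinM.
apply: complex_eqP; rewrite ?ReM ?ImM /=.
  under eq_Rintegral do rewrite ReM.
  by rewrite RintegralB ?RintegralZl//; apply: Zi.
under eq_Rintegral do rewrite ImM.
by rewrite RintegralD ?RintegralZl//; apply: Zi.
Qed.

Lemma intCN F : cint F -> intC (fun x => - F x) = - intC F.
Proof.
move=> iF; rewrite -mulN1r -intCZ//; congr (integralC _ _ _).
by apply/funext => x; rewrite mulN1r.
Qed.

Lemma intCB F G : cint F -> cint G ->
  intC (fun x => F x - G x) = intC F - intC G.
Proof. by move=> iF iG; rewrite intCD ?intCN//; exact: cintN. Qed.

Lemma intC_conj F : cint F -> intC (fun x => conjc (F x)) = conjc (intC F).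
Proof.
move=> iF; apply: complex_eqP; rewrite ?Re_conj ?Im_conj /=.
  by apply: eq_Rintegral => x _; rewrite Re_conj.
under eq_Rintegral do rewrite Im_conj -mulN1r.
by rewrite RintegralZl ?mulN1r//; exact: cint_Im.
Qed.

Lemma intC_real (f : T -> R) : intC (fun x => ((f x)%:C)%C) = ((\int[mu]_x f x)%:C)%C.
Proof.
by apply: complex_eqP => //=; rewrite Rintegral_cst// mul0r.
Qed.

Lemma nc_intC_le F : cmeas F ->
  ((nc (intC F))%:E <= \int[mu]_x (nc (F x))%:E)%E.
Proof.
move=> mF; have [iF|] := ltP (\int[mu]_x (nc (F x))%:E)%E (+oo)%E; last first.
  by move=> h; apply: le_trans h; rewrite leey.
have cF : cint F by [].
have [c c1 cE] := nc_phase (intC F).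
have := congr1 (@complex.Re R) cE; rewrite -intCZ//= => <-.
have ->: ((\int[mu]_x complex.Re (c * F x))%:E = \int[mu]_x (complex.Re (c * F x))%:E)%E.
  rewrite /Rintegral fineK//; apply: integrable_fin_num => //.
  by have /cint_Re := cintZ c cF.
apply: le_integral => //; [exact: (cint_Re (cintZ c cF))|exact: cint_nc|].
move=> x _; rewrite lee_fin; apply: le_trans (ler_norm _) _.
by apply: le_trans (le_Re_nc _) _; rewrite Normc.normcM ler_piMl ?nc_ge0.
Qed.

Lemma intC_ae_eq F G : cmeas F -> cmeas G -> {ae mu, forall x, F x = G x} ->
  intC F = intC G.
Proof.
move=> [mF1 mF2] [mG1 mG2] FG; apply: complex_eqP => /=.
  congr fine; apply: ae_eq_integral => //; [exact/measurable_EFinP..|].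
  by apply: filterS FG => x -> _.
congr fine; apply: ae_eq_integral => //; [exact/measurable_EFinP..|].
by apply: filterS FG => x -> _.
Qed.

Lemma eq_intC F G : F =1 G -> intC F = intC G.
Proof. by move=> /funext ->. Qed.

End cint.

(** * Limit theorems, change of variables and Fubini for complex integrals *)

Section cint_ae.
Context {d1} {T : measurableType d1} {R : realType}.
Variable mu : {measure set T -> \bar R}.
Implicit Types F G : T -> R[i].

Lemma ae_imp (P Q : T -> Prop) : {ae mu, forall x, P x} -> (forall x, P x -> Q x) ->
  {ae mu, forall x, Q x}.
Proof. by move=> aeP PQ; apply: filterS aeP. Qed.

Lemma ae_ltey (f : T -> \bar R) : measurable_fun setT f -> (forall x, 0 <= f x)%E ->
  (\int[mu]_x f x < +oo)%E -> {ae mu, forall x, (f x < +oo)%E}.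
Proof.
move=> mf f0 fi.
have /(integrable_ae measurableT) : mu.-integrable setT f.
  by apply/integrableP; split=> //; under eq_integral do rewrite gee0_abs//.
by apply: filterS => x /(_ I); rewrite ge0_fin_numE.
Qed.

(** Bounding the squared norms by real numbers keeps the arithmetic of extended
    reals out of the applications. *)
Lemma cauchy_schwarz_ge0 (f g : T -> R) (a b : R) :
  measurable_fun setT f -> measurable_fun setT g ->
  (forall x, 0 <= f x) -> (forall x, 0 <= g x) -> 0 <= a -> 0 <= b ->
  (\int[mu]_x (f x ^+ 2)%:E <= a%:E)%E -> (\int[mu]_x (g x ^+ 2)%:E <= b%:E)%E ->
  (\int[mu]_x (f x * g x)%:E <= (Num.sqrt (a * b))%:E)%E.
Proof.
move=> mf mg f0 g0 a0 b0 fa gb.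
have H := @hoelder _ T R mu _ _ 2 2 mf mg.
have E h c : (forall x, 0 <= h x) -> 0 <= c -> (\int[mu]_x (h x ^+ 2)%:E <= c%:E)%E ->
    (Lnorm mu 2%:E (EFin \o h) <= (Num.sqrt c)%:E)%E.
  move=> h0 c0 hc; rewrite unlock.
  under eq_integral => x _ do rewrite /= ger0_norm// powR_mulrn//.
  rewrite -powR12_sqrt// -poweR_EFin; apply: gt0_ler_poweR => //=.
  - by rewrite in_itv/= leey integral_ge0// => x _; rewrite lee_fin sqr_ge0.
  - by rewrite in_itv/= leey lee_fin c0.
have {}H : (Lnorm mu 1 (EFin \o (f \* g)%R) <= Lnorm mu 2%:E (EFin \o f) * Lnorm mu 2%:E (EFin \o g))%E.
  by apply: H; rewrite //; lra.
have -> : (\int[mu]_x (f x * g x)%:E = Lnorm mu 1 (EFin \o (f \* g)%R))%E.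
  by rewrite Lnorm1; apply: eq_integral => x _ /=; rewrite ger0_norm// mulr_ge0.
apply: le_trans H _; rewrite sqrtrM// EFinM; apply: lee_pmul; rewrite ?Lnorm_ge0//; exact: E.
Qed.

Lemma cint_mul F G (a b : R) : cmeas F -> cmeas G -> 0 <= a -> 0 <= b ->
  (\int[mu]_x (nc (F x) ^+ 2)%:E <= a%:E)%E ->
  (\int[mu]_x (nc (G x) ^+ 2)%:E <= b%:E)%E ->
  cint mu (fun x => F x * G x) /\
  nc (integralC mu setT (fun x => F x * G x)) <= Num.sqrt (a * b).
Proof.
move=> mF mG a0 b0 Fa Gb.
have H := cauchy_schwarz_ge0 (measurable_nc mF) (measurable_nc mG)
  (fun x => nc_ge0 _) (fun x => nc_ge0 _) a0 b0 Fa Gb.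
have mFG := cmeasM mF mG.
have H' : (\int[mu]_x (nc (F x * G x))%:E <= (Num.sqrt (a * b))%:E)%E.
  by apply: le_trans H; under eq_integral do rewrite Normc.normcM.
split; last by rewrite -lee_fin; apply: le_trans (nc_intC_le mu mFG) _.
by split=> //; apply: le_lt_trans H' _; rewrite ltry.
Qed.

Lemma dominated_cvg0 (g_ : nat -> T -> \bar R) (h : T -> \bar R) :
  (forall n, measurable_fun setT (g_ n)) -> (forall n x, 0 <= g_ n x)%E ->
  {ae mu, forall x n, (g_ n x <= h x)%E} -> measurable_fun setT h ->
  (\int[mu]_x h x < +oo)%E -> (forall x, 0 <= h x)%E ->
  {ae mu, forall x, g_ ^~ x @ \oo --> 0%E} ->
  (\int[mu]_x g_ n x)%E @[n --> \oo] --> 0%E.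
Proof.
move=> mg g0 gh mh ih h0 gcvg.
have ihh : mu.-integrable setT h.
  by apply/integrableP; split=> //; under eq_integral do rewrite gee0_abs//.
have [] := @dominated_convergence _ _ _ mu setT measurableT g_ (cst 0%E) h.
- exact: mg.
- exact: measurable_cst.
- by apply: filterS gcvg => x gx _.
- exact: ihh.
- by apply: filterS gh => x gx n _; rewrite gee0_abs.
move=> _ _; rewrite integral0; exact.
Qed.

Lemma fatou_bound (g_ : nat -> T -> \bar R) (f : T -> \bar R) (C : \bar R) :
  (forall n, measurable_fun setT (g_ n)) -> (forall n x, 0 <= g_ n x)%E ->
  measurable_fun setT f -> (forall x, 0 <= f x)%E ->
  {ae mu, forall x, g_ ^~ x @ \oo --> f x} ->
  (forall n, \int[mu]_x g_ n x <= C)%E -> (\int[mu]_x f x <= C)%E.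
Proof.
move=> mg g0 mf f0 gf gC.
have ml : measurable_fun setT (fun x => limn_einf (g_ ^~ x)).
  under eq_fun => x.
    rewrite (_ : g_ ^~ x = (-%E \o (fun n => - g_ n x)%E)) ?limn_einfN; last first.
      by apply/funext => n /=; rewrite oppeK.
    over.
  have ml := @measurable_fun_limn_esup _ T R setT (fun n x => - g_ n x)%E
    (fun n => measurableT_comp (@oppe_measurable R setT) (mg n)).
  exact: (measurableT_comp (@oppe_measurable R setT) ml).
have H := @fatou _ _ _ mu setT measurableT g_ mg (fun n x _ => g0 n x).
rewrite (ae_eq_integral (fun x => limn_einf (g_ ^~ x)))//; last first.
  apply: filterS gf => x gx _; apply/esym.
  by rewrite is_cvg_limn_einfE; [exact/cvg_lim|apply/cvg_ex; eexists; exact: gx].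
apply: le_trans H _; rewrite limn_einf_lim; apply: lime_le; first exact: is_cvg_einfs.
by apply: nearW => n; apply: le_trans (gC n); apply: ereal_inf_lbound; exists n => /=.
Qed.

End cint_ae.

(** A change of variables phi with constant Jacobian factor c, tested on
    nonnegative functions. *)
Definition scales_integral d1 d2 (X : measurableType d1) (Y : measurableType d2)
    (R : realType) (mu : {measure set X -> \bar R}) (nu : {measure set Y -> \bar R})
    (phi : X -> Y) (c : R) : Prop :=
  forall f : Y -> \bar R, measurable_fun setT f -> (forall y, 0 <= f y)%E ->
    (\int[mu]_x f (phi x) = c%:E * \int[nu]_y f y)%E.

Section change_of_variables.
Context {d1 d2} {X : measurableType d1} {Y : measurableType d2} {R : realType}.
Variables (mu : {measure set X -> \bar R}) (nu : {measure set Y -> \bar R}).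
Variables (phi : X -> Y) (c : R).
Hypothesis mphi : measurable_fun setT phi.
Hypothesis c0 : 0 <= c.
Hypothesis cov : scales_integral mu nu phi c.

Lemma cint_cov (F : Y -> R[i]) : cint nu F -> cint mu (fun x => F (phi x)).
Proof.
move=> [mF iF]; split; first exact: cmeas_comp mphi mF.
rewrite (cov (f := fun y => (nc (F y))%:E)); [|exact: measurable_ncE|by move=> y; rewrite lee_fin nc_ge0].
by rewrite lte_mul_pinfty.
Qed.

Lemma Rintegral_cov (f : Y -> R) : nu.-integrable setT (EFin \o f) ->
  \int[mu]_x f (phi x) = c * \int[nu]_y f y.
Proof.
move=> i; have mf := measurable_int _ i.
have ip := integrable_pos_fin_num measurableT i.
have ine := integrable_neg_fin_num measurableT i.
rewrite /Rintegral integralE (integralE nu).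
have -> : (\int[mu]_x (fun x => (f (phi x))%:E)^\+ x = c%:E * \int[nu]_x (EFin \o f)^\+ x)%E.
  by rewrite -cov//; [apply: eq_integral => x _; rewrite !funeposE|exact: measurable_funepos].
have -> : (\int[mu]_x (fun x => (f (phi x))%:E)^\- x = c%:E * \int[nu]_x (EFin \o f)^\- x)%E.
  by rewrite -cov//; [apply: eq_integral => x _; rewrite !funenegE|exact: measurable_funeneg].
rewrite -(fineK ip) -(fineK ine) -!EFinM -!EFinB /= mulrBr; congr (_ - _).
Qed.

Lemma intC_cov (F : Y -> R[i]) : cint nu F ->
  integralC mu setT (fun x => F (phi x)) = (c%:C)%C * integralC nu setT F.
Proof.
move=> iF; apply: complex_eqP; rewrite ?ReM ?ImM /= !mul0r ?subr0 ?addr0.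
  by rewrite (Rintegral_cov (cint_Re iF)).
by rewrite (Rintegral_cov (cint_Im iF)).
Qed.

End change_of_variables.

Section product_sigma_finite.
Context {d1 d2} {T1 : measurableType d1} {T2 : measurableType d2} {R : realType}.
Variable m1 : {sigma_finite_measure set T1 -> \bar R}.
Variable m2 : {sigma_finite_measure set T2 -> \bar R}.

Lemma product_sigma_finite : sigma_finite setT (m1 \x m2)%E.
Proof.
have /sigma_finiteP[F [TF ndF Foo]] := sigma_finiteT m1.
have /sigma_finiteP[G [TG ndG Goo]] := sigma_finiteT m2.
exists (fun n => F n `*` G n).
  rewrite -setXTT TF TG predeqE => -[x y]; split.
    move=> [/= [n _ Fnx] [k _ Gky]]; exists (maxn n k) => //; split.
    - by move: x Fnx; exact/subsetPset/ndF/leq_maxl.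
    - by move: y Gky; exact/subsetPset/ndG/leq_maxr.
  by move=> [n _ []/= ? ?]; split; exists n.
move=> k; have [? ?] := Foo k; have [? ?] := Goo k.
split; first exact: measurableX.
by rewrite product_measure1E// lte_mul_pinfty// ge0_fin_numE.
Qed.

(** The product measure, packaged as a sigma-finite measure so that products
    can be iterated. *)
Definition prodm : set (T1 * T2)%type -> \bar R := (m1 \x m2)%E.

HB.instance Definition _ := Measure.on prodm.

HB.instance Definition _ :=
  Measure_isSigmaFinite.Build _ _ _ prodm product_sigma_finite.

End product_sigma_finite.

Section fubini_complex.
Context {d1 d2} {T1 : measurableType d1} {T2 : measurableType d2} {R : realType}.
Variable m1 : {sigma_finite_measure set T1 -> \bar R}.
Variable m2 : {sigma_finite_measure set T2 -> \bar R}.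
Implicit Types F : T1 * T2 -> R[i].

Lemma cmeas_sec1 F x : cmeas F -> cmeas (fun y => F (x, y)).
Proof. by move=> mF; apply: cmeas_comp mF; exact: measurable_pair1. Qed.

Lemma cmeas_sec2 F y : cmeas F -> cmeas (fun x => F (x, y)).
Proof. by move=> mF; apply: cmeas_comp mF; exact: measurable_pair2. Qed.

Lemma measurable_Rintegral1 (f : T1 * T2 -> R) : measurable_fun setT f ->
  measurable_fun setT (fun x => \int[m2]_y f (x, y)).
Proof.
move=> /measurable_EFinP mf; apply: (measurableT_comp (fine_measurable measurableT)).
under eq_fun do rewrite integralE.
apply: emeasurable_funB.
  rewrite (_ : (fun x => _) = fubini_F m2 (EFin \o f)^\+%E).
    by apply: measurable_fun_fubini_tonelli_F => //; exact: measurable_funepos.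
  by apply/funext => x; apply: eq_integral => y _; rewrite !funeposE.
rewrite (_ : (fun x => _) = fubini_F m2 (EFin \o f)^\-%E).
  by apply: measurable_fun_fubini_tonelli_F => //; exact: measurable_funeneg.
by apply/funext => x; apply: eq_integral => y _; rewrite !funenegE.
Qed.

Lemma measurable_Rintegral2 (f : T1 * T2 -> R) : measurable_fun setT f ->
  measurable_fun setT (fun y => \int[m1]_x f (x, y)).
Proof.
move=> /measurable_EFinP mf; apply: (measurableT_comp (fine_measurable measurableT)).
under eq_fun do rewrite integralE.
apply: emeasurable_funB.
  rewrite (_ : (fun x => _) = fubini_G m1 (EFin \o f)^\+%E).
    by apply: measurable_fun_fubini_tonelli_G => //; exact: measurable_funepos.
  by apply/funext => x; apply: eq_integral => y _; rewrite !funeposE.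
rewrite (_ : (fun x => _) = fubini_G m1 (EFin \o f)^\-%E).
  by apply: measurable_fun_fubini_tonelli_G => //; exact: measurable_funeneg.
by apply/funext => x; apply: eq_integral => y _; rewrite !funenegE.
Qed.

Lemma cmeas_int1 F : cmeas F -> cmeas (fun x => integralC m2 setT (fun y => F (x, y))).
Proof. by move=> [mF1 mF2]; split => /=; exact: (measurable_Rintegral1 (f := fun z => _ (F z))). Qed.

Lemma cmeas_int2 F : cmeas F -> cmeas (fun y => integralC m1 setT (fun x => F (x, y))).
Proof. by move=> [mF1 mF2]; split => /=; exact: (measurable_Rintegral2 (f := fun z => _ (F z))). Qed.

Local Open Scope ereal_scope.

Lemma cint1P F : cmeas F -> \int[m1]_x \int[m2]_y (nc (F (x, y)))%:E < +oo ->
  cint (m1 \x m2) F.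
Proof.
move=> mF iF; split=> //.
by rewrite fubini_tonelli1//; [exact: measurable_ncE|move=> z; rewrite lee_fin nc_ge0].
Qed.

Lemma cint1_lt F : cint (m1 \x m2) F -> \int[m1]_x \int[m2]_y (nc (F (x, y)))%:E < +oo.
Proof.
move=> [mF]; rewrite fubini_tonelli1//; [exact: measurable_ncE|by move=> z; rewrite lee_fin nc_ge0].
Qed.

Lemma cint2_lt F : cint (m1 \x m2) F -> \int[m2]_y \int[m1]_x (nc (F (x, y)))%:E < +oo.
Proof.
move=> [mF]; rewrite fubini_tonelli2//; [exact: measurable_ncE|by move=> z; rewrite lee_fin nc_ge0].
Qed.

Lemma measurable_int_nc1 F : cmeas F ->
  measurable_fun setT (fun x => \int[m2]_y (nc (F (x, y)))%:E).
Proof.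
move=> mF; apply: (measurable_fun_fubini_tonelli_F (fun z => (nc (F z))%:E)); first exact: measurable_ncE.
by move=> z; rewrite lee_fin nc_ge0.
Qed.

Lemma measurable_int_nc2 F : cmeas F ->
  measurable_fun setT (fun y => \int[m1]_x (nc (F (x, y)))%:E).
Proof.
move=> mF; apply: (measurable_fun_fubini_tonelli_G (fun z => (nc (F z))%:E)); first exact: measurable_ncE.
by move=> z; rewrite lee_fin nc_ge0.
Qed.

Lemma ae_cint1 F : cint (m1 \x m2) F -> {ae m1, forall x, cint m2 (fun y => F (x, y))}.
Proof.
move=> iF; have H : {ae m1, forall x, \int[m2]_y (nc (F (x, y)))%:E < +oo}.
  apply: ae_ltey; [exact: measurable_int_nc1 (cint_meas iF)| |exact: cint1_lt].
  by move=> ?; apply: integral_ge0 => ? _; rewrite lee_fin nc_ge0.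
by apply: filterS H => ? ?; split => //; exact: cmeas_sec1 (cint_meas iF).
Qed.

Lemma ae_cint2 F : cint (m1 \x m2) F -> {ae m2, forall y, cint m1 (fun x => F (x, y))}.
Proof.
move=> iF; have H : {ae m2, forall y, \int[m1]_x (nc (F (x, y)))%:E < +oo}.
  apply: ae_ltey; [exact: measurable_int_nc2 (cint_meas iF)| |exact: cint2_lt].
  by move=> ?; apply: integral_ge0 => ? _; rewrite lee_fin nc_ge0.
by apply: filterS H => ? ?; split => //; exact: cmeas_sec2 (cint_meas iF).
Qed.

Lemma cint_int1 F : cint (m1 \x m2) F ->
  cint m1 (fun x => integralC m2 setT (fun y => F (x, y))).
Proof.
move=> iF; apply: (@cint_le _ _ _ m1 _ (fun x => \int[m2]_y (nc (F (x, y)))%:E)).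
- exact: cmeas_int1 (cint_meas iF).
- exact: measurable_int_nc1 (cint_meas iF).
- by move=> x; apply: nc_intC_le; exact: cmeas_sec1 (cint_meas iF).
- exact: cint1_lt.
Qed.

Lemma cint_int2 F : cint (m1 \x m2) F ->
  cint m2 (fun y => integralC m1 setT (fun x => F (x, y))).
Proof.
move=> iF; apply: (@cint_le _ _ _ m2 _ (fun y => \int[m1]_x (nc (F (x, y)))%:E)).
- exact: cmeas_int2 (cint_meas iF).
- exact: measurable_int_nc2 (cint_meas iF).
- by move=> x; apply: nc_intC_le; exact: cmeas_sec2 (cint_meas iF).
- exact: cint2_lt.
Qed.

Lemma Rintegral12 (f : T1 * T2 -> R) : (m1 \x m2).-integrable setT (EFin \o f) ->
  (\int[m1]_x (\int[m2]_y f (x, y)) = \int[m1 \x m2]_z f z)%R.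
Proof.
move=> i; congr fine; rewrite -(integral12_prod_meas1 i); apply: ae_eq_integral => //.
- by apply/measurable_EFinP; apply: measurable_Rintegral1; apply/measurable_EFinP; exact: measurable_int i.
- exact: (measurable_fubini_F i).
- apply: filterS (ae_integrable1 i) => x ix _.
  by rewrite /Rintegral/= fineK//; exact: integrable_fin_num.
Qed.

Lemma Rintegral21 (f : T1 * T2 -> R) : (m1 \x m2).-integrable setT (EFin \o f) ->
  (\int[m2]_y (\int[m1]_x f (x, y)) = \int[m1 \x m2]_z f z)%R.
Proof.
move=> i; congr fine; rewrite -(integral21_prod_meas1 i); apply: ae_eq_integral => //.
- by apply/measurable_EFinP; apply: measurable_Rintegral2; apply/measurable_EFinP; exact: measurable_int i.
- exact: (measurable_fubini_G i).
- apply: filterS (ae_integrable2 i) => x ix _.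
  by rewrite /Rintegral/= fineK//; exact: integrable_fin_num.
Qed.

Lemma intC12 F : cint (m1 \x m2) F ->
  integralC m1 setT (fun x => integralC m2 setT (fun y => F (x, y))) =
  integralC (m1 \x m2) setT F.
Proof.
move=> iF; apply: complex_eqP => /=.
  exact: (Rintegral12 (cint_Re iF)).
exact: (Rintegral12 (cint_Im iF)).
Qed.

Lemma intC21 F : cint (m1 \x m2) F ->
  integralC m2 setT (fun y => integralC m1 setT (fun x => F (x, y))) =
  integralC (m1 \x m2) setT F.
Proof.
move=> iF; apply: complex_eqP => /=.
  exact: (Rintegral21 (cint_Re iF)).
exact: (Rintegral21 (cint_Im iF)).
Qed.

Lemma intC_swap F : cint (m1 \x m2) F ->
  integralC m1 setT (fun x => integralC m2 setT (fun y => F (x, y))) =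
  integralC m2 setT (fun y => integralC m1 setT (fun x => F (x, y))).
Proof. by move=> iF; rewrite intC12// intC21. Qed.

End fubini_complex.

(** * Affine changes of variables in euclidean space *)

Section affine_line.
Context {R : realType}.
Local Notation mu := (@lebesgue_measure R).

Lemma measurable_affine (x t : R) :
  measurable_fun setT ((fun y => x + t * y) : measurableTypeR R -> measurableTypeR R).
Proof. by apply: measurable_funD => //; exact: measurable_funM. Qed.

Lemma affine_preimage_itv (x t a b : R) : t != 0 ->
  mu ((fun y => x + t * y) @^-1` `]a, b]) = (`|t|^-1%:E * mu `]a, b])%E.
Proof.
move=> t0; rewrite lebesgue_measure_itv /= lte_fin.
have [tp|tn] := ltP 0 t.
  rewrite (_ : _ @^-1` _ = `](a - x) / t, (b - x) / t]%classic); last first.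
    apply/seteqP; split=> y /=; rewrite !in_itv/= ltr_pdivrMr// ler_pdivlMr// ltrBlDl lerBrDl;
      by rewrite (mulrC y).
  rewrite lebesgue_measure_itv /= lte_fin ltr_pM2r ?invr_gt0// ltrD2r.
  case: ifPn => ab; last by rewrite mule0.
  rewrite gtr0_norm// -!EFinB -EFinM; congr EFin.
  by rewrite -mulrBl opprB addrA subrK mulrC.
have {}tn : t < 0 by rewrite lt_neqAle t0.
rewrite (_ : _ @^-1` _ = `[(b - x) / t, (a - x) / t[%classic); last first.
  apply/seteqP; split=> y /=; rewrite !in_itv/= ler_ndivrMr// ltr_ndivlMr// ltrBlDl lerBrDl (mulrC y);
    by rewrite andbC.
rewrite lebesgue_measure_itv /= lte_fin ltr_nM2r ?invr_lt0// ltrD2r.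
case: ifPn => ab; last by rewrite mule0.
rewrite ltr0_norm// -!EFinB -EFinM; congr EFin.
by rewrite -mulrBl opprB addrA subrK invrN mulrC mulNr -mulrN opprB.
Qed.

(** Lebesgue measure is characterized by its values on intervals, so the
    formula only has to be checked on preimages of intervals. *)
Lemma integral_affine (x t : R) (f : measurableTypeR R -> \bar R) : t != 0 ->
  measurable_fun setT f -> (forall y, 0 <= f y)%E ->
  (\int[mu]_y f (x + t * y)%R = `|t|^-1%:E * \int[mu]_y f y)%E.
Proof.
move=> t0 mf f0.
have tp : 0 <= `|t| by [].
pose phi := ((fun y => x + t * y) : measurableTypeR R -> measurableTypeR R).
pose nu : {measure set (measurableTypeR R) -> \bar R} :=
  mscale (NngNum tp) (measure_function_pushforward__canonical__measure_function_Measure mu (measurable_affine x t)).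
have E A : measurable A -> mu A = nu A.
  apply: lebesgue_measure_unique => _ [[a b] _ <-].
  rewrite /nu /= /mscale/= /pushforward/= affine_preimage_itv//.
  by rewrite muleA -EFinM mulfV ?normr_eq0// mul1e.
rewrite [in RHS](eq_measure_integral nu); last by move=> A mA _; exact: E.
rewrite ge0_integral_mscale//= muleA -EFinM mulVf ?normr_eq0// mul1e.
by rewrite (ge0_integral_pushforward (measurable_affine x t)).
Qed.

End affine_line.

Section leb_integral.
Context {R : realType}.

Lemma integral_leb_cons n (f : euclidean R n.+1 -> \bar R) :
  measurable_fun setT f -> (forall y, 0 <= f y)%E ->
  (\int[leb R n.+1]_y f y =
   \int[lebesgue_measure \x leb R n]_z f (tuple_cons z))%E.
Proof.
by move=> mf f0; rewrite /= /lebesgue_cons (ge0_integral_pushforward measurable_tuple_cons).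
Qed.

Lemma measurable_add_scaled n d (T : measurableType d) (a c : T -> euclidean R n) (b : T -> R) :
  measurable_fun setT a -> measurable_fun setT b -> measurable_fun setT c ->
  measurable_fun setT (fun z => add_scaled (a z) (b z) (c z)).
Proof.
move=> ma mb mc; apply/measurable_fun_tnthP => i.
rewrite (_ : _ \o _ = (fun z => (tnth (a z) i : R) + b z * tnth (c z) i)); last first.
  by apply/funext => z /=; rewrite tnth_mktuple.
apply: measurable_funD; first exact: (measurableT_comp (measurable_tnth i) ma).
by apply: measurable_funM => //; exact: (measurableT_comp (measurable_tnth i) mc).
Qed.

Lemma measurable_dot n d (T : measurableType d) (a c : T -> euclidean R n) :
  measurable_fun setT a -> measurable_fun setT c ->
  measurable_fun setT (fun z => dot (a z) (c z)).
Proof.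
move=> ma mc; apply: measurable_sum => i.
apply: measurable_funM; first exact: (measurableT_comp (measurable_tnth i) ma).
exact: (measurableT_comp (measurable_tnth i) mc).
Qed.

Lemma add_scaled_cons n (x : euclidean R n.+1) t z :
  add_scaled x t (tuple_cons z) =
  tuple_cons ((tnth x ord0 : R) + t * z.1, add_scaled [tuple of behead x] t z.2).
Proof.
apply: eq_from_tnth => i; rewrite tnth_mktuple.
have [j ->|->] := unliftP ord0 i.
  rewrite /tuple_cons !tnthS tnth_mktuple; congr (_ + _).
  by rewrite [in LHS](tuple_eta x) tnthS.
by rewrite /tuple_cons.
Qed.

(** Induction on the dimension: Lebesgue measure on R^(n+1) is a product, and
    the affine map acts coordinatewise. *)
Lemma integral_add_scaled n (x : euclidean R n) (t : R) (f : euclidean R n -> \bar R) :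
  t != 0 -> measurable_fun setT f -> (forall y, 0 <= f y)%E ->
  (\int[leb R n]_y f (add_scaled x t y) = (`|t| ^- n)%:E * \int[leb R n]_y f y)%E.
Proof.
move=> t0; elim: n x f => [|n IHn] x f mf f0.
  rewrite expr0 invr1 mul1e; apply: eq_integral => y _; congr f.
  by rewrite (tuple0 y) (tuple0 (add_scaled _ _ _)).
have mc : measurable_fun setT (fun z => f (tuple_cons z)).
  exact: measurableT_comp mf measurable_tuple_cons.
rewrite !integral_leb_cons//; last first.
  by apply: (measurableT_comp mf); apply: measurable_add_scaled.
rewrite !fubini_tonelli1//; last first.
  apply: (measurableT_comp mf); apply: measurable_add_scaled => //.
  exact: measurable_tuple_cons.
rewrite /fubini_F /=.
under eq_integral => a _.
  under eq_integral => y _ do rewrite add_scaled_cons/=.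
  rewrite (IHn _ (fun y => f (tuple_cons (_, y))))//; last first.
    exact: (measurableT_comp mc (measurable_pair1 _)).
  over.
rewrite ge0_integralZl//=; last 2 first.
- exact: (measurableT_comp (measurable_fun_fubini_tonelli_F (fun z => f (tuple_cons z)) mc (fun=> f0 _)) (measurable_affine _ _)).
- by move=> a _; exact: integral_ge0.
rewrite (@integral_affine _ (tnth x ord0) t (fun a => \int[leb R n]_y f (tuple_cons (a, y)))%E)//.
- by rewrite muleA -EFinM -invfM -exprSr.
- exact: (measurable_fun_fubini_tonelli_F (fun z => f (tuple_cons z))).
- by move=> a; exact: integral_ge0.
Qed.

Definition scale_tuple n (t : R) (y : euclidean R n) : euclidean R n :=
  [tuple t * (tnth y i : R) | i < n].

Lemma add_scaledC n (x y : euclidean R n) t :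
  add_scaled x t y = add_scaled (scale_tuple t y) 1 x.
Proof. by apply: eq_from_tnth => i; rewrite !tnth_mktuple mul1r addrC. Qed.

Lemma integral_translate n (y : euclidean R n) (t : R) (f : euclidean R n -> \bar R) :
  measurable_fun setT f -> (forall y, 0 <= f y)%E ->
  (\int[leb R n]_x f (add_scaled x t y) = \int[leb R n]_x f x)%E.
Proof.
move=> mf f0; under eq_integral do rewrite add_scaledC.
by rewrite integral_add_scaled ?oner_neq0// normr1 expr1n invr1 mul1e.
Qed.

End leb_integral.

(** * The Fourier transform of an exponential weight *)

Section exponential_weight.
Context {R : realType}.
Local Notation mu := (@lebesgue_measure R).

Lemma is_derive_expRN (t : R) : is_derive t 1 (fun t : R => expR (- t)) (- expR (- t)).
Proof.
have := @is_derive1_comp R expR -%R t (expR (- t)) (-1).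
rewrite mulrN1; apply; exact: is_deriveNid.
Qed.

Lemma is_derive_scaled (f : R -> R) (s t a : R) : is_derive (s * t) 1 f a ->
  is_derive t 1 (fun t : R => f (s * t)) (a * s).
Proof.
move=> fd; apply: (@is_derive1_comp R f (fun t => s * t)) => //.
by apply: is_derive_eq; rewrite -[LHS]/(s * 1) mulr1.
Qed.

(** An explicit primitive is available; adding 1 to the cosine makes the
    integrand nonnegative, so that the fundamental theorem of calculus applies
    directly on the half-line. *)
Lemma integral_exp_1Dcos (s : R) :
  (\int[mu]_(t in `[0%R, +oo[) (expR (- t) * (1 + cos (s * t)))%:E =
   (1 + (1 + s ^+ 2)^-1)%:E)%E.
Proof.
have s1 : 1 + s ^+ 2 != 0 by rewrite gt_eqF// ltr_wpDr// sqr_ge0.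
pose F t := expR (- t) * ((s * sin (s * t) - cos (s * t)) / (1 + s ^+ 2) - 1).
have dF (t : R) : is_derive t 1 F (expR (- t) * (1 + cos (s * t))).
  have d1 := is_derive_expRN t.
  have d2 := is_derive_scaled (is_derive_sin (s * t)).
  have d3 := is_derive_scaled (is_derive_cos (s * t)).
  rewrite /F.
  by apply: is_derive_eq; rewrite /GRing.scale/=; field.
rewrite (@ge0_continuous_FTC2y _ _ F _ 0) //.
- rewrite /F oppr0 expR0 mulr0 sin0 mulr0 cos0 -EFinB; congr EFin; field.
  exact: s1.
- apply: continuous_subspaceT => t; apply: differentiable_continuous.
  apply/derivable1_diffP.
  have d1 := is_derive_expRN t.
  have d3 := is_derive_scaled (is_derive_cos (s * t)).
  by apply: ex_derive.
- apply/norm_cvg0P; apply: (@squeeze_cvgr _ _ _ _ (fun=> 0) (fun t => expR (- t) * (`|s| + 2))).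
  + near=> t; rewrite normr_ge0/= /F normrM ger0_norm ?expR_ge0// ler_wpM2l ?expR_ge0//.
    apply: le_trans (ler_normB _ _) _; rewrite normr1.
    suff: `|(s * sin (s * t) - cos (s * t)) / (1 + s ^+ 2)| <= `|s| + 1 by lra.
    have s1p : 1 <= 1 + s ^+ 2 by rewrite lerDl sqr_ge0.
    rewrite normrM normfV (ger0_norm (le_trans ler01 s1p)) ler_pdivrMr ?(lt_le_trans ltr01)//.
    apply: (@le_trans _ _ (`|s| + 1)); last by rewrite ler_peMr.
    apply: le_trans (ler_normB _ _) _; apply: lerD; last exact: cos_max.
    by rewrite normrM ler_piMr// sin_max.
  + exact: cvg_cst.
  + rewrite -(mul0r (`|s| + 2)); apply: cvgM; [exact: cvgr_expR|exact: cvg_cst].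
- apply: cvg_at_right_filter; apply: differentiable_continuous; apply/derivable1_diffP.
  exact: ex_derive.
- by move=> t _; rewrite derive1E; exact: derive_val.
Unshelve. all: by end_near. Qed.

Lemma continuous_exp_1Dcos (s : R) :
  continuous (fun t : R => expR (- `|t|) * (1 + cos (s * t))).
Proof.
move=> t; apply: cvgM.
  apply: (continuous_comp (f := fun t : R => - `|t|)); last exact: continuous_expR.
  by apply: cvgN; apply: norm_continuous.
apply: cvgD; first exact: cvg_cst.
apply: (continuous_comp (f := fun t : R => s * t)); last exact: continuous_cos.
by apply: cvgM; [exact: cvg_cst|exact: cvg_id].
Qed.

Lemma integralT_exp_1Dcos (s : R) :
  (\int[mu]_t (expR (- `|t|) * (1 + cos (s * t)))%:E =
   (2 * (1 + (1 + s ^+ 2)^-1))%:E)%E.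
Proof.
rewrite (ge0_symfun_integralT (f := fun t => expR (- `|t|) * (1 + cos (s * t)))).
- rewrite -set_itvcy EFinM; congr (_ * _)%E; rewrite -integral_exp_1Dcos.
  apply: eq_integral => t; rewrite inE/= in_itv/= andbT => t0.
  by rewrite ger0_norm.
- by move=> t; rewrite mulr_ge0 ?expR_ge0// -lerBlDl sub0r cos_geN1.
- exact: continuous_exp_1Dcos.
- by move=> t /=; rewrite normrN mulrN cosN.
Qed.

(** The Fourier transform at y of the weight exp (- r |t|). *)
Definition lorentz (r y : R) : R := 2 * r / (r ^+ 2 + (2 * pi * y) ^+ 2).

Lemma lorentz_ge0 r y : 0 <= r -> 0 <= lorentz r y.
Proof. by move=> r0; rewrite divr_ge0 ?mulr_ge0// addr_ge0 ?sqr_ge0. Qed.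

Lemma integral_expr_1Dcos (r y : R) : 0 < r ->
  (\int[mu]_t (expR (- (r * `|t|)) * (1 + cos (2 * pi * y * t)))%:E =
   (2 / r + lorentz r y)%:E)%E.
Proof.
move=> r0; have rn0 : r != 0 by rewrite gt_eqF.
pose s := 2 * pi * y / r.
pose f t := (expR (- `|t|) * (1 + cos (s * t)))%:E.
have -> : (\int[mu]_t (expR (- (r * `|t|)) * (1 + cos (2 * pi * y * t)))%:E =
    \int[mu]_t f (0 + r * t)%R)%E.
  apply: eq_integral => t _; rewrite /f add0r normrM (gtr0_norm r0); congr (_ * (1 + cos _))%:E.
  by rewrite /s; field.
rewrite integral_affine//.
- rewrite integralT_exp_1Dcos (gtr0_norm r0) -EFinM; congr EFin.
  rewrite /lorentz /s; field; rewrite rn0 andbT.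
  by rewrite gt_eqF//; apply: ltr_pwDl; [exact: exprn_gt0|exact: sqr_ge0].
- rewrite /f; apply/measurable_EFinP; apply: continuous_measurable_fun.
  exact: continuous_exp_1Dcos.
- by move=> t; rewrite lee_fin mulr_ge0 ?expR_ge0// -lerBlDl sub0r cos_geN1.
Qed.

End exponential_weight.

Section product_integrals.
Context {R : realType}.

Lemma intC_mul d1 d2 (X : measurableType d1) (Y : measurableType d2)
  (m1 : {sigma_finite_measure set X -> \bar R}) (m2 : {sigma_finite_measure set Y -> \bar R})
  (F : X -> R[i]) (G : Y -> R[i]) : cint m1 F -> cint m2 G ->
  cint (m1 \x m2)%E (fun z => F z.1 * G z.2) /\
  integralC (m1 \x m2)%E setT (fun z => F z.1 * G z.2) =
  integralC m1 setT F * integralC m2 setT G.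
Proof.
move=> iF iG; have mF := cint_meas iF; have mG := cint_meas iG.
have i12 : cint (m1 \x m2)%E (fun z => F z.1 * G z.2).
  apply: cint1P.
    apply: cmeasM; first by apply: cmeas_comp mF; exact: measurable_fst.
    by apply: cmeas_comp mG; exact: measurable_snd.
  under eq_integral => x _.
    under eq_integral => y _ do rewrite /= Normc.normcM EFinM.
    rewrite ge0_integralZl//=; last 3 first.
      exact: measurable_ncE.
      by move=> y _; rewrite lee_fin nc_ge0.
      by rewrite lee_fin nc_ge0.
    over.
  rewrite ge0_integralZr//=.
  - by apply: lte_mul_pinfty; [apply: integral_ge0 => x _; rewrite lee_fin nc_ge0|
      rewrite ge0_fin_numE; [case: iF|apply: integral_ge0 => x _; rewrite lee_fin nc_ge0]|case: iG].
  - exact: measurable_ncE.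
  - by move=> x _; rewrite lee_fin nc_ge0.
  - by apply: integral_ge0 => x _; rewrite lee_fin nc_ge0.
split=> //; rewrite -intC12//=.
under eq_intC do rewrite intCZ//.
under eq_intC do rewrite mulrC.
by rewrite intCZ// mulrC.
Qed.

Lemma cmeas_prod d (T : measurableType d) n (g : 'I_n -> T -> R[i]) :
  (forall i, cmeas (g i)) -> cmeas (fun x => \prod_(i < n) g i x).
Proof.
move=> mg; elim: n g mg => [|n IHn] g mg.
  by apply: cmeas_eq (cmeas_cst 1) => x; rewrite big_ord0.
apply: (@cmeas_eq _ _ _ (fun x => g ord0 x * \prod_(i < n) g (lift ord0 i) x)).
  by move=> x; rewrite big_ord_recl.
by apply: cmeasM => //; exact: IHn.
Qed.

Lemma integral_leb0 (f : euclidean R 0 -> \bar R) : measurable_fun setT f ->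
  (\int[leb R 0]_x f x = f [tuple of [::]])%E.
Proof. by move=> mf; rewrite /= integral_dirac// diracT mul1e. Qed.

Lemma intC_leb_cons n (F : euclidean R n.+1 -> R[i]) : cmeas F ->
  cint (lebesgue_measure \x leb R n)%E (fun z => F (tuple_cons z)) ->
  cint (leb R n.+1) F /\ integralC (leb R n.+1) setT F =
  integralC (lebesgue_measure \x leb R n)%E setT (fun z => F (tuple_cons z)).
Proof.
move=> mF [_ iF]; have icF : cint (leb R n.+1) F.
  split=> //; rewrite integral_leb_cons//; first exact: measurable_ncE.
  by move=> y; rewrite lee_fin nc_ge0.
split=> //; have cov : scales_integral (lebesgue_measure \x leb R n)%E (leb R n.+1) (@tuple_cons R n) 1.
  by move=> f mf f0; rewrite mul1e integral_leb_cons.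
by rewrite (intC_cov cov icF) mul1r.
Qed.

Lemma leb_prod n (g : 'I_n -> R -> R[i]) :
  (forall i, cint (@lebesgue_measure R) (g i)) ->
  cint (leb R n) (fun x => \prod_(i < n) g i (tnth x i)) /\
  integralC (leb R n) setT (fun x => \prod_(i < n) g i (tnth x i)) =
  \prod_(i < n) integralC (@lebesgue_measure R) setT (g i).
Proof.
elim: n g => [|n IHn] g ig.
  have -> : (fun x : euclidean R 0 => \prod_(i < 0) g i (tnth x i)) = fun=> 1%:C%C.
    by apply/funext => x; rewrite big_ord0.
  split.
    split; first exact: cmeas_cst.
    by rewrite integral_leb0//= ltry.
  rewrite big_ord0 intC_real; congr (_%:C)%C.
  by rewrite /Rintegral integral_leb0.
have [iP eP] := IHn (fun i => g (lift ord0 i)) (fun i => ig _).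
have mP : cmeas (fun x : euclidean R n.+1 => \prod_(i < n.+1) g i (tnth x i)).
  apply: cmeas_prod => i.
  by apply: cmeas_comp (cint_meas (ig i)); exact: measurable_tnth.
have E : (fun z => \prod_(i < n.+1) g i (tnth (@tuple_cons R n z) i)) =
    (fun z => g ord0 z.1 * \prod_(i < n) g (lift ord0 i) (tnth z.2 i)).
  apply/funext => z; rewrite big_ord_recl; congr (_ * _).
  by apply: eq_bigr => i _; rewrite /tuple_cons tnthS.
have [iM eM] := intC_mul (ig ord0) iP.
have [|iT eT] := intC_leb_cons mP; first by rewrite E.
by split=> //; rewrite eT E eM eP big_ord_recl.
Qed.

End product_integrals.

Section expi.
Context {R : realType}.

Lemma nc_expi (t : R) : nc (expi t) = 1.
Proof. by rewrite /= cos2Dsin2 sqrtr1. Qed.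

Lemma expiD (s t : R) : expi (s + t) = expi s * expi t.
Proof.
by apply: complex_eqP; rewrite ?ReM ?ImM /= ?cosD ?sinD// addrC.
Qed.

Lemma expi0 : expi (0 : R) = 1.
Proof. by apply: complex_eqP; rewrite /= ?cos0 ?sin0. Qed.

Lemma conj_expi (t : R) : conjc (expi t) = expi (- t).
Proof. by rewrite /expi /= cosN sinN. Qed.

Lemma expi_sum n (f : 'I_n -> R) : expi (\sum_(i < n) f i) = \prod_(i < n) expi (f i).
Proof. by elim/big_ind2: _ => [|? ? ? ? <- <-|]; rewrite ?expi0 ?expiD. Qed.

Lemma cmeas_expi d (T : measurableType d) (f : T -> R) :
  measurable_fun setT f -> cmeas (fun x => expi (f x)).
Proof.
move=> mf; split=> /=.
  by apply: measurableT_comp mf; apply: continuous_measurable_fun; exact: continuous_cos.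
by apply: measurableT_comp mf; apply: continuous_measurable_fun; exact: continuous_sin.
Qed.

End expi.

Section lorentz_transform.
Context {R : realType}.
Local Notation mu := (@lebesgue_measure R).

Lemma measurable_expRabs (r : R) : measurable_fun setT (fun t : R => expR (- (r * `|t|))).
Proof.
apply: measurableT_comp => //; apply: measurableT_comp => //.
by apply: measurable_funM => //; exact: measurableT_comp.
Qed.

Lemma integral_expRabs (r : R) : 0 < r ->
  (\int[mu]_t (expR (- (r * `|t|)))%:E = (2 / r)%:E)%E.
Proof.
move=> r0; have := integral_expr_1Dcos 0 r0.
rewrite /lorentz mulr0 expr0n/= addr0.
under eq_integral => t _ do rewrite mul0r cos0 mulrC EFinM.
rewrite ge0_integralZl//=; last first.
  by apply/measurable_EFinP; exact: measurable_expRabs.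
move=> /(congr1 (fun x => (2^-1)%:E * x)%E); rewrite muleA -!EFinM mulVf ?pnatr_eq0// mul1e => ->.
by congr EFin; field; rewrite gt_eqF.
Qed.

Lemma ft_exp_abs (r y : R) : 0 < r ->
  cint mu (fun t : R => ((expR (- (r * `|t|)))%:C)%C * expi (- (2 * pi * (t * y)))) /\
  integralC mu setT (fun t : R => ((expR (- (r * `|t|)))%:C)%C * expi (- (2 * pi * (t * y))))
  = ((lorentz r y)%:C)%C.
Proof.
move=> r0.
have mF : cmeas (fun t : R => ((expR (- (r * `|t|)))%:C)%C * expi (- (2 * pi * (t * y)))).
  apply: cmeasM; first exact: (cmeas_real (measurable_expRabs r)).
  apply: cmeas_expi; apply: measurableT_comp => //; apply: measurable_funM => //.
  exact: measurable_funM.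
have iF : cint mu (fun t : R => ((expR (- (r * `|t|)))%:C)%C * expi (- (2 * pi * (t * y)))).
  split=> //; under eq_integral => t _ do
    rewrite Normc.normcM nc_real nc_expi mulr1 ger0_norm ?expR_ge0//.
  by rewrite integral_expRabs// ltry.
split=> //.
have iE : mu.-integrable setT (EFin \o (fun t : R => expR (- (r * `|t|)))).
  apply/integrableP; split; first by apply/measurable_EFinP; exact: measurable_expRabs.
  under eq_integral => t _ do rewrite /= ger0_norm ?expR_ge0//.
  by rewrite integral_expRabs// ltry.
apply: complex_eqP => /=.
- under eq_Rintegral => t _ do rewrite mul0r subr0.
  transitivity (\int[mu]_t (expR (- (r * `|t|)) * (1 + cos (2 * pi * y * t)) - expR (- (r * `|t|)))).
    apply: eq_Rintegral => t _; rewrite cosN.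
    by rewrite (_ : 2 * pi * (t * y) = 2 * pi * y * t); ring.
  have i1 := integral_expr_1Dcos y r0.
  rewrite RintegralB//.
    by rewrite /Rintegral i1 integral_expRabs//= [X in X - _]addrC addrK.
  apply/integrableP; split.
    apply/measurable_EFinP; apply: measurable_funM; first exact: measurable_expRabs.
    apply: measurable_funD => //; apply: measurableT_comp.
      by apply: continuous_measurable_fun; exact: continuous_cos.
    exact: measurable_funM.
  under eq_integral => t _ do rewrite /= ger0_norm ?mulr_ge0 ?expR_ge0 -?lerBlDl ?sub0r ?cos_geN1//.
  by rewrite i1 ltry.
- set f := fun t : R => _.
  have iI : mu.-integrable setT (EFin \o f).
    by apply: eq_integrable (cint_Im iF) => //.
  have cov : scales_integral mu mu (fun t : R => 0 + (-1) * t) 1.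
    by move=> g mg g0; rewrite integral_affine ?oppr_eq0 ?oner_eq0// normrN1 invr1.
  have := Rintegral_cov cov iI.
  rewrite mul1r (_ : (fun x => f (0 + -1 * x)) = (fun x => -1 * f x)); last first.
    apply/funext => t; rewrite /f add0r !mulN1r normrN !mul0r !addr0.
    by rewrite (_ : 2 * pi * (- t * y) = - (2 * pi * (t * y))) ?sinN ?opprK ?mulrN ?opprK//; ring.
  by rewrite RintegralZl// mulN1r => /eqP; rewrite eqNr => /eqP.
Qed.

End lorentz_transform.

Section bessel.
Context {R : realType} {n : nat}.
Local Notation E := (euclidean R n).

Definition ft (F : E -> R[i]) (xi : E) : R[i] :=
  integralC (leb R n) setT (fun y => expi (- (2 * pi * dot xi y)) * F y).

(** An approximate unit in xi as r tends to 0, with a nonnegative Fourier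
    transform: this positivity is what makes the Schur test below work with
    constant one. *)
Definition exp_weight (r : R) (xi : E) : R :=
  expR (- (r * \sum_(i < n) `|tnth xi i : R|)).

Definition lorentz_kernel (r : R) (y : E) : R := \prod_(i < n) lorentz r (tnth y i).

Lemma lorentz_kernel_ge0 r y : 0 <= r -> 0 <= lorentz_kernel r y.
Proof. by move=> r0; apply: prodr_ge0 => i _; exact: lorentz_ge0. Qed.

Lemma measurable_exp_weight r : measurable_fun setT (exp_weight r).
Proof.
apply: measurableT_comp => //; apply: measurableT_comp => //.
apply: measurable_funM => //; apply: measurable_sum => i.
by apply: measurableT_comp => //; exact: measurable_tnth.
Qed.

Lemma measurable_lorentz (r : R) : measurable_fun setT (lorentz r).
Proof.
rewrite (_ : lorentz r = fun y => 2 * r * (r ^+ 2 + (2 * pi * y) ^+ 2) `^ (-1)).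
  apply: measurable_funM => //; apply: (measurableT_comp (measurable_powR _)).
  by apply: measurable_funD => //; apply: measurable_funX; exact: measurable_funM.
by apply/funext => y; rewrite powR_inv1// addr_ge0// sqr_ge0.
Qed.

Lemma ft_exp_weight r (y : E) : 0 < r ->
  cint (leb R n) (fun xi => ((exp_weight r xi)%:C)%C * expi (- (2 * pi * dot xi y))) /\
  integralC (leb R n) setT (fun xi => ((exp_weight r xi)%:C)%C * expi (- (2 * pi * dot xi y))) =
  ((lorentz_kernel r y)%:C)%C.
Proof.
move=> r0.
have [i1 e1] := leb_prod (fun i => (ft_exp_abs (tnth y i) r0).1).
have E xi : ((exp_weight r xi)%:C)%C * expi (- (2 * pi * dot xi y)) =
   \prod_(i < n) (((expR (- (r * `|tnth xi i|)))%:C)%C * expi (- (2 * pi * (tnth xi i * tnth y i)))).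
  rewrite big_split/= /exp_weight /dot mulr_sumr -sumrN expR_sum rmorph_prod; congr (_ * _).
  by rewrite mulr_sumr -sumrN expi_sum.
rewrite (_ : (fun xi => _) = (fun xi => \prod_(i < n) (((expR (- (r * `|tnth xi i|)))%:C)%C * expi (- (2 * pi * (tnth xi i * tnth y i)))))).
  split=> //; rewrite e1 /lorentz_kernel rmorph_prod; apply: eq_bigr => i _.
  by rewrite (ft_exp_abs (tnth y i) r0).2.
by apply/funext => xi; rewrite E.
Qed.

End bessel.

(** * Bessel's inequality for the Fourier transform *)

Section bessel_inequality.
Context {R : realType}.

Lemma integralT_oneDsqr :
  (\int[@lebesgue_measure R]_x ((oneDsqr x)^-1)%:E = pi%:E)%E.
Proof.
rewrite (ge0_symfun_integralT (f := fun x => (oneDsqr x)^-1)).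
- rewrite -set_itvcy integral0y_oneDsqr -EFinM; congr EFin; by field.
- by move=> x; rewrite invr_ge0; exact: le_trans ler01 (oneDsqr_ge1 x).
- by move=> x; exact: continuous_oneDsqrV.
- by move=> x /=; rewrite /oneDsqr sqrrN.
Qed.

Lemma integral_lorentz (r : R) : 0 < r ->
  (\int[@lebesgue_measure R]_y (lorentz r y)%:E = 1)%E.
Proof.
move=> r0; have rn0 : r != 0 by rewrite gt_eqF.
have pi0 : pi != 0 :> R by rewrite gt_eqF// pi_gt0.
have t0 : 2 * pi / r != 0 by rewrite mulf_neq0 ?invr_eq0// mulf_neq0.
have tp : 0 < 2 * pi / r by rewrite divr_gt0// mulr_gt0// pi_gt0.
have -> : (\int[@lebesgue_measure R]_y (lorentz r y)%:E =
  \int[@lebesgue_measure R]_y ((2 / r)%:E * ((oneDsqr (0 + (2 * pi / r) * y))^-1)%:E))%E.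
  apply: eq_integral => y _; rewrite -EFinM; congr EFin.
  rewrite /lorentz /oneDsqr add0r; set P := pi in pi0 *.
  field; rewrite rn0/= gt_eqF//.
  by apply: ltr_pwDl; [exact: exprn_gt0|exact: sqr_ge0].
have m1 : measurable_fun setT (fun y : R => ((oneDsqr y)^-1)%:E).
  by apply/measurable_EFinP; apply: continuous_measurable_fun; exact: continuous_oneDsqrV.
have p1 (y : R) : (0 <= ((oneDsqr y)^-1)%:E)%E.
  by rewrite lee_fin invr_ge0; exact: le_trans ler01 (oneDsqr_ge1 y).
rewrite ge0_integralZl//; last 2 first.
- exact: (measurableT_comp m1 (measurable_affine 0 _)).
- by rewrite lee_fin divr_ge0// ltW.
rewrite (integral_affine 0 t0 m1 p1) integralT_oneDsqr (gtr0_norm tp) -!EFinM.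
have gen (P : R) : P != 0 -> 2 / r * ((2 * P / r)^-1 * P) = 1.
  by move=> P0; field; rewrite P0 rn0.
by rewrite gen.
Qed.

Context {n : nat}.
Local Notation E := (euclidean R n).

Lemma measurable_lorentz_kernel r : measurable_fun setT (@lorentz_kernel R n r).
Proof.
apply: measurable_prod => i _.
by apply: (measurableT_comp (measurable_lorentz r)); exact: measurable_tnth.
Qed.

Lemma integral_lorentz_kernel (r : R) : 0 < r ->
  (\int[leb R n]_y (lorentz_kernel r y)%:E = 1)%E.
Proof.
move=> r0; have r0' := ltW r0.
have i1 : cint (@lebesgue_measure R) (fun y => ((lorentz r y)%:C)%C).
  split; first exact: (cmeas_real (measurable_lorentz r)).
  under eq_integral => y _ do rewrite nc_real ger0_norm ?lorentz_ge0//.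
  by rewrite integral_lorentz// ltry.
have [[mP iP] eP] := @leb_prod R n (fun=> fun y => ((lorentz r y)%:C)%C) (fun=> i1).
have E1 : (fun x : E => \prod_(i < n) ((lorentz r (tnth x i))%:C)%C) =
  (fun x => ((lorentz_kernel r x)%:C)%C).
  by apply/funext => x; rewrite /lorentz_kernel rmorph_prod.
move: eP iP; rewrite E1 intC_real => eP iP.
have {}iP : (\int[leb R n]_y (lorentz_kernel r y)%:E < +oo)%E.
  apply: le_lt_trans iP; rewrite le_eqVlt; apply/orP; left; apply/eqP.
  apply: eq_integral => y _; rewrite (congr1 (@^~ y) E1) nc_real.
  by rewrite ger0_norm ?lorentz_kernel_ge0.
have {}eP : \int[leb R n]_y lorentz_kernel r y = 1.
  move: eP; rewrite big1 => [[]//|i _].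
  by rewrite intC_real /Rintegral integral_lorentz.
rewrite -[LHS]fineK; first by rewrite -[fine _]/(Rintegral _ _ _) eP.
by rewrite ge0_fin_numE//; apply: integral_ge0 => y _; rewrite lee_fin lorentz_kernel_ge0.
Qed.

Lemma cmeas_ft_kernel d (T : measurableType d) (a b : T -> E) (F : E -> R[i]) :
  measurable_fun setT a -> measurable_fun setT b -> cmeas F ->
  cmeas (fun z => expi (- (2 * pi * dot (a z) (b z))) * F (b z)).
Proof.
move=> ma mb mF; apply: cmeasM; last exact: cmeas_comp mF.
apply: cmeas_expi; apply: measurableT_comp => //; apply: measurable_funM => //.
exact: measurable_dot.
Qed.

Lemma cmeas_ft (F : E -> R[i]) : cmeas F -> cmeas (ft F).
Proof.
move=> mF; apply: (@cmeas_int1 _ _ E E R (leb R n) (fun z => expi (- (2 * pi * dot z.1 z.2)) * F z.2)).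
exact: cmeas_ft_kernel.
Qed.

Lemma cint_ft_kernel (F : E -> R[i]) xi : cint (leb R n) F ->
  cint (leb R n) (fun y => expi (- (2 * pi * dot xi y)) * F y).
Proof.
move=> iF; apply: (cint_bM (k := 1)) => //; last by move=> y; rewrite nc_expi.
apply: cmeas_expi; apply: measurableT_comp => //; apply: measurable_funM => //.
exact: measurable_dot.
Qed.

Lemma dot_sub (xi y y' : E) : dot xi (add_scaled y (-1) y') = dot xi y - dot xi y'.
Proof.
rewrite /dot -sumrB; apply: eq_bigr => i _.
by rewrite tnth_mktuple mulN1r mulrBr.
Qed.

(** The Schur test with 2 |F (x)| |F (y)| <= |F (x)|^2 + |F (y)|^2, for a
    nonnegative convolution kernel of integral one. *)
Lemma lorentz_schur (F : E -> R[i]) r : 0 < r -> cmeas F ->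
  (\int[leb R n \x leb R n]_z
     (nc (F z.1) * nc (F z.2) * lorentz_kernel r (add_scaled z.1 (-1) z.2))%:E <=
   \int[leb R n]_y (nc (F y) ^+ 2)%:E)%E.
Proof.
move=> r0 mF; have r0' := ltW r0.
have mk : measurable_fun setT (fun z : E * E => lorentz_kernel r (add_scaled z.1 (-1) z.2)).
  apply: (measurableT_comp (measurable_lorentz_kernel r)).
  exact: measurable_add_scaled.
have m1 : measurable_fun setT (fun z : E * E => nc (F z.1)).
  by apply: (measurableT_comp (measurable_nc mF)).
have m2 : measurable_fun setT (fun z : E * E => nc (F z.2)).
  by apply: (measurableT_comp (measurable_nc mF)).
pose h1 (z : E * E) := ((nc (F z.1) ^+ 2)%:E * (lorentz_kernel r (add_scaled z.1 (-1) z.2))%:E)%E.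
pose h2 (z : E * E) := ((nc (F z.2) ^+ 2)%:E * (lorentz_kernel r (add_scaled z.1 (-1) z.2))%:E)%E.
have mh1 : measurable_fun setT h1.
  by apply: emeasurable_funM; apply/measurable_EFinP => //; exact: measurable_funX.
have mh2 : measurable_fun setT h2.
  by apply: emeasurable_funM; apply/measurable_EFinP => //; exact: measurable_funX.
have h10 z : (0 <= h1 z)%E by rewrite mule_ge0// lee_fin ?sqr_ge0 ?lorentz_kernel_ge0.
have h20 z : (0 <= h2 z)%E by rewrite mule_ge0// lee_fin ?sqr_ge0 ?lorentz_kernel_ge0.
have kk (y : E) : measurable_fun setT (fun x => (lorentz_kernel r (add_scaled y (-1) x))%:E).
  by apply/measurable_EFinP; exact: (measurableT_comp mk (measurable_pair1 y)).
have kk2 (y : E) : measurable_fun setT (fun x => (lorentz_kernel r (add_scaled x (-1) y))%:E).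
  by apply/measurable_EFinP; exact: (measurableT_comp mk (measurable_pair2 y)).
have mker : measurable_fun setT (fun x : E => (lorentz_kernel r x)%:E).
  by apply/measurable_EFinP; exact: measurable_lorentz_kernel.
have pker (x : E) : (0 <= (lorentz_kernel r x)%:E)%E by rewrite lee_fin lorentz_kernel_ge0.
have I1 : (\int[leb R n \x leb R n]_z h1 z = \int[leb R n]_y (nc (F y) ^+ 2)%:E)%E.
  rewrite fubini_tonelli1//; apply: eq_integral => y _; rewrite /fubini_F /h1/=.
  rewrite ge0_integralZl// ?lee_fin ?sqr_ge0//.
  rewrite (@integral_add_scaled _ _ y (-1) (fun x => (lorentz_kernel r x)%:E))//.
  by rewrite integral_lorentz_kernel// normrN1 expr1n invr1 !mule1.
have I2 : (\int[leb R n \x leb R n]_z h2 z = \int[leb R n]_y (nc (F y) ^+ 2)%:E)%E.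
  rewrite fubini_tonelli2//; apply: eq_integral => y _; rewrite /fubini_G /h2/=.
  rewrite ge0_integralZl// ?lee_fin ?sqr_ge0//.
  rewrite (@integral_translate _ _ y (-1) (fun x => (lorentz_kernel r x)%:E))//.
  by rewrite integral_lorentz_kernel// mule1.
have mh12 : measurable_fun setT (fun z => h1 z + h2 z)%E by exact: emeasurable_funD.
apply: (@le_trans _ _ (\int[leb R n \x leb R n]_z ((2^-1)%:E * (h1 z + h2 z)))%E).
  apply: ge0_le_integral => //.
  - by move=> z _; rewrite lee_fin !mulr_ge0 ?nc_ge0 ?lorentz_kernel_ge0.
  - by apply/measurable_EFinP; apply: measurable_funM => //; exact: measurable_funM.
  - by apply: emeasurable_funM => //; exact: emeasurable_funD.
  - move=> z _; set k := lorentz_kernel r (add_scaled z.1 (-1) z.2).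
    rewrite -[leRHS]/((2^-1 * (nc (F z.1) ^+ 2 * k + nc (F z.2) ^+ 2 * k))%:E) lee_fin.
    have k0 := lorentz_kernel_ge0 (add_scaled z.1 (-1) z.2) r0'.
    move: (nc _) (nc _) @k k0 => a b k k0.
    rewrite -subr_ge0 (_ : _ - _ = 2^-1 * ((a - b) ^+ 2 * k)); last by field.
    by apply: mulr_ge0; [rewrite invr_ge0|exact: mulr_ge0 (sqr_ge0 _) k0].
rewrite ge0_integralZl//; last first.
  by move=> z _; exact: adde_ge0.
rewrite ge0_integralD// I1 I2.
have : (0 <= \int[leb R n]_y (nc (F y) ^+ 2)%:E)%E.
  by apply: integral_ge0 => y _; rewrite lee_fin sqr_ge0.
move: (integral _ _ _) => I; case: I => [I _| _|].
- rewrite -[leLHS]/((2^-1 * (I + I))%:E) lee_fin; lra.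
- by rewrite leey.
- by [].
Qed.

End bessel_inequality.

Section bessel_main.
Context {R : realType} {n : nat}.
Local Notation E := (euclidean R n).
Local Notation leb2 := (prodm (leb R n) (leb R n)).

Lemma integral_nc_intC_real d (T : measurableType d) (mu : {measure set T -> \bar R})
  (f : T -> R) : (forall x, 0 <= f x) -> cint mu (fun x => ((f x)%:C)%C) ->
  (\int[mu]_x (f x)%:E = (nc (integralC mu setT (fun x => ((f x)%:C)%C)))%:E)%E.
Proof.
move=> f0 iF; rewrite intC_real nc_real ger0_norm ?Rintegral_ge0//.
rewrite /Rintegral fineK//; exact: integrable_fin_num (cint_Re iF).
Qed.

(** Expanding |ft F|^2 as a double integral and integrating the weight first
    leaves the form of the convolution kernel [lorentz_kernel], to which the
    Schur test applies. *)
Lemma weighted_bessel (F : E -> R[i]) r : 0 < r -> cint (leb R n) F ->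
  (\int[leb R n]_xi (exp_weight r xi * nc (ft F xi) ^+ 2)%:E <=
   \int[leb R n]_y (nc (F y) ^+ 2)%:E)%E.
Proof.
move=> r0 iF; have mF := cint_meas iF.
pose e (xi y : E) : R[i] := expi (- (2 * pi * dot xi y)).
have me d (T : measurableType d) (a b : T -> E) : measurable_fun setT a ->
    measurable_fun setT b -> cmeas (fun z => e (a z) (b z)).
  move=> ma mb; apply: cmeas_expi; apply: measurableT_comp => //.
  by apply: measurable_funM => //; exact: measurable_dot.
pose H (z : E * (E * E)) : R[i] := e z.1 z.2.1 * conjc (e z.1 z.2.2) *
  (((exp_weight r z.1)%:C)%C * (F z.2.1 * conjc (F z.2.2))).
have iw : cint (leb R n) (fun xi : E => ((exp_weight r xi)%:C)%C).
  have [[_ iw] _] := ft_exp_weight [tuple (0 : R) | i < n] r0.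
  split; first exact: (cmeas_real (measurable_exp_weight r)).
  by under eq_integral => xi _ do rewrite -[nc _]mulr1 -(nc_expi (- (2 * pi * dot xi [tuple (0 : R) | i < n]))) -Normc.normcM.
have mfst2 : measurable_fun setT (fun z : E * (E * E) => z.2.1).
  exact: measurableT_comp.
have msnd2 : measurable_fun setT (fun z : E * (E * E) => z.2.2).
  exact: measurableT_comp.
have iFF : cint leb2 (fun z => F z.1 * conjc (F z.2)) := (intC_mul iF (cint_conj iF)).1.
have iH : cint (leb R n \x leb2)%E H.
  have [iwFF _] := intC_mul iw iFF.
  apply: (cint_bM (k := 1)) iwFF.
    by apply: cmeasM; [exact: me|apply: cmeas_conj; exact: me].
  by move=> z; rewrite Normc.normcM nc_conj !nc_expi mulr1.
have inner1 xi : integralC leb2 setT (fun w => H (xi, w)) =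
    ((exp_weight r xi * nc (ft F xi) ^+ 2)%:C)%C.
  have i1 := cint_ft_kernel xi iF.
  have [i2 e2] := intC_mul i1 (cint_conj i1).
  have -> : (fun w => H (xi, w)) = (fun w : E * E => ((exp_weight r xi)%:C)%C *
     (e xi w.1 * F w.1 * conjc (e xi w.2 * F w.2))).
    by apply/funext => w; rewrite /H /= rmorphM /=; ring.
  by rewrite intCZ// e2 intC_conj// -/(ft F xi) mul_conj -rmorphM.
have inner2 w : integralC (leb R n) setT (fun xi => H (xi, w)) =
    F w.1 * conjc (F w.2) * ((lorentz_kernel r (add_scaled w.1 (-1) w.2))%:C)%C.
  have [i3 e3] := ft_exp_weight (add_scaled w.1 (-1) w.2) r0.
  rewrite -e3 -intCZ//; apply: eq_intC => xi.
  have -> : expi (- (2 * pi * dot xi (add_scaled w.1 (-1) w.2))) =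
      e xi w.1 * conjc (e xi w.2).
    by rewrite /e conj_expi -expiD dot_sub; congr expi; ring.
  by rewrite /H /=; ring.
have iG : cint (leb R n) (fun xi => ((exp_weight r xi * nc (ft F xi) ^+ 2)%:C)%C).
  by apply: cint_eq (cint_int1 iH) => xi; rewrite inner1.
rewrite integral_nc_intC_real//; last first.
  by move=> xi; rewrite mulr_ge0 ?sqr_ge0 ?expR_ge0.
under eq_intC do rewrite -inner1.
rewrite intC_swap//; under eq_intC do rewrite inner2.
apply: le_trans (nc_intC_le _ _) _.
  apply: cmeas_eq (cint_meas (cint_int2 iH)) => w; exact: inner2.
apply: le_trans (lorentz_schur r0 mF).
rewrite le_eqVlt; apply/orP; left; apply/eqP; apply: eq_integral => w _.
by rewrite !Normc.normcM nc_conj nc_real ger0_norm// lorentz_kernel_ge0// ltW.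
Qed.

(** Let r tend to 0 in the weighted inequality and use Fatou's lemma. *)
Theorem bessel (F : E -> R[i]) : cint (leb R n) F ->
  (\int[leb R n]_xi (nc (ft F xi) ^+ 2)%:E <= \int[leb R n]_y (nc (F y) ^+ 2)%:E)%E.
Proof.
move=> iF; have mF := cint_meas iF; have mG := cmeas_ft mF.
pose g (k : nat) (xi : E) : \bar R := (exp_weight k.+1%:R^-1 xi * nc (ft F xi) ^+ 2)%:E.
have mg k : measurable_fun setT (g k).
  apply/measurable_EFinP; apply: measurable_funM; first exact: measurable_exp_weight.
  by apply: measurable_funX; exact: measurable_nc.
have g0 k xi : (0 <= g k xi)%E by rewrite lee_fin mulr_ge0 ?expR_ge0 ?sqr_ge0.
have gcvg xi : g k xi @[k --> \oo] --> (nc (ft F xi) ^+ 2)%:E.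
  have h : k.+1%:R^-1 * (\sum_(i < n) `|tnth xi i : R|) @[k --> \oo] --> (0 : R).
    rewrite -[X in _ --> X](mul0r (\sum_(i < n) `|tnth xi i : R|)).
    by apply: cvgM; [exact: cvg_harmonic|exact: cvg_cst].
  have h2 : exp_weight k.+1%:R^-1 xi @[k --> \oo] --> (1 : R).
    rewrite -[X in _ --> X](@expR0 R) -[X in expR X]oppr0.
    by apply: continuous_cvg; [exact: continuous_expR|exact: cvgN].
  apply: cvg_EFin; first by near=> k.
  rewrite -[X in _ --> X]mul1r.
  by apply: cvgM; [exact: h2|exact: cvg_cst].
apply: (fatou_bound mg) => //.
- exact: measurable_nc2E.
- by move=> xi; rewrite lee_fin sqr_ge0.
- by apply: aeW => xi; exact: gcvg.
- by move=> k; apply: weighted_bessel; rewrite ?invr_gt0.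
Unshelve. all: by end_near. Qed.

End bessel_main.

(** * Square-integrable functions and shears of phase space *)

Section L2le.
Context {disp} {T : measurableType disp} {R : realType}.
Variable mu : {measure set T -> \bar R}.

(** Square integrability with an explicit bound N on the squared norm, which
    avoids arithmetic with infinite values. *)
Definition L2le (N : R) (F : T -> R[i]) : Prop :=
  cmeas F /\ (\int[mu]_x (nc (F x) ^+ 2)%:E <= N%:E)%E.

Lemma L2le_ge0 N F : L2le N F -> 0 <= N.
Proof.
by move=> [_]; rewrite -lee_fin; apply: le_trans; apply: integral_ge0 => x _; rewrite lee_fin sqr_ge0.
Qed.

Lemma L2le_fine F : cmeas F -> (\int[mu]_x (nc (F x) ^+ 2)%:E < +oo)%E ->
  L2le (fine (\int[mu]_x (nc (F x) ^+ 2)%:E)%E) F.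
Proof.
move=> mF iF; split=> //; rewrite fineK// ge0_fin_numE//.
by apply: integral_ge0 => x _; rewrite lee_fin sqr_ge0.
Qed.

Lemma L2le_lty N F : L2le N F -> (\int[mu]_x (nc (F x) ^+ 2)%:E < +oo)%E.
Proof. by move=> [_ h]; apply: le_lt_trans h _; rewrite ltry. Qed.

Lemma L2le_conj N F : L2le N F -> L2le N (fun x => conjc (F x)).
Proof.
move=> [mF iF]; split; first exact: cmeas_conj.
by under eq_integral do rewrite nc_conj.
Qed.

Lemma L2le_cint_mul N M F G : L2le N F -> L2le M G -> cint mu (fun x => F x * G x).
Proof.
move=> LF LG; have [mF iF] := LF; have [mG iG] := LG.
by have [] := cint_mul mF mG (L2le_ge0 LF) (L2le_ge0 LG) iF iG.
Qed.

Lemma L2le_mul N M F G : L2le N F -> L2le M G ->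
  nc (integralC mu setT (fun x => F x * G x)) <= Num.sqrt (N * M).
Proof.
move=> LF LG; have [mF iF] := LF; have [mG iG] := LG.
by have [] := cint_mul mF mG (L2le_ge0 LF) (L2le_ge0 LG) iF iG.
Qed.

End L2le.

Section L2le_cov.
Context {d1 d2} {X : measurableType d1} {Y : measurableType d2} {R : realType}.
Variables (mu : {measure set X -> \bar R}) (nu : {measure set Y -> \bar R}).

Lemma L2le_cov (phi : X -> Y) c N F : measurable_fun setT phi -> 0 <= c ->
  scales_integral mu nu phi c -> L2le nu N F -> L2le mu (c * N) (fun x => F (phi x)).
Proof.
move=> mphi c0 cov [mF iF]; split; first exact: cmeas_comp mphi mF.
rewrite (cov (fun y => (nc (F y) ^+ 2)%:E)).
- by rewrite EFinM; apply: lee_wpmul2l; rewrite ?lee_fin.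
- exact: measurable_nc2E.
- by move=> y; rewrite lee_fin sqr_ge0.
Qed.

End L2le_cov.

Section tensor.
Context {d1 d2} {T1 : measurableType d1} {T2 : measurableType d2} {R : realType}.
Variable m1 : {sigma_finite_measure set T1 -> \bar R}.
Variable m2 : {sigma_finite_measure set T2 -> \bar R}.

Lemma cmeas_tensor (F : T1 -> R[i]) (G : T2 -> R[i]) : cmeas F -> cmeas G ->
  cmeas (fun z : T1 * T2 => F z.1 * G z.2).
Proof.
move=> mF mG; apply: cmeasM; first by apply: cmeas_comp mF; exact: measurable_fst.
by apply: cmeas_comp mG; exact: measurable_snd.
Qed.

Lemma L2le_tensor N M (F : T1 -> R[i]) (G : T2 -> R[i]) : L2le m1 N F -> L2le m2 M G ->
  L2le (prodm m1 m2) (N * M) (fun z => F z.1 * G z.2).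
Proof.
move=> LF LG; have [mF iF] := LF; have [mG iG] := LG.
have mFG := cmeas_tensor mF mG; split=> //.
have -> : (\int[prodm m1 m2]_z (nc (F z.1 * G z.2) ^+ 2)%:E =
   \int[m1 \x m2]_z (nc (F z.1 * G z.2) ^+ 2)%:E)%E by [].
rewrite fubini_tonelli1//; [|exact: measurable_nc2E|by move=> z; rewrite lee_fin sqr_ge0].
rewrite /fubini_F/=.
under eq_integral => x _.
  under eq_integral => y _ do rewrite Normc.normcM exprMn EFinM.
  rewrite ge0_integralZl//; [|exact: measurable_nc2E|by move=> y _; rewrite lee_fin sqr_ge0|by rewrite lee_fin sqr_ge0].
  over.
rewrite ge0_integralZr//; [|exact: measurable_nc2E|by move=> y _; rewrite lee_fin sqr_ge0|
  by apply: integral_ge0 => y _; rewrite lee_fin sqr_ge0].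
by rewrite EFinM; apply: lee_pmul => //; apply: integral_ge0 => y _; rewrite lee_fin sqr_ge0.
Qed.

End tensor.

Section phase_shear.
Context {R : realType} {d : nat}.
Local Notation E := (euclidean R d).
Local Notation lam := (leb R d).
Local Notation leb2 := (prodm lam lam).

(** If u = x + tau y and v = x - (1 - tau) y, then this is the inverse map from
    (u, v) to (x, y); in the coordinates (u, v) the tau-Wigner kernel is the
    tensor product f (u) conj f (v). *)
Definition phase_shear (tau : R) (w : E * E) : E * E :=
  (add_scaled w.1 (- tau) (add_scaled w.1 (- 1) w.2), add_scaled w.1 (- 1) w.2).

Lemma measurable_phase_shear tau : measurable_fun setT (phase_shear tau).
Proof.
have m1 : measurable_fun setT (fun w : E * E => add_scaled w.1 (- 1) w.2).
  exact: measurable_add_scaled.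
by apply/measurable_fun_pairP; split => //=; exact: measurable_add_scaled.
Qed.

(** The map is the composition of two maps, each of which, for a fixed value of
    one variable, is a translation or a point reflection in the other. *)
Lemma phase_shear_preserves tau : scales_integral leb2 leb2 (phase_shear tau) 1.
Proof.
move=> f mf f0; rewrite mul1e.
have mg : measurable_fun setT (fun w : E * E => f (add_scaled w.1 (- tau) w.2, w.2)).
  apply: (measurableT_comp mf); apply/measurable_fun_pairP; split => /=.
    exact: measurable_add_scaled.
  exact: measurable_snd.
transitivity (\int[lam \x lam]_w f (phase_shear tau w))%E => //.
rewrite fubini_tonelli1//; last exact: (measurableT_comp mf (measurable_phase_shear tau)).
rewrite /fubini_F /phase_shear/=.
under eq_integral => u _.
  rewrite (@integral_add_scaled _ _ u (-1) (fun y => f (add_scaled u (- tau) y, y)))//; last first.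
    exact: (measurableT_comp mg (measurable_pair1 u)).
  rewrite normrN1 expr1n invr1 mul1e.
  over.
rewrite -(fubini_tonelli1 (fun w : E * E => f (add_scaled w.1 (- tau) w.2, w.2)))//.
rewrite fubini_tonelli2// /fubini_G/=.
transitivity (\int[lam \x lam]_w f w)%E => //.
rewrite (fubini_tonelli2 f mf f0); apply: eq_integral => y _.
rewrite (@integral_translate _ _ y (- tau) (fun x => f (x, y)))//.
exact: (measurableT_comp mf (measurable_pair2 y)).
Qed.

End phase_shear.

(** * The tau-Wigner distribution *)

Section wigner_bounds.
Context {R : realType} {d : nat}.
Local Notation E := (euclidean R d).
Local Notation lam := (leb R d).
Local Notation leb2 := (prodm lam lam).
Implicit Types f : E -> R[i].

Definition wigner_kernel (tau : R) f (z : E * E) : R[i] :=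
  f (add_scaled z.1 tau z.2) * conjc (f (add_scaled z.1 (- (1 - tau)) z.2)).

Lemma wignerE tau f z : wigner tau f z = ft (fun y => wigner_kernel tau f (z.1, y)) z.2.
Proof. by apply: eq_intC => y; rewrite /wigner_kernel mulrA. Qed.

Lemma wigner_kernel_shear tau f w :
  wigner_kernel tau f (phase_shear tau w) = f w.1 * conjc (f w.2).
Proof.
rewrite /wigner_kernel /phase_shear/=; congr (f _ * conjc (f _)).
  by apply: eq_from_tnth => i; rewrite !tnth_mktuple; ring.
by apply: eq_from_tnth => i; rewrite !tnth_mktuple; ring.
Qed.

Lemma cmeas_wigner_kernel f : cmeas f ->
  cmeas (fun p : R * (E * E) => wigner_kernel p.1 f p.2).
Proof.
move=> mf; apply: cmeasM.
  apply: cmeas_comp mf; apply: measurable_add_scaled => //.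
    exact: measurableT_comp.
  exact: measurableT_comp.
apply: cmeas_conj; apply: cmeas_comp mf; apply: measurable_add_scaled => //.
- exact: measurableT_comp.
- by apply: measurableT_comp => //; exact: measurable_funB.
- exact: measurableT_comp.
Qed.

Lemma cmeas_wigner_kernel1 tau f : cmeas f -> cmeas (wigner_kernel tau f).
Proof.
move=> mf; exact: (cmeas_sec1 tau (cmeas_wigner_kernel mf)).
Qed.

Lemma cmeas_wigner_joint f : cmeas f -> cmeas (fun p : R * (E * E) => wigner p.1 f p.2).
Proof.
move=> mf.
apply: (@cmeas_eq _ _ _ (fun p : R * (E * E) => integralC lam setT
   (fun y => expi (- (2 * pi * dot p.2.2 y)) * wigner_kernel p.1 f (p.2.1, y)))).
  by move=> p; rewrite wignerE.
apply: (@cmeas_int1 _ _ (R * (E * E))%type E R lam (fun q =>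
   expi (- (2 * pi * dot q.1.2.2 q.2)) * wigner_kernel q.1.1 f (q.1.2.1, q.2))).
apply: cmeasM.
  apply: cmeas_expi; apply: measurableT_comp => //; apply: measurable_funM => //.
  apply: measurable_dot => //.
  by do 2 (apply: measurableT_comp => //).
apply: (@cmeas_comp _ _ _ _ R (fun p => wigner_kernel p.1 f p.2)
  (fun q : (R * (E * E)) * E => (q.1.1, (q.1.2.1, q.2))) _ (cmeas_wigner_kernel mf)).
apply/measurable_fun_pairP; split => /=.
  exact: (measurableT_comp measurable_fst measurable_fst).
apply/measurable_fun_pairP; split => /=; last exact: measurable_snd.
exact: (measurableT_comp measurable_fst (measurableT_comp measurable_snd measurable_fst)).
Qed.

Lemma cmeas_wigner tau f : cmeas f -> cmeas (wigner tau f).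
Proof. by move=> mf; exact: (cmeas_sec1 tau (cmeas_wigner_joint mf)). Qed.

Lemma L2le_wigner_kernel tau f N : L2le lam N f -> L2le leb2 (N * N) (wigner_kernel tau f).
Proof.
move=> Lf; have [mf _] := Lf.
split; first exact: cmeas_wigner_kernel1.
have mk := cmeas_wigner_kernel1 tau mf.
have := phase_shear_preserves tau (measurable_nc2E mk).
rewrite mul1e => <-; last by move=> z; rewrite lee_fin sqr_ge0.
under eq_integral do rewrite wigner_kernel_shear.
by have [] := L2le_tensor Lf (L2le_conj Lf).
Qed.

Lemma L2le_affine (x : E) t f N : t != 0 -> L2le lam N f ->
  L2le lam (`|t| ^- d * N) (fun y => f (add_scaled x t y)).
Proof.
move=> t0 Lf; apply: (L2le_cov (nu := lam)) => //.
- exact: measurable_add_scaled.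
- by move=> g mg g0; rewrite integral_add_scaled.
Qed.

(** The constant |tau|^(-d/2) |1 - tau|^(-d/2) produced by the Cauchy-Schwarz
    inequality in [cint_wigner_kernel]. *)
Definition sup_const (tau : R) : R := Num.sqrt (`|tau| ^- d * `|1 - tau| ^- d).

Lemma cint_wigner_kernel tau f N x : tau != 0 -> tau != 1 -> L2le lam N f ->
  cint lam (fun y => wigner_kernel tau f (x, y)) /\
  (\int[lam]_y (nc (wigner_kernel tau f (x, y)))%:E <= (sup_const tau * N)%:E)%E.
Proof.
move=> t0 t1 Lf.
have N0 := L2le_ge0 Lf.
have [m1 i1] := L2le_affine x t0 Lf.
have t1' : - (1 - tau) != 0 by rewrite oppr_eq0 subr_eq0 eq_sym.
have [m2 i2] := L2le_affine x t1' Lf.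
have H := cauchy_schwarz_ge0 (measurable_nc m1) (measurable_nc m2) (fun=> nc_ge0 _)
  (fun=> nc_ge0 _) _ _ i1 i2.
have {}H : (\int[lam]_y (nc (wigner_kernel tau f (x, y)))%:E <= (sup_const tau * N)%:E)%E.
  under eq_integral do rewrite Normc.normcM nc_conj/=.
  apply: le_trans (H _ _) _; [by rewrite mulr_ge0// invr_ge0 exprn_ge0..|].
  rewrite normrN mulrACA sqrtrM ?mulr_ge0 ?invr_ge0 ?exprn_ge0//.
  by rewrite -expr2 sqrtr_sqr (ger0_norm N0).
split=> //; split; first exact: (cmeas_sec1 x (cmeas_wigner_kernel1 tau (proj1 Lf))).
by apply: le_lt_trans H _; rewrite ltry.
Qed.

Lemma wigner_sup tau f N z : tau != 0 -> tau != 1 -> L2le lam N f ->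
  nc (wigner tau f z) <= sup_const tau * N.
Proof.
move=> t0 t1 Lf; have [iF bF] := cint_wigner_kernel z.1 t0 t1 Lf.
rewrite -lee_fin; apply: le_trans bF; rewrite wignerE.
apply: le_trans (nc_intC_le _ _) _; first exact: cint_meas (cint_ft_kernel _ iF).
by under eq_integral do rewrite Normc.normcM nc_expi mul1r.
Qed.

(** Fibrewise Bessel's inequality, followed by the measure-preserving shear
    that turns the kernel into a tensor product. *)
Lemma wigner_L2 tau f N : tau != 0 -> tau != 1 -> L2le lam N f ->
  L2le leb2 (N * N) (wigner tau f).
Proof.
move=> t0 t1 Lf; have [mf _] := Lf.
have mW := cmeas_wigner tau mf; split=> //.
have [_ bK] := L2le_wigner_kernel tau Lf; apply: le_trans bK.
have -> : (\int[leb2]_z (nc (wigner tau f z) ^+ 2)%:E =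
    \int[lam \x lam]_z (nc (wigner tau f z) ^+ 2)%:E)%E by [].
have -> : (\int[leb2]_z (nc (wigner_kernel tau f z) ^+ 2)%:E =
    \int[lam \x lam]_z (nc (wigner_kernel tau f z) ^+ 2)%:E)%E by [].
have mk := cmeas_wigner_kernel1 tau mf.
have p2 (F : E * E -> R[i]) z : (0 <= (nc (F z) ^+ 2)%:E)%E by rewrite lee_fin sqr_ge0.
rewrite !fubini_tonelli1//; [|exact: measurable_nc2E..].
apply: ge0_le_integral => //.
- by move=> x _; apply: integral_ge0 => y _.
- exact: (measurable_fun_fubini_tonelli_F _ (measurable_nc2E mW)).
- exact: (measurable_fun_fubini_tonelli_F _ (measurable_nc2E mk)).
- move=> x _; rewrite /fubini_F.
  under eq_integral do rewrite wignerE/=.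
  by apply: bessel; have [] := cint_wigner_kernel x t0 t1 Lf.
Qed.

End wigner_bounds.

(** * Averaging over the parameter tau *)

Section unit_measure.
Context {R : realType}.

(** Lebesgue measure restricted to ]0, 1[, as a measure on the whole line: it
    allows Fubini's theorem on the product of the parameter space with phase
    space. *)
Definition unit_interval_measure : set (measurableTypeR R) -> \bar R :=
  mrestr lebesgue_measure (measurable_itv `]0%R, 1%R[).

HB.instance Definition _ := Measure.on unit_interval_measure.

Lemma unit_interval_measureT : unit_interval_measure setT = 1%E.
Proof.
by rewrite /unit_interval_measure /mrestr setTI lebesgue_measure_itv/= lte_fin ltr01 oppr0 adde0.
Qed.

Lemma unit_interval_measure_fin : fin_num_fun unit_interval_measure.
Proof.
move=> A mA; rewrite ge0_fin_numE//; apply: (@le_lt_trans _ _ 1%E); last by rewrite ltry.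
by rewrite -unit_interval_measureT; apply: le_measure; rewrite ?inE.
Qed.

HB.instance Definition _ :=
  Measure_isFinite.Build _ _ _ unit_interval_measure unit_interval_measure_fin.

Definition unit_measure : {finite_measure set (measurableTypeR R) -> \bar R} :=
  unit_interval_measure.

Lemma ae_unit_measure : {ae unit_measure, forall tau : R, 0 < tau < 1}.
Proof.
exists (~` `]0%R, 1%R[%classic); split; first exact: measurableC.
  by rewrite /unit_measure/= /unit_interval_measure /mrestr setICl measure0.
by apply: subsetC => t /=; rewrite in_itv.
Qed.

Lemma integral_unit_measure (f : measurableTypeR R -> \bar R) : measurable_fun setT f ->
  (\int[unit_measure]_t f t = \int[lebesgue_measure]_(t in `]0%R, 1%R[) f t)%E.
Proof.
move=> mf; transitivity (\int[unit_measure]_(t in `]0%R, 1%R[) f t)%E; last first.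
  apply: eq_measure_integral => A mA AS.
  rewrite /= /unit_interval_measure /mrestr; congr (lebesgue_measure _); exact: setIidl.
rewrite [RHS]integral_mkcond; apply: ae_eq_integral => //.
  by apply/(measurable_restrictT _ (measurable_itv _)); exact: measurable_funTS.
apply: (ae_imp ae_unit_measure) => t t01 _.
by rewrite patchE mem_set//= in_itv.
Qed.

Lemma intC_unit_measure (F : R -> R[i]) : cmeas F ->
  integralC (@lebesgue_measure R) `]0%R, 1%R[ F = integralC unit_measure setT F.
Proof.
move=> [m1 m2]; apply: complex_eqP; rewrite /= /Rintegral integral_unit_measure//.
  exact/measurable_EFinP.
exact/measurable_EFinP.
Qed.

Lemma integral_powR_itv (a e : R) : 0 <= a < 1 -> 0 < e < 1 ->
  (\int[lebesgue_measure]_(t in `[e, 1%R]) (t `^ (- a))%:E <= ((1 - a)^-1)%:E)%E.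
Proof.
move=> /andP[a0 a1] /andP[e0 e1].
pose F (t : R) := (1 - a)^-1 * t `^ (1 - a).
have a1' : 0 < 1 - a by rewrite subr_gt0.
have dF (t : R) : 0 < t -> is_derive t 1 F (t `^ (- a)).
  move=> t0; have := is_derive1_powR (1 - a) t0 => d1.
  apply: is_derive_eq; rewrite /GRing.scale/= mulrA mulVf ?gt_eqF// mul1r.
  by congr (_ `^ _); ring.
have cF (t : R) : 0 < t -> {for t, continuous F}.
  move=> t0; apply: differentiable_continuous; apply/derivable1_diffP.
  by have [] := dF t t0.
rewrite (@continuous_FTC2 _ (fun t => t `^ (- a)) F)//.
- rewrite -EFinB lee_fin /F powR1 mulr1 lerBlDr lerDl.
  by rewrite mulr_ge0 ?powR_ge0// invr_ge0 ltW.
- apply: continuous_in_subspaceT => t; rewrite inE/= in_itv/= => /andP[et _].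
  have t0 := lt_le_trans e0 et.
  apply: differentiable_continuous; apply/derivable1_diffP.
  by have [] := is_derive1_powR (- a) t0.
- split.
  + by move=> t; rewrite in_itv/= => /andP[et _]; have [] := dF t (lt_trans e0 et).
  + by apply: cvg_at_right_filter; exact: cF.
  + by apply: cvg_at_left_filter; exact: cF.
- move=> t; rewrite in_itv/= => /andP[et _].
  by rewrite derive1E; have [_ ->] := dF t (lt_trans e0 et).
Qed.

Lemma integral_powR01 (a : R) : 0 <= a < 1 ->
  (\int[unit_measure]_t (t `^ (- a))%:E <= ((1 - a)^-1)%:E)%E.
Proof.
move=> a01; have mf : measurable_fun setT (fun t : R => (t `^ (- a))%:E).
  by apply/measurable_EFinP; exact: measurable_powR.
rewrite integral_unit_measure//.
pose F (i : nat) : set (measurableTypeR R) := `[i.+2%:R^-1, 1]%classic.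
have F01 : `]0, 1[%classic `<=` \bigcup_i F i.
  move=> t /=; rewrite in_itv/= => /andP[t0 t1].
  have [k kt] := ltr_add_invr t0.
  exists k => //; rewrite /F/= in_itv/= (ltW t1) andbT.
  rewrite add0r in kt; apply: le_trans (ltW kt).
  by rewrite lef_pV2 ?posrE// ler_nat.
have mF i : measurable (F i) by exact: measurable_itv.
have f0 (t : R) : (0 <= (t `^ (- a))%:E)%E by rewrite lee_fin powR_ge0.
apply: (@le_trans _ _ (\int[lebesgue_measure]_(t in \bigcup_i F i) (t `^ (- a))%:E)%E).
  apply: ge0_subset_integral => //; first exact: bigcup_measurable.
  exact: measurable_funTS.
have ndF : nondecreasing_seq F.
  move=> i j ij; apply/subsetPset => t; rewrite /F/= !in_itv/= => /andP[it ->].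
  rewrite andbT; apply: le_trans it.
  by rewrite lef_pV2 ?posrE// ler_nat !ltnS.
have H := @ge0_nondecreasing_set_cvg_integral _ _ R F (fun t => (t `^ (- a))%:E)
  lebesgue_measure ndF mF (fun i => measurable_funTS mf) (fun _ _ _ => f0 _).
rewrite -(cvg_lim _ H)//; apply: lime_le; first by apply/cvg_ex; eexists; exact: H.
apply: nearW => i; apply: integral_powR_itv => //.
by rewrite invr_gt0 ltr0n/= invf_lt1// ltr1n.
Qed.

End unit_measure.

Section singular_weight.
Context {R : realType} {d : nat}.

Lemma unit_measure_reflect (f : measurableTypeR R -> \bar R) : measurable_fun setT f ->
  (forall t, 0 <= f t)%E ->
  (\int[unit_measure]_t f (1 - t)%R = \int[unit_measure]_t f t)%E.
Proof.
move=> mf f0.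
have mr : measurable_fun setT (fun t : measurableTypeR R => f (1 - t)%R).
  by apply: (measurableT_comp mf); apply: measurable_funB.
rewrite !integral_unit_measure// [LHS]integral_mkcond [RHS]integral_mkcond.
pose g := f \_ (`]0%R, 1%R[%classic : set (measurableTypeR R)).
have mg : measurable_fun setT g.
  by apply/(measurable_restrictT _ (measurable_itv _)); exact: measurable_funTS.
have g0 t : (0 <= g t)%E by rewrite /g patchE; case: ifP.
transitivity (\int[lebesgue_measure]_t g (1 + (-1) * t)%R)%E; last first.
  rewrite integral_affine// ?oppr_eq0 ?oner_eq0//.
  by rewrite normrN1 invr1 mul1e.
apply: eq_integral => t _; rewrite /g !patchE mulN1r.
suff -> : (1 - t \in (`]0%R, 1%R[%classic : set R)) = (t \in (`]0%R, 1%R[%classic : set R)) by [].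
by apply/idP/idP; rewrite !inE/= !in_itv/= => /andP[? ?]; apply/andP; split; lra.
Qed.

Lemma measurable_invX_norm (n : nat) : measurable_fun setT (fun t : R => `|t| ^- n).
Proof.
rewrite (_ : (fun t => _) = (fun t : R => `|t| `^ (- n%:R))).
  apply: (measurableT_comp (measurable_powR _)).
  exact: normr_measurable.
by apply/funext => t; rewrite powR_invn.
Qed.

Lemma measurable_sup_const : measurable_fun setT (@sup_const R d).
Proof.
apply: (measurableT_comp (continuous_measurable_fun (@sqrt_continuous R))).
apply: measurable_funM; first exact: measurable_invX_norm.
apply: (measurableT_comp (measurable_invX_norm d)).
by apply: measurable_funB.
Qed.

Lemma sup_const_gt0 (t : R) : 0 < t < 1 -> 0 < @sup_const R d t.
Proof.
move=> /andP[t0 t1]; rewrite sqrtr_gt0 mulr_gt0// invr_gt0 exprn_gt0// normr_gt0.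
  by rewrite gt_eqF.
by rewrite subr_eq0 gt_eqF.
Qed.

Lemma sup_const_powR (c t : R) : 0 < t < 1 ->
  @sup_const R d t `^ c = (t * (1 - t)) `^ (- (d%:R / 2 * c)).
Proof.
move=> /andP[t0 t1]; have t1' : 0 < 1 - t by rewrite subr_gt0.
rewrite /sup_const (gtr0_norm t0) (gtr0_norm t1') -powR12_sqrt; last first.
  by rewrite mulr_ge0// invr_ge0 exprn_ge0// ltW.
rewrite -!powR_invn ?ltW// -powRM ?ltW// -!powRrM; by congr (_ `^ _); rewrite mulNr mulrA.
Qed.

(** A bound for the integral over ]0, 1[ of (tau (1 - tau))^(-a): one of the
    two factors is at most 2^a, and each power integrates to at most 1/(1 - a).
    *)
Definition weight_bound (a : R) : R := 2 `^ a * ((1 - a)^-1 + (1 - a)^-1).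

Lemma integral_singular_weight (c : R) : 0 <= d%:R / 2 * c < 1 ->
  (\int[unit_measure]_t (@sup_const R d t `^ c)%:E <= (weight_bound (d%:R / 2 * c))%:E)%E.
Proof.
set a := d%:R / 2 * c => a01; have /andP[a0 a1] := a01.
have mp : measurable_fun setT (fun t : R => (t `^ (- a))%:E).
  by apply/measurable_EFinP; exact: measurable_powR.
have mp' : measurable_fun setT (fun t : R => ((1 - t) `^ (- a))%:E).
  apply/measurable_EFinP; apply: (measurableT_comp (measurable_powR _)).
  by apply: measurable_funB.
have p0 (t : R) : (0 <= (t `^ (- a))%:E)%E by rewrite lee_fin powR_ge0.
have b0 : (0 <= (2 `^ a)%:E :> \bar R)%E by rewrite lee_fin powR_ge0.
apply: (@le_trans _ _ (\int[unit_measure]_t ((2 `^ a)%:E * ((t `^ (- a))%:E + ((1 - t) `^ (- a))%:E)))%E).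
  apply: ae_ge0_le_integral => //.
  - by move=> t _; rewrite lee_fin powR_ge0.
  - apply/measurable_EFinP; apply: (measurableT_comp (measurable_powR _)).
    exact: measurable_sup_const.
  - by move=> t _; rewrite mule_ge0// adde_ge0.
  - by apply: emeasurable_funM => //; exact: emeasurable_funD.
  - apply: (ae_imp ae_unit_measure) => t t01 _; rewrite sup_const_powR// -/a.
    have /andP[t0 t1] := t01; have t1' : 0 < 1 - t by rewrite subr_gt0.
    rewrite -EFinD -EFinM lee_fin (powRM _ (ltW t0) (ltW t1')).
    have half (s : R) : 2^-1 <= s -> s `^ (- a) <= 2 `^ a.
      move=> s2; have s0 : 0 < s by apply: lt_le_trans s2; rewrite invr_gt0.
      rewrite powRN -[leLHS]mul1r ler_pdivrMr ?powR_gt0// -(powRM _ _ (ltW s0))//.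
      rewrite [leLHS](_ : 1 = 1 `^ a); last by rewrite powR1.
      apply: ge0_ler_powR => //.
      - by rewrite nnegrE.
      - by rewrite nnegrE mulr_ge0// ltW.
      - lra.
    have [th|th] := leP 2^-1 t.
      have := half t th; have := powR_ge0 (1 - t) (- a); have := powR_ge0 t (- a).
      have := powR_ge0 2 a; nra.
    have th' : 2^-1 <= 1 - t by lra.
    have := half _ th'; have := powR_ge0 (1 - t) (- a); have := powR_ge0 t (- a).
    have := powR_ge0 2 a; nra.
rewrite ge0_integralZl//; last 2 first.
- exact: emeasurable_funD.
- by move=> t _; rewrite adde_ge0.
rewrite ge0_integralD//.
have := unit_measure_reflect mp p0 => /= ->.
by rewrite /weight_bound EFinM EFinD; apply: lee_wpmul2l => //; apply: leeD; exact: integral_powR01.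
Qed.

End singular_weight.

(** * L^q bounds for the Born-Jordan distribution *)

Section weighted_hoelder.
Context {disp} {T : measurableType disp} {R : realType}.
Variable mu : {measure set T -> \bar R}.

(** Hoelder's inequality applied to h = (h rho^(-1 + 1/q)) (rho^(1 - 1/q)). *)
Lemma weighted_hoelder (h rho : T -> R) (q I : R) : 1 < q ->
  measurable_fun setT h -> measurable_fun setT rho ->
  (forall t, 0 <= h t) -> (forall t, 0 <= rho t) -> {ae mu, forall t, 0 < rho t} ->
  0 <= I -> (\int[mu]_t (rho t)%:E <= I%:E)%E ->
  ((\int[mu]_t (h t)%:E) `^ q <=
   (I `^ (q - 1))%:E * \int[mu]_t (h t `^ q * rho t `^ (1 - q))%:E)%E.
Proof.
move=> q1 mh mr h0 r0 rpos I0 Ir.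
have q0 : 0 < q by apply: lt_trans q1.
have qn0 : q != 0 by rewrite gt_eqF.
have q1' : 0 < q - 1 by rewrite subr_gt0.
have q1n : q - 1 != 0 by rewrite gt_eqF.
pose f1 t := h t * rho t `^ ((1 - q) / q).
pose g1 t := rho t `^ ((q - 1) / q).
have mf1 : measurable_fun setT f1.
  by apply: measurable_funM => //; exact: (measurableT_comp (measurable_powR _)).
have mg1 : measurable_fun setT g1 by exact: (measurableT_comp (measurable_powR _)).
have f10 t : 0 <= f1 t by rewrite mulr_ge0// powR_ge0.
have g10 t : 0 <= g1 t by rewrite powR_ge0.
have q'0 : 0 < q / (q - 1) by rewrite divr_gt0.
have H := hoelder mu mf1 mg1 q0 q'0.
have {}H : (Lnorm mu 1 (EFin \o (f1 \* g1)%R) <= Lnorm mu q%:E (EFin \o f1) * Lnorm mu (q / (q - 1))%:E (EFin \o g1))%E.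
  by apply: H; field; rewrite qn0 q1n.
have E1 : (Lnorm mu 1 (EFin \o (f1 \* g1)%R) = \int[mu]_t (h t)%:E)%E.
  rewrite Lnorm1; apply: ae_eq_integral => //.
  - apply: measurableT_comp => //; apply/measurable_EFinP; exact: measurable_funM.
  - exact/measurable_EFinP.
  - apply: (ae_imp rpos) => t rt _ /=.
    rewrite (ger0_norm (mulr_ge0 (f10 t) (g10 t))).
    rewrite /f1 /g1 -mulrA -powRD; last by rewrite (gt_eqF rt) implybT.
    by rewrite -mulrDl addrC subrKA subrr mul0r powRr0 mulr1.
have E2 : (Lnorm mu q%:E (EFin \o f1) = (\int[mu]_t (h t `^ q * rho t `^ (1 - q))%:E) `^ q^-1)%E.
  rewrite unlock; congr (_ `^ _)%E; apply: eq_integral => t _ /=.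
  rewrite ger0_norm// /f1 powRM// ?powR_ge0// -powRrM; congr (_ * _ `^ _)%:E.
  by field.
have E3 : (Lnorm mu (q / (q - 1))%:E (EFin \o g1) <= (I `^ ((q - 1) / q))%:E)%E.
  rewrite unlock (_ : (q / (q - 1))^-1 = (q - 1) / q); last by rewrite invf_div.
  have -> : (\int[mu]_x `|(EFin \o g1) x| `^ (q / (q - 1)) = \int[mu]_t (rho t)%:E)%E.
    apply: eq_integral => t _ /=; rewrite ger0_norm// /g1 -powRrM.
    by rewrite mulrA divfK// divff// powRr1.
  rewrite -poweR_EFin; apply: gt0_ler_poweR => //=.
  - by rewrite divr_ge0// ltW.
  - by rewrite in_itv/= leey integral_ge0// => x _; rewrite lee_fin.
  - by rewrite in_itv/= leey lee_fin I0.
have X0 : (0 <= \int[mu]_t (h t `^ q * rho t `^ (1 - q))%:E)%E.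
  by apply: integral_ge0 => t _; rewrite lee_fin mulr_ge0// powR_ge0.
have S0 : (0 <= \int[mu]_t (h t)%:E)%E by apply: integral_ge0 => t _; rewrite lee_fin.
rewrite E1 E2 in H.
have {}H : (\int[mu]_t (h t)%:E <= (\int[mu]_t (h t `^ q * rho t `^ (1 - q))%:E) `^ q^-1 * (I `^ ((q - 1) / q))%:E)%E.
  by apply: le_trans H _; apply: lee_wpmul2l => //; exact: poweR_ge0.
have {}H := @gt0_ler_poweR _ _ (ltW q0) _ _ _ _ H.
apply: le_trans (H _ _) _.
- by rewrite in_itv/= leey S0.
- by rewrite in_itv/= leey mule_ge0// ?poweR_ge0// lee_fin powR_ge0.
rewrite poweRM ?poweR_ge0 ?lee_fin ?powR_ge0// -poweRrM mulVf// poweRe1// muleC.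
by rewrite poweR_EFin -powRrM divfK.
Qed.

End weighted_hoelder.

Section born_jordan_Lq.
Context {R : realType} {d : nat}.
Local Notation E := (euclidean R d).
Local Notation lam := (leb R d).
Local Notation leb2 := (prodm lam lam).
Local Notation nu := (@unit_measure R).
Implicit Types f : E -> R[i].

Lemma cmeas_wigner_tau f z : cmeas f -> cmeas (fun tau : R => wigner tau f z).
Proof. by move=> mf; exact: (cmeas_sec2 z (cmeas_wigner_joint mf)). Qed.

Lemma born_jordanE f z : cmeas f ->
  born_jordan f z = integralC nu setT (fun tau => wigner tau f z).
Proof. by move=> mf; rewrite /born_jordan intC_unit_measure//; exact: cmeas_wigner_tau. Qed.

Lemma cmeas_born_jordan f : cmeas f -> cmeas (born_jordan f).
Proof.
move=> mf; have -> : born_jordan f = fun z => integralC nu setT (fun tau => wigner tau f z).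
  by apply/funext => z; rewrite born_jordanE.
exact: (cmeas_int2 nu (cmeas_wigner_joint mf)).
Qed.

(** Interpolation inside the integral: |W_tau f|^q is at most the sup bound to
    the power q - 2 times |W_tau f|^2. Taking as Hoelder weight the power (q -
    2)/q of the sup constant leaves |W_tau f|^2 times the same weight; the
    weight is integrable in tau, and the squared L^2 norm of W_tau f is bounded
    uniformly in tau. *)
Lemma born_jordan_abs_Lq f (N q : R) : 2 <= q -> d%:R / 2 * ((q - 2) / q) < 1 -> L2le lam N f ->
  (\int[leb2]_z ((\int[nu]_tau (nc (wigner tau f z))%:E) `^ q) <=
    (weight_bound (d%:R / 2 * ((q - 2) / q)) `^ q * N `^ q)%:E)%E.
Proof.
move=> q2 a1 Lf; set c := (q - 2) / q in a1 *; set I := weight_bound _.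
have [mf _] := Lf; have N0 := L2le_ge0 Lf.
have q0 : 0 < q by apply: lt_le_trans q2.
have qn0 : q != 0 by rewrite gt_eqF.
have q1 : 1 < q by apply: lt_le_trans q2; lra.
have c0 : 0 <= c by rewrite divr_ge0 ?subr_ge0// ltW.
have a0 : 0 <= d%:R / 2 * c by rewrite mulr_ge0// divr_ge0.
have a01 : 0 <= d%:R / 2 * c < 1 by rewrite a0.
have HI := integral_singular_weight a01.
have I0 : 0 <= I.
  by rewrite -lee_fin; apply: le_trans HI; apply: integral_ge0 => t _; rewrite lee_fin powR_ge0.
pose rho (t : R) := @sup_const R d t `^ c.
have mrho : measurable_fun setT rho.
  by apply: (measurableT_comp (measurable_powR _)); exact: measurable_sup_const.
have rho_pos : {ae nu, forall t, 0 < rho t}.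
  by apply: (ae_imp ae_unit_measure) => t t01; rewrite powR_gt0// sup_const_gt0.
have mW := cmeas_wigner_joint mf.
pose X (p : R * (E * E)) := (nc (wigner p.1 f p.2) `^ q * rho p.1 `^ (1 - q))%:E.
have mX : measurable_fun setT X.
  apply/measurable_EFinP; apply: measurable_funM.
    by apply: (measurableT_comp (measurable_powR _)); exact: (measurable_nc mW).
  apply: (measurableT_comp (measurable_powR _)).
  exact: (measurableT_comp mrho measurable_fst).
have X0 p : (0 <= X p)%E by rewrite lee_fin mulr_ge0// powR_ge0.
have mXz : measurable_fun setT (fun z => \int[nu]_tau X (tau, z))%E.
  exact: (@measurable_fun_fubini_tonelli_G _ _ _ _ _ nu X mX X0).
have mXt : measurable_fun setT (fun tau => \int[leb2]_z X (tau, z))%E.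
  exact: (@measurable_fun_fubini_tonelli_F _ _ _ _ _ leb2 X mX X0).
apply: (@le_trans _ _ (\int[leb2]_z ((I `^ (q - 1))%:E * \int[nu]_tau X (tau, z)))%E).
  apply: ge0_le_integral => //.
  - by move=> z _; exact: poweR_ge0.
  - exact: (measurableT_comp (measurable_poweR q) (measurable_int_nc2 nu mW)).
  - exact: emeasurable_funM.
  - move=> z _; apply: weighted_hoelder => //.
    + by apply: measurable_nc; exact: cmeas_wigner_tau.
    + by move=> t; exact: nc_ge0.
    + by move=> t; exact: powR_ge0.
rewrite ge0_integralZl//; last 2 first.
- by move=> z _; apply: integral_ge0.
- by rewrite lee_fin powR_ge0.
have -> : (\int[leb2]_z \int[nu]_tau X (tau, z) = \int[nu]_tau \int[leb2]_z X (tau, z))%E.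
  exact/esym/(@fubini_tonelli _ _ _ _ R nu leb2 X mX X0).
have bound : {ae nu, forall t, (\int[leb2]_z X (t, z) <= (rho t)%:E * (N `^ q)%:E)%E}.
  apply: (ae_imp ae_unit_measure) => t t01; have /andP[t0 t1] := t01.
  have tn0 : t != 0 by rewrite gt_eqF.
  have tn1 : t != 1 by rewrite lt_eqF.
  have s0 := @sup_const_gt0 R d _ t01.
  have [mWt WN] := wigner_L2 tn0 tn1 Lf.
  pose K := @sup_const R d t `^ (q - 2) * N `^ (q - 2) * rho t `^ (1 - q).
  have K0 : 0 <= K by rewrite !mulr_ge0// powR_ge0.
  apply: (@le_trans _ _ (\int[leb2]_z (K%:E * (nc (wigner t f z) ^+ 2)%:E))%E).
    apply: ge0_le_integral.
    - exact: measurableT.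
    - by move=> z _; exact: X0.
    - exact: (measurableT_comp mX (measurable_pair1 t)).
    - exact: (emeasurable_funM (measurable_cst _) (measurable_nc2E mWt)).
    - move=> z _; rewrite -EFinM lee_fin /X /K /=.
      have w0 := nc_ge0 (wigner t f z).
      have ws := wigner_sup z tn0 tn1 Lf.
      rewrite mulrAC ler_wpM2r ?powR_ge0//.
      have -> : nc (wigner t f z) `^ q = nc (wigner t f z) `^ (q - 2) * nc (wigner t f z) ^+ 2.
        rewrite -powR_mulrn// -powRD ?subrK//.
        by rewrite (negbTE qn0) implyFb.
      rewrite ler_wpM2r ?sqr_ge0// -powRM ?(ltW s0)//.
      by apply: ge0_ler_powR; rewrite ?subr_ge0// ?nnegrE// mulr_ge0// ltW.
  rewrite ge0_integralZl//; last 2 first.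
  - exact: measurable_nc2E.
  - by move=> z _; rewrite lee_fin sqr_ge0.
  apply: (@le_trans _ _ (K%:E * (N * N)%:E)%E); first by apply: lee_wpmul2l.
  rewrite -!EFinM lee_fin le_eqVlt; apply/orP; left; apply/eqP; rewrite /K.
  have -> : @sup_const R d t `^ (q - 2) = rho t `^ q.
    by rewrite /rho -powRrM /c divfK.
  have rt : 0 < rho t by rewrite powR_gt0.
  have -> : rho t `^ q * N `^ (q - 2) * rho t `^ (1 - q) * (N * N) =
      (rho t `^ q * rho t `^ (1 - q)) * (N `^ (q - 2) * (N ^+ 2)) by ring.
  rewrite -powRD; last by rewrite (gt_eqF rt) implybT.
  rewrite -powR_mulrn// -powRD; last by rewrite subrK (negbTE qn0) implyFb.
  by rewrite addrC subrK powRr1 ?(ltW rt)// subrK.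
apply: (@le_trans _ _ ((I `^ (q - 1))%:E * (I%:E * (N `^ q)%:E))%E).
  apply: lee_wpmul2l; first by rewrite lee_fin powR_ge0.
  apply: (@le_trans _ _ (\int[nu]_t ((rho t)%:E * (N `^ q)%:E))%E).
    apply: ae_ge0_le_integral => //.
    - by move=> t _; apply: integral_ge0 => z _; exact: X0.
    - by move=> t _; rewrite mule_ge0// lee_fin powR_ge0.
    - by apply: emeasurable_funM => //; exact/measurable_EFinP.
    - by apply: (ae_imp bound) => t bt _.
  rewrite ge0_integralZr//.
  - by apply: lee_wpmul2r => //; rewrite lee_fin powR_ge0.
  - exact/measurable_EFinP.
  - by move=> t _; rewrite lee_fin powR_ge0.
  - by rewrite lee_fin powR_ge0.
rewrite -!EFinM lee_fin mulrA ler_wpM2r ?powR_ge0// mulrC mulr_powRB1//.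
Qed.

(** The absolute value of an average is at most the average of the absolute
    values. *)
Lemma born_jordan_Lq f (N q : R) : 2 <= q -> d%:R / 2 * ((q - 2) / q) < 1 -> L2le lam N f ->
  (\int[leb2]_z (nc (born_jordan f z) `^ q)%:E <=
    (weight_bound (d%:R / 2 * ((q - 2) / q)) `^ q * N `^ q)%:E)%E.
Proof.
move=> q2 a1 Lf; have [mf _] := Lf; apply: le_trans (born_jordan_abs_Lq q2 a1 Lf).
have q0 : 0 < q by apply: lt_le_trans q2.
have qn0 : q != 0 by rewrite gt_eqF.
have mW := cmeas_wigner_joint mf.
apply: ge0_le_integral => //.
- by move=> z _; rewrite lee_fin powR_ge0.
- apply/measurable_EFinP; apply: (measurableT_comp (measurable_powR _)).
  by apply: measurable_nc; exact: cmeas_born_jordan.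
- exact: (measurableT_comp (measurable_poweR q) (measurable_int_nc2 nu mW)).
- move=> z _; rewrite -poweR_EFin; apply: gt0_ler_poweR; rewrite ?(ltW q0)//.
  + move: (nc_ge0 (born_jordan f z)); move: (nc (born_jordan f z)) => w w0.
    by rewrite in_itv/= leey lee_fin w0.
  + by rewrite in_itv/= leey integral_ge0// => t _; rewrite lee_fin nc_ge0.
  + by rewrite born_jordanE//; apply: nc_intC_le; exact: cmeas_wigner_tau.
Qed.

End born_jordan_Lq.

(** * Hilbert-Schmidt forms and weak convergence *)

Lemma ncD (R : realType) (z w : R[i]) : nc (z + w) <= nc z + nc w.
Proof. exact: (@le_normcD R z w). Qed.

Lemma ncN (R : realType) (z : R[i]) : nc (- z) = nc z.
Proof. exact: (@normcN R z). Qed.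

Section weak_null.
Context {disp} {T : measurableType disp} {R : realType}.
Variable mu : {sigma_finite_measure set T -> \bar R}.

(** The pairing is bilinear; conjugating the test function gives the usual
    inner product. *)
Definition weakly_null (g_ : nat -> T -> R[i]) : Prop := forall M h, L2le mu M h ->
  nc (integralC mu setT (fun x => g_ n x * h x)) @[n --> \oo] --> (0 : R).

Lemma weakly_null_conj N (g_ : nat -> T -> R[i]) : (forall n, L2le mu N (g_ n)) -> weakly_null g_ ->
  weakly_null (fun n x => conjc (g_ n x)).
Proof.
move=> Lg wg M h Lh; have := wg M _ (L2le_conj Lh).
apply: cvg_trans; apply: near_eq_cvg; apply: nearW => n.
rewrite -nc_conj -intC_conj; last first.
  exact: L2le_cint_mul (Lg n) (L2le_conj Lh).
by congr nc; apply: eq_intC => x; rewrite rmorphM /= conjcK.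
Qed.

Lemma L2le_sections (M : R) (K : T * T -> R[i]) : L2le (prodm mu mu) M K ->
  [/\ measurable_fun setT (fun v => \int[mu]_u (nc (K (u, v)) ^+ 2)%:E)%E,
    (\int[mu]_v \int[mu]_u (nc (K (u, v)) ^+ 2)%:E <= M%:E)%E &
    {ae mu, forall v, L2le mu (fine (\int[mu]_u (nc (K (u, v)) ^+ 2)%:E)%E) (fun u => K (u, v))}].
Proof.
move=> [mK iK].
have p0 z : (0 <= (nc (K z) ^+ 2)%:E)%E by rewrite lee_fin sqr_ge0.
have mS : measurable_fun setT (fun v => \int[mu]_u (nc (K (u, v)) ^+ 2)%:E)%E.
  exact: (@measurable_fun_fubini_tonelli_G _ _ _ _ _ mu (fun z => (nc (K z) ^+ 2)%:E) (measurable_nc2E mK) p0).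
have iS : (\int[mu]_v \int[mu]_u (nc (K (u, v)) ^+ 2)%:E <= M%:E)%E.
  apply: le_trans iK; rewrite le_eqVlt; apply/orP; left; apply/eqP/esym.
  exact: (@fubini_tonelli2 _ _ _ _ _ mu mu _ (measurable_nc2E mK) p0).
split => //.
have ae1 : {ae mu, forall v, (\int[mu]_u (nc (K (u, v)) ^+ 2)%:E < +oo)%E}.
  apply: ae_ltey => //; first by move=> v; apply: integral_ge0 => u _.
  by apply: le_lt_trans iS _; rewrite ltry.
by apply: (ae_imp ae1) => v vfin; apply: L2le_fine => //; exact: cmeas_sec2.
Qed.

Lemma measurable_int_kernel (g : T -> R[i]) (K : T * T -> R[i]) : cmeas g -> cmeas K ->
  cmeas (fun v => integralC mu setT (fun u => g u * K (u, v))).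
Proof.
move=> mg mK; apply: (@cmeas_int2 _ _ T T R mu (fun z => g z.1 * K z)).
by apply: cmeasM => //; apply: (cmeas_comp _ mg); exact: measurable_fst.
Qed.

(** The exceptional null set does not depend on g, so that the bound can be
    used for a whole sequence at once. *)
Lemma int_kernel_bound (N M : R) (K : T * T -> R[i]) : L2le (prodm mu mu) M K ->
  {ae mu, forall v, forall g, L2le mu N g ->
   ((nc (integralC mu setT (fun u => (g u * K (u, v))%R)) ^+ 2)%:E <=
    N%:E * \int[mu]_u (nc (K (u, v)) ^+ 2)%:E)%E}.
Proof.
move=> LK; have [_ _ aeS] := L2le_sections LK.
apply: (ae_imp aeS) => v Lv g Lg; have N0 := L2le_ge0 Lg.
have S0 : (0 <= \int[mu]_u (nc (K (u, v)) ^+ 2)%:E)%E.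
  by apply: integral_ge0 => u _; rewrite lee_fin sqr_ge0.
have Sfin : (\int[mu]_u (nc (K (u, v)) ^+ 2)%:E)%E \is a fin_num.
  by rewrite ge0_fin_numE//; exact: L2le_lty Lv.
rewrite -[X in (_ <= _ * X)%E]fineK// -EFinM lee_fin.
have H := L2le_mul Lg Lv.
rewrite -[leRHS]sqr_sqrtr; last by rewrite mulr_ge0// fine_ge0.
by rewrite lerXn2r// nnegrE ?nc_ge0 ?sqrtr_ge0.
Qed.

Lemma L2le_int_kernel (N M : R) (g : T -> R[i]) (K : T * T -> R[i]) :
  L2le mu N g -> L2le (prodm mu mu) M K ->
  L2le mu (N * M) (fun v => integralC mu setT (fun u => g u * K (u, v))).
Proof.
move=> Lg LK; have N0 := L2le_ge0 Lg; have [mS iS _] := L2le_sections LK.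
have S0 v : (0 <= \int[mu]_u (nc (K (u, v)) ^+ 2)%:E)%E.
  by apply: integral_ge0 => u _; rewrite lee_fin sqr_ge0.
have mB := measurable_int_kernel Lg.1 LK.1.
split; first exact: mB.
apply: (@le_trans _ _ (\int[mu]_v (N%:E * \int[mu]_u (nc (K (u, v)) ^+ 2)%:E))%E).
  apply: ae_ge0_le_integral => //.
  - by move=> v _; rewrite lee_fin sqr_ge0.
  - exact: measurable_nc2E mB.
  - by move=> v _; rewrite mule_ge0.
  - exact: emeasurable_funM.
  - by apply: (ae_imp (int_kernel_bound N LK)) => v bv _; exact: bv.
by rewrite ge0_integralZl// EFinM; apply: lee_wpmul2l.
Qed.

(** A Hilbert-Schmidt operator maps weakly null bounded sequences to strongly
    null ones: its values tend to zero pointwise because almost every section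
    of the kernel is square integrable, and they are dominated by the
    Cauchy-Schwarz inequality. *)
Lemma hilbert_schmidt_null N (g_ : nat -> T -> R[i]) M (K : T * T -> R[i]) :
  (forall n, L2le mu N (g_ n)) -> weakly_null g_ -> L2le (prodm mu mu) M K ->
  (forall n, L2le mu (N * M) (fun v => integralC mu setT (fun u => g_ n u * K (u, v)))) /\
  (\int[mu]_v (nc (integralC mu setT (fun u => g_ n u * K (u, v))) ^+ 2)%:E)%E
    @[n --> \oo] --> 0%E.
Proof.
move=> Lg wg LK; have N0 := L2le_ge0 (Lg 0); have [mK iK] := LK.
have [mS iS aeS] := L2le_sections LK.
split; first by move=> n; exact: L2le_int_kernel (Lg n) LK.
pose B n v := integralC mu setT (fun u => g_ n u * K (u, v)).
have mB n : cmeas (B n) by exact: measurable_int_kernel (Lg n).1 mK.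
have S0 v : (0 <= \int[mu]_u (nc (K (u, v)) ^+ 2)%:E)%E.
  by apply: integral_ge0 => u _; rewrite lee_fin sqr_ge0.
have mNS : measurable_fun setT (fun v => N%:E * \int[mu]_u (nc (K (u, v)) ^+ 2)%:E)%E.
  exact: emeasurable_funM.
have iNS : (\int[mu]_v (N%:E * \int[mu]_u (nc (K (u, v)) ^+ 2)%:E) <= (N * M)%:E)%E.
  by rewrite ge0_integralZl// EFinM; apply: lee_wpmul2l.
have bB : {ae mu, forall v n, ((nc (B n v) ^+ 2)%:E <= N%:E * \int[mu]_u (nc (K (u, v)) ^+ 2)%:E)%E}.
  by apply: (ae_imp (int_kernel_bound N LK)) => v bv n; exact: bv.
apply: (@dominated_cvg0 _ _ _ mu (fun n v => (nc (B n v) ^+ 2)%:E) _ _ _ bB) => //.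
- by move=> n; exact: measurable_nc2E (mB n).
- by move=> n v; rewrite lee_fin sqr_ge0.
- by apply: le_lt_trans iNS _; rewrite ltry.
- by move=> v; rewrite mule_ge0.
- apply: (ae_imp aeS) => v Lv.
  have := wg _ _ Lv => H.
  apply: cvg_EFin; first by apply: nearW => n.
  rewrite -[X in _ --> X](mulr0 (0 : R)); under eq_fun do rewrite /= expr2.
  by apply: cvgM; exact: H.
Qed.

(** With g_n = f_n - f, the difference of the two forms is the form of (g_n,
    f_n) plus the form of (f, g_n). In the first the integral against g_n tends
    to zero in norm, and the second is a weakly null sequence paired with a
    fixed function. *)
Lemma hs_form_cvg N (f_ : nat -> T -> R[i]) f M (K : T * T -> R[i]) :
  (forall n, L2le mu N (f_ n)) -> L2le mu N f ->
  (forall n, L2le mu (4 * N) (fun x => f_ n x - f x)) ->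
  weakly_null (fun n x => f_ n x - f x) -> L2le (prodm mu mu) M K ->
  nc (integralC (prodm mu mu) setT (fun w => f_ n w.1 * conjc (f_ n w.2) * K w) -
      integralC (prodm mu mu) setT (fun w => f w.1 * conjc (f w.2) * K w))
    @[n --> \oo] --> (0 : R).
Proof.
move=> Lfn Lf Lg wg LK.
have Li (a b : T -> R[i]) A B : L2le mu A a -> L2le mu B b ->
    cint (prodm mu mu) (fun w => a w.1 * conjc (b w.2) * K w).
  by move=> La Lb; exact: L2le_cint_mul (L2le_tensor La (L2le_conj Lb)) LK.
have iter (a b : T -> R[i]) A B : L2le mu A a -> L2le mu B b ->
    integralC (prodm mu mu) setT (fun w => a w.1 * conjc (b w.2) * K w) =
    integralC mu setT (fun v => conjc (b v) * integralC mu setT (fun u => a u * K (u, v))).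
  move=> La Lb; have iw := Li _ _ _ _ La Lb.
  rewrite -[LHS](intC21 iw); apply: intC_ae_eq.
  - exact: cmeas_int2 (cint_meas iw).
  - apply: cmeasM; first exact: cmeas_conj Lb.1.
    exact: measurable_int_kernel La.1 LK.1.
  - have [_ _ aeS] := L2le_sections LK; apply: (ae_imp aeS) => v Lv /=.
    rewrite -intCZ; last exact: L2le_cint_mul La Lv.
    by apply: eq_intC => u; ring.
pose g_ n x := f_ n x - f x.
have key n : integralC (prodm mu mu) setT (fun w => f_ n w.1 * conjc (f_ n w.2) * K w) -
      integralC (prodm mu mu) setT (fun w => f w.1 * conjc (f w.2) * K w) =
   integralC mu setT (fun v => conjc (f_ n v) * integralC mu setT (fun u => g_ n u * K (u, v))) +
   integralC mu setT (fun v => conjc (g_ n v) * integralC mu setT (fun u => f u * K (u, v))).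
  rewrite -(iter (g_ n) (f_ n) _ _ (Lg n) (Lfn n)) -(iter f (g_ n) _ _ Lf (Lg n)).
  rewrite -intCB; [|exact: (Li _ _ _ _ (Lfn n) (Lfn n))|exact: (Li _ _ _ _ Lf Lf)].
  rewrite -intCD; [|exact: Li (Lg n) (Lfn n)|exact: Li Lf (Lg n)].
  by apply: eq_intC => w; rewrite /g_ rmorphB; ring.
have [LB B0] := hilbert_schmidt_null Lg wg LK.
have LD : L2le mu (N * M) (fun v => integralC mu setT (fun u => f u * K (u, v))).
  exact: L2le_int_kernel Lf LK.
under eq_fun do rewrite key.
pose b n := (\int[mu]_v (nc (integralC mu setT (fun u => g_ n u * K (u, v))) ^+ 2)%:E)%E.
have bfin n : b n \is a fin_num.
  rewrite ge0_fin_numE; first exact: L2le_lty (LB n).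
  by apply: integral_ge0 => v _; rewrite lee_fin sqr_ge0.
apply: (@squeeze_cvgr _ _ _ _ (fun=> 0) (fun n => Num.sqrt (N * fine (b n)) +
   nc (integralC mu setT (fun v => conjc (g_ n v) * integralC mu setT (fun u => f u * K (u, v)))))).
- apply: nearW => n; apply/andP; split; first exact: nc_ge0.
  apply: le_trans (ncD _ _) _.
  rewrite lerD2r; apply: L2le_mul (L2le_conj (Lfn n)) _; apply: L2le_fine.
    exact: (LB n).1.
  exact: L2le_lty (LB n).
- exact: cvg_cst.
- rewrite -[X in _ --> X](addr0 (0 : R)); apply: cvgD.
    rewrite -[X in _ --> X](@sqrtr0 R); apply: continuous_cvg; first exact: sqrt_continuous.
    rewrite -[X in _ --> X](mulr0 N); apply: cvgM; first exact: cvg_cst.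
    exact: fine_cvg.
  exact: (weakly_null_conj Lg wg LD).
Qed.

End weak_null.

(** * Duality with test functions on phase space *)

Section pairing.
Context {R : realType} {d : nat}.
Local Notation E := (euclidean R d).
Local Notation lam := (leb R d).
Local Notation leb2 := (prodm lam lam).
Local Notation nu := (@unit_measure R).
Implicit Types (f : E -> R[i]) (G : E * E -> R[i]).

Lemma dotC (x y : E) : dot x y = dot y x.
Proof. by apply: eq_bigr => i _; rewrite mulrC. Qed.

(** Integrability is required of every fibre G (x, .), not only of almost every
    one, so that the partial Fourier transform is defined everywhere and no
    exceptional set appears in the iterated integrals. *)
Definition test_function (M : R) G : Prop :=
  [/\ cint leb2 G, forall x, cint lam (fun xi => G (x, xi)) & L2le leb2 M G].

Definition partial_ft G (z : E * E) : R[i] := ft (fun xi => G (z.1, xi)) z.2.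

Lemma cmeas_partial_ft G : cmeas G -> cmeas (partial_ft G).
Proof.
move=> mG.
apply: (@cmeas_int1 _ _ (E * E)%type E R lam
  (fun q => expi (- (2 * pi * dot q.1.2 q.2)) * G (q.1.1, q.2))).
apply: cmeasM.
  apply: cmeas_expi; apply: measurableT_comp => //; apply: measurable_funM => //.
  apply: measurable_dot => //.
  exact: (measurableT_comp measurable_snd measurable_fst).
apply: cmeas_comp mG; apply/measurable_fun_pairP; split => /=.
  exact: (measurableT_comp measurable_fst measurable_fst).
exact: measurable_snd.
Qed.

Lemma L2le_partial_ft M G : test_function M G -> L2le leb2 M (partial_ft G).
Proof.
move=> [iG sG [mG bG]]; have mV := cmeas_partial_ft mG; split=> //.
apply: le_trans bG.
have p2 (F : E * E -> R[i]) z : (0 <= (nc (F z) ^+ 2)%:E)%E by rewrite lee_fin sqr_ge0.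
have -> : (\int[leb2]_z (nc (partial_ft G z) ^+ 2)%:E =
    \int[lam \x lam]_z (nc (partial_ft G z) ^+ 2)%:E)%E by [].
have -> : (\int[leb2]_z (nc (G z) ^+ 2)%:E = \int[lam \x lam]_z (nc (G z) ^+ 2)%:E)%E by [].
rewrite (fubini_tonelli1 _ (measurable_nc2E mV) (p2 _)).
rewrite (fubini_tonelli1 _ (measurable_nc2E mG) (p2 _)).
apply: ge0_le_integral.
- exact: measurableT.
- by move=> x _; apply: integral_ge0 => y _; exact: p2.
- exact: (measurable_fun_fubini_tonelli_F _ (measurable_nc2E mV) (p2 _)).
- exact: (measurable_fun_fubini_tonelli_F _ (measurable_nc2E mG) (p2 _)).
- by move=> x _; exact: bessel (sG x).
Qed.

(** The multiplication formula, an instance of Fubini's theorem. *)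
Lemma ft_multiplication (F H : E -> R[i]) : cint lam F -> cint lam H ->
  integralC lam setT (fun xi => ft F xi * H xi) =
  integralC lam setT (fun y => F y * ft H y).
Proof.
move=> iF iH.
pose P (w : E * E) := expi (- (2 * pi * dot w.1 w.2)) * (H w.1 * F w.2).
have [iHF _] := intC_mul iH iF.
have iP : cint (lam \x lam)%E P.
  apply: (cint_bM (k := 1)) iHF; last by move=> w; rewrite nc_expi.
  apply: cmeas_expi; apply: measurableT_comp => //; apply: measurable_funM => //.
  exact: measurable_dot.
transitivity (integralC lam setT (fun xi => integralC lam setT (fun y => P (xi, y)))).
  apply: eq_intC => xi; rewrite mulrC -intCZ; last exact: cint_ft_kernel.
  by apply: eq_intC => y; rewrite /P/=; ring.
rewrite (intC_swap iP); apply: eq_intC => y; rewrite -intCZ; last exact: cint_ft_kernel.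
by apply: eq_intC => xi; rewrite /P/= dotC; ring.
Qed.

(** On each fibre the Fourier transform is moved to the test function, and the
    shear then separates the variables of the kernel. *)
Lemma wigner_pairing tau f N M G : tau != 0 -> tau != 1 -> L2le lam N f ->
  test_function M G ->
  cint leb2 (fun z => wigner tau f z * G z) /\
  integralC leb2 setT (fun z => wigner tau f z * G z) =
  integralC leb2 setT (fun w => f w.1 * conjc (f w.2) * partial_ft G (phase_shear tau w)).
Proof.
move=> t0 t1 Lf tG; have LV := L2le_partial_ft tG; have [iG sG LG] := tG.
have iWG := L2le_cint_mul (wigner_L2 t0 t1 Lf) LG.
have iFV := L2le_cint_mul (L2le_wigner_kernel tau Lf) LV.
split=> //.
transitivity (integralC leb2 setT (fun z => wigner_kernel tau f z * partial_ft G z)).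
  rewrite -[LHS](intC12 iWG) -[RHS](intC12 iFV); apply: eq_intC => x.
  under eq_intC do rewrite wignerE.
  exact: (ft_multiplication (cint_wigner_kernel x t0 t1 Lf).1 (sG x)).
have := intC_cov (phase_shear_preserves tau) iFV; rewrite mul1r => <-.
by apply: eq_intC => w; rewrite wigner_kernel_shear.
Qed.

Lemma wigner_pairing_bound tau f N M G : tau != 0 -> tau != 1 -> L2le lam N f ->
  test_function M G ->
  (\int[leb2]_z (nc (wigner tau f z * G z))%:E <= (Num.sqrt (N * N * M))%:E)%E.
Proof.
move=> t0 t1 Lf [_ _ LG]; have LW := wigner_L2 t0 t1 Lf.
under eq_integral do rewrite Normc.normcM.
apply: cauchy_schwarz_ge0 (LW.2) (LG.2).
- exact: measurable_nc LW.1.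
- exact: measurable_nc LG.1.
- by move=> z; exact: nc_ge0.
- by move=> z; exact: nc_ge0.
- exact: L2le_ge0 LW.
- exact: L2le_ge0 LG.
Qed.

Lemma ae_unit_neq : {ae nu, forall tau : R, tau != 0 /\ tau != 1}.
Proof.
apply: (ae_imp ae_unit_measure) => t /andP[t0 t1].
by rewrite gt_eqF// lt_eqF.
Qed.

Lemma integral_unit_bound (h : R -> \bar R) (C : R) : measurable_fun setT h ->
  (forall t, 0 <= h t)%E -> {ae nu, forall t, (h t <= C%:E)%E} ->
  (\int[nu]_t h t <= C%:E)%E.
Proof.
move=> mh h0 hC.
have C0 : (0 <= C%:E)%E.
  rewrite leNgt; apply/negP => C0.
  have : nu setT = 0%E.
    apply: (@measure_negligible _ _ _ nu setT) => //.
    case: hC => A [mA A0 sA]; exists A; split=> // t _; apply: sA => /= ht.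
    by have := le_lt_trans (le_trans (h0 t) ht) C0; rewrite ltxx.
  by move=> /eqP; rewrite [nu setT]unit_interval_measureT onee_eq0.
apply: (@le_trans _ _ (\int[nu]_t cst C%:E t)%E).
  by apply: ae_ge0_le_integral => //; apply: (ae_imp hC) => t ht _.
by rewrite integral_cst//= [X in (_ * X)%E]unit_interval_measureT mule1.
Qed.

Lemma born_jordan_pairing f N M G : L2le lam N f -> test_function M G ->
  integralC leb2 setT (fun z => born_jordan f z * G z) =
  integralC nu setT (fun tau => integralC leb2 setT (fun z => wigner tau f z * G z)).
Proof.
move=> Lf tG; have [mf _] := Lf; have [iG sG LG] := tG.
have mW := cmeas_wigner_joint mf.
have mWG : cmeas (fun p : R * (E * E) => wigner p.1 f p.2 * G p.2).
  by apply: cmeasM => //; apply: (cmeas_comp _ LG.1); exact: measurable_snd.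
have iWG : cint (nu \x leb2)%E (fun p : R * (E * E) => wigner p.1 f p.2 * G p.2).
  apply: (cint1P (m1 := nu) (m2 := leb2)) => //.
  apply: (@le_lt_trans _ _ (Num.sqrt (N * N * M))%:E); last by rewrite ltry.
  apply: integral_unit_bound.
  - exact: (measurable_int_nc1 leb2 mWG).
  - by move=> t; apply: integral_ge0 => z _; rewrite lee_fin nc_ge0.
  - by apply: (ae_imp ae_unit_neq) => t [t0 t1]; exact: wigner_pairing_bound.
rewrite (intC_swap (m1 := nu) (m2 := leb2) iWG); apply: intC_ae_eq.
- by apply: cmeasM LG.1; exact: cmeas_born_jordan.
- exact: (cmeas_int2 nu mWG).
- apply: (ae_imp (ae_cint2 (m1 := nu) (m2 := leb2) iWG)) => z iz /=.
  rewrite born_jordanE//; have [Gz|Gz] := eqVneq (G z) 0.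
    rewrite Gz mulr0 -[LHS](mul0r (integralC nu setT (fun=> 0))) -intCZ.
      by apply: eq_intC => t; rewrite !mulr0.
    split; first exact: cmeas_cst.
    by under eq_integral do rewrite nc0; rewrite integral0 ltry.
  have iWz : cint nu (fun tau => wigner tau f z).
    by apply: cint_eq (cintZ (G z)^-1 iz) => t; rewrite mulrC mulfK.
  by rewrite mulrC -intCZ//; apply: eq_intC => t; rewrite mulrC.
Qed.

End pairing.

(** * Averages of forms and their Gram kernels *)

Section average_form.
Context {disp} {X : measurableType disp} {R : realType}.
Variable mu : {sigma_finite_measure set X -> \bar R}.
Local Notation nu := (@unit_measure R).
Local Notation nu2 := (prodm nu nu).
Local Notation R1 := (measurableTypeR R).

Lemma L2le_cst1 : L2le nu 1 (fun=> 1 : R[i]).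
Proof.
split; first exact: cmeas_cst.
apply: integral_unit_bound => //; first by move=> t; rewrite lee_fin sqr_ge0.
by apply/nearW => t; rewrite Normc.normc1 expr1n.
Qed.

(** With K the average of the kernels H (tau, .), the left-hand side is at most
    A times the squared norm of K, and this squared norm is the double average
    of the inner products of H (tau, .) and H (sigma, .). *)
Lemma average_form_bound (A M : R) (F : X -> R[i]) (H : R1 * X -> R[i]) :
  L2le mu A F -> cmeas H -> (forall tau, L2le mu M (fun w => H (tau, w))) ->
  ((nc (integralC nu setT (fun tau => integralC mu setT (fun w => F w * H (tau, w))%R)) ^+ 2)%:E <=
  A%:E * \int[nu]_tau \int[nu]_sig
    (nc (integralC mu setT (fun w => H (tau, w) * conjc (H (sig, w)))))%:E)%E.
Proof.
move=> LF mH LH.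
have mH1 (g : (R1 * R1) * X -> R) : measurable_fun setT g -> cmeas (fun p => H (g p, p.2)).
  move=> mg; apply: (cmeas_comp _ mH); apply/measurable_fun_pairP; split => //=.
  exact: measurable_snd.
pose P (p : (R1 * R1) * X) := H (p.1.1, p.2) * conjc (H (p.1.2, p.2)).
have mP : cmeas P.
  apply: cmeasM; first by apply: mH1; exact: (measurableT_comp measurable_fst measurable_fst).
  by apply: cmeas_conj; apply: mH1; exact: (measurableT_comp measurable_snd measurable_fst).
have M0 : 0 <= M by exact: L2le_ge0 (LH 0).
have iPw tau sig : (\int[mu]_w (nc (P ((tau, sig), w)))%:E <= M%:E)%E.
  rewrite /P /=; under eq_integral do rewrite Normc.normcM nc_conj.
  apply: le_trans (cauchy_schwarz_ge0 _ _ _ _ M0 M0 (LH tau).2 (LH sig).2) _.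
  - exact: measurable_nc (LH tau).1.
  - exact: measurable_nc (LH sig).1.
  - by move=> w; exact: nc_ge0.
  - by move=> w; exact: nc_ge0.
  - by rewrite -expr2 sqrtr_sqr ger0_norm.
have iP : cint (nu2 \x mu)%E P.
  apply: (cint1P (m1 := nu2) (m2 := mu)) => //.
  apply: (@le_lt_trans _ _ M%:E); last by rewrite ltry.
  have mg := measurable_int_nc1 mu mP.
  have g0 (ts : R * R) : (0 <= \int[mu]_w (nc (P (ts, w)))%:E)%E.
    by apply: integral_ge0 => w _; rewrite lee_fin nc_ge0.
  have -> : (\int[nu2]_ts \int[mu]_w (nc (P (ts, w)))%:E =
     \int[nu]_tau \int[nu]_sig \int[mu]_w (nc (P ((tau, sig), w)))%:E)%E.
    exact: (@fubini_tonelli1 _ _ _ _ _ nu nu (fun ts => \int[mu]_w (nc (P (ts, w)))%:E)%E mg g0).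
  apply: integral_unit_bound.
  - exact: (@measurable_fun_fubini_tonelli_F _ _ _ _ _ nu (fun ts => \int[mu]_w (nc (P (ts, w)))%:E)%E mg g0).
  - by move=> tau; apply: integral_ge0 => sig _; exact: (g0 (tau, sig)).
  - apply/nearW => tau; apply: integral_unit_bound.
    + exact: (measurableT_comp mg (measurable_pair1 tau)).
    + by move=> sig; exact: (g0 (tau, sig)).
    + by apply/nearW => sig; exact: iPw.
pose K w := integralC nu setT (fun tau => H (tau, w)).
have mK : cmeas K by exact: (@cmeas_int2 _ _ (measurableTypeR R) X R nu H mH).
have aeH : {ae mu, forall w, cint nu (fun tau => H (tau, w))}.
  have mH2 := measurable_nc2E mH.
  have h0 (p : R1 * X) : (0 <= (nc (H p) ^+ 2)%:E)%E by rewrite lee_fin sqr_ge0.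
  have : {ae mu, forall w, (\int[nu]_tau (nc (H (tau, w)) ^+ 2)%:E < +oo)%E}.
    apply: ae_ltey.
    - exact: (@measurable_fun_fubini_tonelli_G _ _ _ _ _ nu (fun p => (nc (H p) ^+ 2)%:E) mH2 h0).
    - by move=> w; apply: integral_ge0 => tau _; exact: h0.
    - apply: (@le_lt_trans _ _ M%:E); last by rewrite ltry.
      have -> : (\int[mu]_w \int[nu]_tau (nc (H (tau, w)) ^+ 2)%:E =
         \int[nu]_tau \int[mu]_w (nc (H (tau, w)) ^+ 2)%:E)%E.
        rewrite -(@fubini_tonelli1 _ _ _ _ _ nu mu (fun p => (nc (H p) ^+ 2)%:E) mH2 h0).
        by rewrite (@fubini_tonelli2 _ _ _ _ _ nu mu (fun p => (nc (H p) ^+ 2)%:E) mH2 h0).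
      apply: integral_unit_bound.
      + exact: (@measurable_fun_fubini_tonelli_F _ _ _ _ _ mu (fun p => (nc (H p) ^+ 2)%:E) mH2 h0).
      + by move=> tau; apply: integral_ge0 => w _; exact: h0.
      + by apply/nearW => tau; exact: (LH tau).2.
  move=> ae1; apply: (ae_imp ae1) => w hw.
  have Lw := L2le_fine (cmeas_sec2 w mH) hw.
  by apply: cint_eq (L2le_cint_mul Lw L2le_cst1) => tau; rewrite mulr1.
have KK : {ae mu, forall w, K w * conjc (K w) = integralC nu2 setT (fun ts => P (ts, w))}.
  apply: (ae_imp aeH) => w iH.
  have [_] := intC_mul iH (cint_conj iH).
  by rewrite intC_conj.
have iP2 := @cint_int2 _ _ _ _ _ nu2 mu P iP.
have iK2 : (\int[mu]_w (nc (K w) ^+ 2)%:E < +oo)%E.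
  apply: le_lt_trans iP2.2; apply: ae_ge0_le_integral => //.
  - by move=> w _; rewrite lee_fin sqr_ge0.
  - exact: measurable_nc2E.
  - by move=> w _; rewrite lee_fin nc_ge0.
  - exact: measurable_ncE iP2.1.
  - by apply: (ae_imp KK) => w <- _; rewrite Normc.normcM nc_conj expr2.
have LK := L2le_fine mK iK2.
set B := fine _ in LK.
have BQ : (B%:E <= \int[nu]_tau \int[nu]_sig
    (nc (integralC mu setT (fun w => H (tau, w) * conjc (H (sig, w)))))%:E)%E.
  have EB : (B%:C)%C = integralC nu2 setT (fun ts => integralC mu setT (fun w => P (ts, w))).
    rewrite (intC_swap (m1 := nu2) (m2 := mu) iP).
    rewrite -[B]/(Rintegral mu setT (fun w => nc (K w) ^+ 2)) -intC_real.
    apply: intC_ae_eq.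
    - apply: (cmeas_eq (F := fun w => K w * conjc (K w))); first by move=> w; rewrite mul_conj.
      by apply: cmeasM => //; exact: cmeas_conj.
    - exact: iP2.1.
    - by apply: (ae_imp KK) => w <-; rewrite mul_conj.
  have mQ := cmeas_int1 mu mP.
  have := nc_intC_le nu2 mQ; rewrite -EB nc_real ger0_norm; last exact: L2le_ge0 LK.
  move=> /le_trans; apply; rewrite le_eqVlt; apply/orP; left; apply/eqP.
  apply: (@fubini_tonelli1 _ _ _ _ _ nu nu (fun ts => (nc (integralC mu setT (fun w => P (ts, w))))%:E)).
    exact: measurable_ncE mQ.
  by move=> ts; rewrite lee_fin nc_ge0.
have iFH : cint (nu \x mu)%E (fun p : R1 * X => F p.2 * H p).
  apply: (cint1P (m1 := nu) (m2 := mu)).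
    by apply: cmeasM => //; apply: (cmeas_comp _ LF.1); exact: measurable_snd.
  apply: (@le_lt_trans _ _ (Num.sqrt (A * M))%:E); last by rewrite ltry.
  apply: integral_unit_bound.
  - apply: (measurable_int_nc1 mu (F := fun p : R1 * X => F p.2 * H p)).
    by apply: cmeasM => //; apply: (cmeas_comp _ LF.1); exact: measurable_snd.
  - by move=> t; apply: integral_ge0 => w _; rewrite lee_fin nc_ge0.
  - apply/nearW => tau /=; under eq_integral do rewrite Normc.normcM.
    apply: cauchy_schwarz_ge0 (LF.2) ((LH tau).2).
    + exact: measurable_nc LF.1.
    + exact: measurable_nc (LH tau).1.
    + by move=> w; exact: nc_ge0.
    + by move=> w; exact: nc_ge0.
    + exact: L2le_ge0 LF.
    + exact: M0.
have -> : integralC nu setT (fun tau => integralC mu setT (fun w => F w * H (tau, w))) =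
    integralC mu setT (fun w => F w * K w).
  rewrite (intC_swap (m1 := nu) (m2 := mu) iFH); apply: intC_ae_eq.
  - exact: (cint_int2 (m1 := nu) (m2 := mu) iFH).1.
  - exact: cmeasM LF.1 mK.
  - by apply: (ae_imp aeH) => w iw; rewrite -intCZ.
have A0 := L2le_ge0 LF.
apply: (@le_trans _ _ (A * B)%:E).
  rewrite lee_fin -[leRHS]sqr_sqrtr; last by rewrite mulr_ge0//; exact: L2le_ge0 LK.
  by rewrite lerXn2r// ?nnegrE ?nc_ge0 ?sqrtr_ge0//; exact: L2le_mul LF LK.
by rewrite EFinM; apply: lee_wpmul2l.
Qed.
End average_form.

(** * The Gram kernel as an oscillatory form *)

Section twisted_form.
Context {R : realType} {d : nat}.
Local Notation E := (euclidean R d).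
Local Notation lam := (leb R d).
Local Notation leb2 := (prodm lam lam).

Lemma add_scaled_assoc (x y : E) (s t : R) :
  add_scaled (add_scaled x s y) t y = add_scaled x (s + t) y.
Proof. by apply: eq_from_tnth => i; rewrite !tnth_mktuple; ring. Qed.

Lemma translate_preserves (t : R) :
  scales_integral leb2 leb2 (fun z : E * E => (add_scaled z.1 t z.2, z.2)) 1.
Proof.
move=> f mf f0; rewrite mul1e.
have mg : measurable_fun setT (fun w : E * E => f (add_scaled w.1 t w.2, w.2)).
  apply: (measurableT_comp mf); apply/measurable_fun_pairP; split => /=.
    exact: measurable_add_scaled.
  exact: measurable_snd.
transitivity (\int[lam \x lam]_w f (add_scaled w.1 t w.2, w.2))%E => //.
rewrite (fubini_tonelli2 _ mg (fun w => f0 _)) /fubini_G/=.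
transitivity (\int[lam \x lam]_w f w)%E => //.
rewrite (fubini_tonelli2 f mf f0); apply: eq_integral => y _.
rewrite (@integral_translate _ _ y t (fun x => f (x, y)))//.
exact: (measurableT_comp mf (measurable_pair2 y)).
Qed.

(** The point y with b = x + t y. *)
Definition slope (t : R) (x b : E) : E :=
  add_scaled (scale_tuple (- t^-1) x) t^-1 b.

Lemma add_scaled_slope t x b : t != 0 -> add_scaled x t (slope t x b) = b.
Proof.
by move=> t0; apply: eq_from_tnth => i; rewrite !tnth_mktuple; field.
Qed.

Lemma measurable_slope d' (T : measurableType d') (t : R) (a c : T -> E) :
  measurable_fun setT a -> measurable_fun setT c ->
  measurable_fun setT (fun w => slope t (a w) (c w)).
Proof.
move=> ma mc; apply: measurable_add_scaled => //.
rewrite (_ : (fun w => scale_tuple (- t^-1) (a w)) =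
  fun w => add_scaled (add_scaled (a w) (-1) (a w)) (- t^-1) (a w)).
  by apply: measurable_add_scaled => //; exact: measurable_add_scaled.
by apply/funext => z; apply: eq_from_tnth => i; rewrite !tnth_mktuple; ring.
Qed.

Lemma slope_scales (t : R) : t != 0 ->
  scales_integral leb2 leb2 (fun z : E * E => (z.1, slope t z.1 z.2)) (`|t^-1| ^- d).
Proof.
move=> t0 f mf f0.
have mg : measurable_fun setT (fun z : E * E => f (z.1, slope t z.1 z.2)).
  apply: (measurableT_comp mf); apply/measurable_fun_pairP; split => /=.
    exact: measurable_fst.
  exact: measurable_slope.
transitivity (\int[lam \x lam]_z f (z.1, slope t z.1 z.2))%E => //.
rewrite (fubini_tonelli1 _ mg (fun w => f0 _)) /fubini_F/=.
transitivity ((`|t^-1| ^- d)%:E * (\int[lam \x lam]_w f w))%E => //.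
rewrite (fubini_tonelli1 f mf f0).
have mF := @measurable_fun_fubini_tonelli_F _ _ _ _ _ lam f mf f0.
have F0 x : (0 <= fubini_F lam f x)%E by apply: integral_ge0.
have k0 : (0 <= (`|t^-1| ^- d)%:E :> \bar R)%E by rewrite lee_fin invr_ge0 exprn_ge0.
rewrite -(ge0_integralZl lam measurableT mF (fun x _ => F0 x) k0).
apply: eq_integral => x _.
rewrite (@integral_add_scaled _ _ _ t^-1 (fun y => f (x, y)))// ?invr_neq0//.
exact: (measurableT_comp mf (measurable_pair1 x)).
Qed.

(** The phase exp (- 2 pi i y . (xi - eta)) with y the slope from x to b, for
    z' = (x, eta) and z = (b, xi). *)
Definition osc_kernel (t : R) (z' z : E * E) : R[i] :=
  expi (- (2 * pi * dot (slope t z'.1 z.1) z.2)) *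
  conjc (expi (- (2 * pi * dot (slope t z'.1 z.1) z'.2))).

Lemma nc_osc_kernel t z' z : nc (osc_kernel t z' z) = 1.
Proof. by rewrite Normc.normcM nc_conj !nc_expi mulr1. Qed.

Lemma cmeas_osc_kernel t : cmeas (fun w : (E * E) * (E * E) => osc_kernel t w.1 w.2).
Proof.
have mx : measurable_fun setT (fun w : (E * E) * (E * E) => slope t w.1.1 w.2.1).
  apply: measurable_slope; first exact: (measurableT_comp measurable_fst measurable_fst).
  exact: (measurableT_comp measurable_fst measurable_snd).
apply: cmeasM; last apply: cmeas_conj.
  apply: cmeas_expi; apply: measurableT_comp => //; apply: measurable_funM => //.
  apply: measurable_dot => //.
  exact: (measurableT_comp measurable_snd measurable_snd).
apply: cmeas_expi; apply: measurableT_comp => //; apply: measurable_funM => //.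
apply: measurable_dot => //.
exact: (measurableT_comp measurable_snd measurable_fst).
Qed.

Lemma cmeas_osc_kernel2 t z' : cmeas (osc_kernel t z').
Proof. exact: (cmeas_sec1 z' (cmeas_osc_kernel t)). Qed.

Lemma cint_osc_kernel t z' (G : E * E -> R[i]) : cint leb2 G ->
  cint leb2 (fun z => osc_kernel t z' z * G z).
Proof.
move=> iG; apply: (cint_bM (k := 1)) => //; first exact: cmeas_osc_kernel2.
by move=> z; rewrite nc_osc_kernel.
Qed.

Lemma osc_form_bound t z' (G : E * E -> R[i]) : cint leb2 G ->
  nc (integralC leb2 setT (fun z => osc_kernel t z' z * G z)) <=
  fine (\int[leb2]_z (nc (G z))%:E)%E.
Proof.
move=> iG; have i2 := cint_osc_kernel t z' iG.
have f0 : (0 <= \int[leb2]_z (nc (G z))%:E)%E.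
  by apply: integral_ge0 => z _; rewrite lee_fin nc_ge0.
rewrite -lee_fin fineK; last by rewrite ge0_fin_numE//; exact: iG.2.
apply: le_trans (nc_intC_le leb2 i2.1) _.
by under eq_integral do rewrite Normc.normcM nc_osc_kernel mul1r.
Qed.

Lemma cmeas_osc_form t (G : E * E -> R[i]) : cmeas G ->
  cmeas (fun z' => integralC leb2 setT (fun z => osc_kernel t z' z * G z)).
Proof.
move=> mG; apply: (@cmeas_int1 _ _ (E * E)%type (E * E)%type R leb2
  (fun w => osc_kernel t w.1 w.2 * G w.2)).
apply: cmeasM; first exact: cmeas_osc_kernel.
by apply: (cmeas_comp _ mG); exact: measurable_snd.
Qed.

(** For fixed x the substitution b = x + t y replaces the inner product of
    sections over the same y by an integral over all pairs (x, b); inserting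
    the definition of the partial Fourier transforms then exhibits the form of
    the unimodular kernel [osc_kernel]. *)
Lemma twisted_form (t M : R) (G : E * E -> R[i]) : t != 0 -> test_function M G ->
  ((`|t^-1| ^- d)%:C)%C * integralC leb2 setT (fun z =>
     partial_ft G (add_scaled z.1 t z.2, z.2) * conjc (partial_ft G z)) =
  integralC leb2 setT (fun z' => conjc (G z') *
     integralC leb2 setT (fun z => osc_kernel t z' z * G z)).
Proof.
move=> t0 tG; have [iG sG LG] := tG; have LV := L2le_partial_ft tG.
have mtr : measurable_fun setT (fun z : E * E => (add_scaled z.1 t z.2, z.2)).
  apply/measurable_fun_pairP; split => /=; last exact: measurable_snd.
  exact: measurable_add_scaled.
have LV' := L2le_cov mtr ler01 (translate_preserves t) LV.
have iF := L2le_cint_mul LV' (L2le_conj LV).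
have msl : measurable_fun setT (fun z : E * E => (z.1, slope t z.1 z.2)).
  apply/measurable_fun_pairP; split => /=; first exact: measurable_fst.
  exact: measurable_slope.
have c0 : 0 <= `|t^-1| ^- d by rewrite invr_ge0 exprn_ge0.
have iS := cint_cov msl c0 (slope_scales t0) iF.
rewrite -(intC_cov (slope_scales t0) iF).
have iR : cint leb2 (fun z' => conjc (G z') *
     integralC leb2 setT (fun z => osc_kernel t z' z * G z)).
  apply: (cint_eq (F := fun z' => integralC leb2 setT (fun z => osc_kernel t z' z * G z) * conjc (G z'))).
    by move=> z'; rewrite mulrC.
  apply: cint_bM (cint_conj iG).
    exact: cmeas_osc_form iG.1.
  by move=> z'; exact: osc_form_bound iG.
rewrite -(intC12 (m1 := lam) (m2 := lam) iS) -(intC12 (m1 := lam) (m2 := lam) iR).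
apply: eq_intC => x.
pose vx b := conjc (partial_ft G (x, slope t x b)).
have mvx : cmeas vx.
  apply: cmeas_conj; apply: (cmeas_comp _ LV.1); apply/measurable_fun_pairP; split => /=.
    exact: measurable_cst.
  by apply: (measurable_slope t).
pose I1 := fine (\int[lam]_xi (nc (G (x, xi)))%:E)%E.
have bvx b : nc (vx b) <= I1.
  have f0 : (0 <= \int[lam]_xi (nc (G (x, xi)))%:E)%E.
    by apply: integral_ge0 => z _; rewrite lee_fin nc_ge0.
  rewrite -lee_fin fineK; last by rewrite ge0_fin_numE//; exact: (sG x).2.
  rewrite nc_conj; apply: le_trans (nc_intC_le lam (cint_ft_kernel _ (sG x)).1) _.
  by under eq_integral do rewrite Normc.normcM nc_expi mul1r.
pose P1 z := (vx z.1 * expi (- (2 * pi * dot (slope t x z.1) z.2))) * G z.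
have iP1 : cint leb2 P1.
  apply: (cint_bM (k := I1)) iG.
    apply: cmeasM; first by apply: (cmeas_comp _ mvx); exact: measurable_fst.
    apply: cmeas_expi; apply: measurableT_comp => //; apply: measurable_funM => //.
    apply: measurable_dot; last exact: measurable_snd.
    by apply: measurable_slope => //; exact: measurable_fst.
  by move=> z; rewrite Normc.normcM nc_expi mulr1.
pose P2 (q : E * (E * E)) := osc_kernel t (x, q.1) q.2 * (conjc (G (x, q.1)) * G q.2).
have iP2 : cint (lam \x leb2)%E P2.
  apply: (cint_bM (k := 1)) (intC_mul (cint_conj (sG x)) iG).1; last first.
    by move=> q; rewrite nc_osc_kernel.
  apply: (cmeas_comp (phi := fun q : E * (E * E) => ((x, q.1), q.2)) _ (cmeas_osc_kernel t)).
  apply/measurable_fun_pairP; split => /=; last exact: measurable_snd.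
  exact: (measurableT_comp (measurable_pair1 x) measurable_fst).
transitivity (integralC leb2 setT P1).
  rewrite -(intC12 (m1 := lam) (m2 := lam) iP1); apply: eq_intC => b.
  transitivity (vx b * partial_ft G (b, slope t x b)).
    by rewrite [(_, _).1]/= [(_, _).2]/= add_scaled_slope// mulrC.
  rewrite /partial_ft /ft -intCZ; last exact: cint_ft_kernel.
  by apply: eq_intC => xi; rewrite /P1 mulrA.
transitivity (integralC leb2 setT (fun z => integralC lam setT (fun eta => P2 (eta, z)))).
  apply: eq_intC => z.
  have -> : P1 z = expi (- (2 * pi * dot (slope t x z.1) z.2)) * G z * vx z.1.
    by rewrite /P1; ring.
  have iv := cint_ft_kernel (slope t x z.1) (sG x).
  have -> : vx z.1 = integralC lam setT (fun eta =>
      conjc (expi (- (2 * pi * dot (slope t x z.1) eta)) * G (x, eta))).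
    by rewrite intC_conj.
  rewrite -intCZ; last exact: cint_conj.
  apply: eq_intC => eta; rewrite /P2 /osc_kernel rmorphM; cbn [fst snd]; ring.
rewrite -(intC_swap (m1 := lam) (m2 := leb2) iP2); apply: eq_intC => eta.
rewrite -intCZ; last exact: cint_osc_kernel.
by apply: eq_intC => z; rewrite /P2 /=; ring.
Qed.

End twisted_form.

(** * Cutting a function down to its integrable fibres *)

Section L2le_more.
Context {disp} {T : measurableType disp} {R : realType}.
Variable mu : {measure set T -> \bar R}.

Lemma L2leB N (F G : T -> R[i]) : L2le mu N F -> L2le mu N G ->
  L2le mu (4 * N) (fun x => F x - G x).
Proof.
move=> [mF bF] [mG bG]; have mFG := cmeasB mF mG; split=> //.
have m2 (H : T -> R[i]) : cmeas H -> measurable_fun setT (fun x => 2%:E * (nc (H x) ^+ 2)%:E)%E.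
  by move=> mH; apply: (emeasurable_funM (measurable_cst _)); exact: measurable_nc2E.
have p2 (H : T -> R[i]) x : (0 <= 2%:E * (nc (H x) ^+ 2)%:E)%E.
  by rewrite -EFinM lee_fin mulr_ge0// sqr_ge0.
apply: (@le_trans _ _ (\int[mu]_x (2%:E * (nc (F x) ^+ 2)%:E + 2%:E * (nc (G x) ^+ 2)%:E))%E).
  apply: ge0_le_integral.
  - exact: measurableT.
  - by move=> x _; rewrite lee_fin sqr_ge0.
  - exact: measurable_nc2E.
  - by apply: emeasurable_funD; exact: m2.
  - move=> x _; rewrite -!EFinM -EFinD lee_fin.
    have := ncD (F x) (- G x); rewrite ncN => h.
    apply: (@le_trans _ _ ((nc (F x) + nc (G x)) ^+ 2)).
      by rewrite lerXn2r// nnegrE ?nc_ge0// addr_ge0 ?nc_ge0.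
    rewrite -subr_ge0 (_ : _ - _ = (nc (F x) - nc (G x)) ^+ 2) ?sqr_ge0//; ring.
rewrite ge0_integralD; [|exact: measurableT|by move=> x _; exact: p2|exact: m2|by move=> x _; exact: p2|exact: m2].
have i2 (H : T -> R[i]) : cmeas H -> (\int[mu]_x (nc (H x) ^+ 2)%:E <= N%:E)%E ->
    (\int[mu]_x (2%:E * (nc (H x) ^+ 2)%:E) <= (2 * N)%:E)%E.
  move=> mH bH; rewrite ge0_integralZl.
  - by rewrite EFinM; apply: lee_wpmul2l.
  - exact: measurableT.
  - exact: measurable_nc2E.
  - by move=> x _; rewrite lee_fin sqr_ge0.
  - by rewrite lee_fin.
rewrite (_ : 4 * N = 2 * N + 2 * N); last by ring.
by rewrite [X in (_ <= X)%E]EFinD; apply: leeD; exact: i2.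
Qed.

Implicit Types A : set T.

Definition cindic (S : set T) (x : T) : R[i] := ((\1_S x : R)%:C)%C.

Lemma cmeas_cindic A : measurable A -> cmeas (cindic A : T -> R[i]).
Proof. by move=> mA; apply: cmeas_real; exact: measurable_indic. Qed.

Lemma nc_cindic A x : nc (cindic A x : R[i]) = \1_A x.
Proof. by rewrite nc_real ger0_norm// indicE ler0n. Qed.

Lemma nc_cindic_le A x : nc (cindic A x : R[i]) <= 1.
Proof. by rewrite nc_cindic indicE lern1 leq_b1. Qed.

Lemma L2le_cindic A (m : R) : measurable A -> mu A = m%:E -> L2le mu m (cindic A).
Proof.
move=> mA Am; split; first exact: cmeas_cindic.
rewrite -Am le_eqVlt; apply/orP; left; apply/eqP.
rewrite -[RHS]mul1e -integral_cst//.
rewrite [RHS]integral_mkcond; apply: eq_integral => x _.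
by rewrite nc_cindic patchE indicE; case: (x \in A); rewrite ?expr1n ?expr0n.
Qed.

Lemma L2le_bM N (F G : T -> R[i]) : cmeas G -> (forall x, nc (G x) <= 1) ->
  L2le mu N F -> L2le mu N (fun x => G x * F x).
Proof.
move=> mG bG [mF bF]; have mGF := cmeasM mG mF; split => //.
apply: le_trans bF; apply: ge0_le_integral.
- exact: measurableT.
- by move=> x _; rewrite lee_fin sqr_ge0.
- exact: measurable_nc2E.
- exact: measurable_nc2E.
- move=> x _; rewrite lee_fin lerXn2r// ?nnegrE ?nc_ge0// Normc.normcM.
  by rewrite ler_piMl ?nc_ge0.
Qed.

End L2le_more.

Section good_version.
Context {R : realType} {d : nat}.
Local Notation E := (euclidean R d).
Local Notation lam := (leb R d).
Local Notation leb2 := (prodm lam lam).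
Implicit Types (f : E -> R[i]) (G : E * E -> R[i]).

(** Almost every x satisfies this condition when G is integrable. *)
Definition good_fibre G : set E := [set x | \int[lam]_xi (nc (G (x, xi)))%:E < +oo]%E.

(** The function G with the exceptional fibres set to zero: a test function
    almost everywhere equal to G. *)
Definition good_version G (z : E * E) : R[i] := cindic (good_fibre G) z.1 * G z.

Lemma measurable_good_fibre G : cmeas G -> measurable (good_fibre G).
Proof.
move=> mG; rewrite -[X in measurable X]setTI.
by apply: emeasurable_fun_infty_o => //; exact: measurable_int_nc1.
Qed.

Lemma nc_good_version G z : nc (good_version G z) <= nc (G z).
Proof. by rewrite Normc.normcM ler_piMl ?nc_ge0// nc_cindic_le. Qed.

Lemma cmeas_good_cindic G : cmeas G -> cmeas (fun z : E * E => cindic (good_fibre G) z.1 : R[i]).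
Proof.
move=> mG; apply: (cmeas_comp _ (cmeas_cindic (measurable_good_fibre mG))).
exact: measurable_fst.
Qed.

Lemma cint_good_version G : cint leb2 G -> cint leb2 (good_version G).
Proof.
move=> iG; apply: (cint_bM (k := 1) _ _ iG); first exact: cmeas_good_cindic iG.1.
by move=> z; exact: nc_cindic_le.
Qed.

Lemma good_version_test M G : cint leb2 G -> L2le leb2 M G -> test_function M (good_version G).
Proof.
move=> iG LG; split; first exact: cint_good_version.
  move=> x; split; first exact: cmeas_sec1 x (cint_good_version iG).1.
  have [gx|gx] := pselect (good_fibre G x).
    apply: le_lt_trans gx; apply: ge0_le_integral.
    - exact: measurableT.
    - by move=> xi _; rewrite lee_fin nc_ge0.
    - exact: measurable_ncE (cmeas_sec1 x (cint_good_version iG).1).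
    - exact: measurable_ncE (cmeas_sec1 x iG.1).
    - by move=> xi _; rewrite lee_fin; exact: nc_good_version.
  under eq_integral => xi _.
    rewrite /good_version /cindic indicE memNset// mul0r nc0.
    over.
  by rewrite integral0 ltry.
apply: L2le_bM LG; first exact: cmeas_good_cindic iG.1.
by move=> z; exact: nc_cindic_le.
Qed.

Lemma intC_good_version G (a : E * E -> R[i]) : cint leb2 G -> cmeas a ->
  cint leb2 (fun z => a z * G z) ->
  integralC leb2 setT (fun z => a z * good_version G z) =
  integralC leb2 setT (fun z => a z * G z).
Proof.
move=> iG ma iaG.
have iag : cint leb2 (fun z => a z * good_version G z).
  apply: (cint_eq (F := fun z => cindic (good_fibre G) z.1 * (a z * G z))).
    by move=> z; rewrite /good_version; ring.
  apply: (cint_bM (k := 1)) iaG; first exact: cmeas_good_cindic iG.1.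
  by move=> z; exact: nc_cindic_le.
rewrite -[LHS](intC12 (m1 := lam) (m2 := lam) iag) -[RHS](intC12 (m1 := lam) (m2 := lam) iaG).
apply: intC_ae_eq; [exact: cmeas_int1 iag.1|exact: cmeas_int1 iaG.1|].
apply: (ae_imp (ae_cint1 (m1 := lam) (m2 := lam) iG)) => x ix.
apply: eq_intC => xi; rewrite /good_version /cindic indicE mem_set ?mul1r//.
exact: ix.2.
Qed.

End good_version.

(** * From weak to strong convergence on sets of finite measure *)

Section born_jordan_L2.
Context {R : realType} {d : nat}.
Local Notation E := (euclidean R d).
Local Notation lam := (leb R d).
Local Notation leb2 := (prodm lam lam).
Local Notation nu := (@unit_measure R).

Lemma born_jordan_L2 (f : E -> R[i]) N : L2le lam N f ->
  L2le leb2 (4 * N ^+ 2) (born_jordan f).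
Proof.
move=> Lf; split; first exact: cmeas_born_jordan Lf.1.
have := born_jordan_Lq (q := 2) (lexx 2) _ Lf.
rewrite subrr mul0r mulr0 => /(_ ltr01).
rewrite /weight_bound powRr0 mul1r subr0 invr1 !powR_mulrn ?(L2le_ge0 Lf)//.
rewrite (_ : (1 + 1 : R) ^+ 2 = 4); last by ring.
move=> h; apply: le_trans h; rewrite le_eqVlt; apply/orP; left; apply/eqP.
by apply: eq_integral => z _; rewrite powR_mulrn// nc_ge0.
Qed.

End born_jordan_L2.

Section weak_limit.
Context {R : realType} {d : nat}.
Local Notation E := (euclidean R d).
Local Notation lam := (leb R d).
Local Notation leb2 := (prodm lam lam).
Local Notation nu := (@unit_measure R).
Variables (N : R) (f_ : nat -> E -> R[i]) (f : E -> R[i]).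
Hypothesis Lfn : forall n, L2le lam N (f_ n).
Hypothesis Lf : L2le lam N f.
Hypothesis wf : weakly_null lam (fun n x => f_ n x - f x).

(** For fixed tau the pairing is a Hilbert-Schmidt form in f. *)
Lemma wigner_pairing_cvg tau M G : tau != 0 -> tau != 1 -> test_function M G ->
  nc (integralC leb2 setT (fun z => wigner tau (f_ n) z * G z) -
      integralC leb2 setT (fun z => wigner tau f z * G z)) @[n --> \oo] --> (0 : R).
Proof.
move=> t0 t1 tG.
under eq_fun do rewrite (wigner_pairing t0 t1 (Lfn _) tG).2 (wigner_pairing t0 t1 Lf tG).2.
have LK := L2le_cov (measurable_phase_shear tau) ler01 (phase_shear_preserves tau) (L2le_partial_ft tG).
exact: hs_form_cvg Lfn Lf (fun n => L2leB (Lfn n) Lf) wf LK.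
Qed.

Lemma cmeas_wigner_pairing (g : E -> R[i]) G : cmeas g -> cmeas G ->
  cmeas (fun tau : measurableTypeR R => integralC leb2 setT (fun z => wigner tau g z * G z)).
Proof.
move=> mg mG; apply: (@cmeas_int1 _ _ (measurableTypeR R) (E * E)%type R leb2
  (fun p => wigner p.1 g p.2 * G p.2)).
apply: cmeasM; first exact: cmeas_wigner_joint.
by apply: (cmeas_comp _ mG); exact: measurable_snd.
Qed.

Lemma cint_wigner_pairing (g : E -> R[i]) M G : L2le lam N g -> test_function M G ->
  cint nu (fun tau => integralC leb2 setT (fun z => wigner tau g z * G z)).
Proof.
move=> Lg tG; have [iG _ LG] := tG; have mP := cmeas_wigner_pairing Lg.1 iG.1.
split=> //; apply: (@le_lt_trans _ _ (Num.sqrt (N * N * M))%:E); last by rewrite ltry.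
apply: integral_unit_bound; first exact: measurable_ncE.
  by move=> t; rewrite lee_fin nc_ge0.
apply: (ae_imp ae_unit_neq) => t [t0 t1]; rewrite lee_fin.
exact: L2le_mul (wigner_L2 t0 t1 Lg) LG.
Qed.

(** Dominated convergence in tau, starting from the convergence for each tau.
    *)
Lemma test_pairing_cvg M G : test_function M G ->
  nc (integralC leb2 setT (fun z => born_jordan (f_ n) z * G z) -
      integralC leb2 setT (fun z => born_jordan f z * G z)) @[n --> \oo] --> (0 : R).
Proof.
move=> tG; have [iG _ LG] := tG; have M0 := L2le_ge0 LG.
pose D n tau := integralC leb2 setT (fun z => wigner tau (f_ n) z * G z) -
      integralC leb2 setT (fun z => wigner tau f z * G z).
have iD n : cint nu (D n).
  exact: cintB (cint_wigner_pairing (Lfn n) tG) (cint_wigner_pairing Lf tG).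
have D0 : (\int[nu]_tau (nc (D n tau))%:E)%E @[n --> \oo] --> 0%E.
  apply: (@dominated_cvg0 _ _ _ nu (fun n tau => (nc (D n tau))%:E)
     (cst ((Num.sqrt (N * N * M) + Num.sqrt (N * N * M)))%:E)).
  - by move=> n; exact: measurable_ncE (iD n).1.
  - by move=> n tau; rewrite lee_fin nc_ge0.
  - apply: (ae_imp ae_unit_neq) => t [t0 t1] n; rewrite lee_fin.
    apply: le_trans (ncD _ _) _; rewrite ncN; apply: lerD.
      exact: L2le_mul (wigner_L2 t0 t1 (Lfn n)) LG.
    exact: L2le_mul (wigner_L2 t0 t1 Lf) LG.
  - exact: measurable_cst.
  - by rewrite integral_cst// [X in (_ * X)%E]unit_interval_measureT mule1 ltry.
  - by move=> t; rewrite lee_fin addr_ge0// sqrtr_ge0.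
  - apply: (ae_imp ae_unit_neq) => t [t0 t1].
    apply: cvg_EFin; first by apply: nearW => n.
    exact: wigner_pairing_cvg t0 t1 tG.
have fin n : (\int[nu]_tau (nc (D n tau))%:E)%E \is a fin_num.
  rewrite ge0_fin_numE; first exact: (iD n).2.
  by apply: integral_ge0 => t _; rewrite lee_fin nc_ge0.
apply: (@squeeze_cvgr _ _ _ _ (fun=> 0) (fun n => fine (\int[nu]_tau (nc (D n tau))%:E)%E)).
- apply: nearW => n; apply/andP; split; first exact: nc_ge0.
  rewrite -lee_fin fineK//.
  have -> : integralC leb2 setT (fun z => born_jordan (f_ n) z * G z) -
      integralC leb2 setT (fun z => born_jordan f z * G z) = integralC nu setT (D n).
    rewrite intCB; [|exact: cint_wigner_pairing tG|exact: cint_wigner_pairing tG].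
    by congr (_ - _); [exact: born_jordan_pairing (Lfn n) tG|exact: born_jordan_pairing Lf tG].
  exact: nc_intC_le (iD n).1.
- exact: cvg_cst.
- exact: fine_cvg.
Qed.

Lemma born_jordan_pairing_cvg M G : cint leb2 G -> L2le leb2 M G ->
  nc (integralC leb2 setT (fun z => born_jordan (f_ n) z * G z) -
      integralC leb2 setT (fun z => born_jordan f z * G z)) @[n --> \oo] --> (0 : R).
Proof.
move=> iG LG; have := test_pairing_cvg (good_version_test iG LG).
have goodE g : L2le lam N g -> integralC leb2 setT (fun z => born_jordan g z * good_version G z) =
    integralC leb2 setT (fun z => born_jordan g z * G z).
  move=> Lg; have Lb := born_jordan_L2 Lg.
  by apply: intC_good_version => //; [exact: Lb.1|exact: L2le_cint_mul Lb LG].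
by apply: cvg_trans; apply: near_eq_cvg; apply: nearW => n; congr nc; congr (_ - _); exact: goodE.
Qed.

End weak_limit.

Lemma conjM (R : realType) (z w : R[i]) : conjc (z * w) = conjc z * conjc w.
Proof. exact: rmorphM. Qed.

Lemma cindic01 (R : realType) d (T : measurableType d) (A : set T) (x : T) :
  cindic A x = 1 :> R[i] \/ cindic A x = 0 :> R[i].
Proof. by rewrite /cindic indicE; case: (x \in A); [left|right]. Qed.

Section strong_limit.
Context {R : realType} {d : nat}.
Local Notation E := (euclidean R d).
Local Notation lam := (leb R d).
Local Notation leb2 := (prodm lam lam).
Local Notation nu := (@unit_measure R).
Variables (N m : R) (f_ : nat -> E -> R[i]) (f : E -> R[i]) (A : set (E * E)).
Hypothesis Lfn : forall n, L2le lam N (f_ n).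
Hypothesis Lf : L2le lam N f.
Hypothesis wf : weakly_null lam (fun n x => f_ n x - f x).
Hypothesis mA : measurable A.
Hypothesis Am : leb2 A = m%:E.

Lemma A_lty : (leb2 A < +oo)%E. Proof. by rewrite Am ltry. Qed.

Definition bj_diff n (z : E * E) : R[i] := born_jordan (f_ n) z - born_jordan f z.

Local Notation W := (4 * (4 * N ^+ 2)).

Lemma bj_diff_L2 n : L2le leb2 W (bj_diff n).
Proof. exact: L2leB (born_jordan_L2 (Lfn n)) (born_jordan_L2 Lf). Qed.

(** Pairing the difference of the two Born-Jordan distributions with this
    function gives its squared norm on A. *)
Definition dual_test n : E * E -> R[i] := fun z => cindic A z * conjc (bj_diff n z).

Lemma dual_test_L2 n : L2le leb2 W (dual_test n).
Proof.
apply: L2le_bM (L2le_conj (bj_diff_L2 n)); first exact: cmeas_cindic.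
exact: nc_cindic_le.
Qed.

Lemma dual_test_cint n : cint leb2 (dual_test n).
Proof. exact: L2le_cint_mul (L2le_cindic mA Am) (L2le_conj (bj_diff_L2 n)). Qed.

Local Notation G n := (good_version (dual_test n)).

Lemma dual_good n : test_function W (G n).
Proof. exact: good_version_test (dual_test_cint n) (dual_test_L2 n). Qed.

Lemma m_ge0 : 0 <= m. Proof. by rewrite -lee_fin -Am measure_ge0. Qed.

Lemma W_ge0 : 0 <= W. Proof. exact: L2le_ge0 (bj_diff_L2 0). Qed.

Lemma dual_good_L1 n : (\int[leb2]_z (nc (G n z))%:E <= (Num.sqrt (m * W))%:E)%E.
Proof.
have mT := cmeas_cindic (R := R) mA.
apply: (@le_trans _ _ (\int[leb2]_z (nc (cindic A z : R[i]) * nc (conjc (bj_diff n z)))%:E)%E).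
  apply: ge0_le_integral.
  - exact: measurableT.
  - by move=> z _; rewrite lee_fin nc_ge0.
  - exact: measurable_ncE (cint_good_version (dual_test_cint n)).1.
  - under eq_fun do rewrite -Normc.normcM.
    exact: measurable_ncE (dual_test_cint n).1.
  - by move=> z _; rewrite lee_fin -Normc.normcM; exact: nc_good_version.
apply: cauchy_schwarz_ge0 (L2le_cindic mA Am).2 (L2le_conj (bj_diff_L2 n)).2.
- exact: measurable_nc.
- exact: measurable_nc (L2le_conj (bj_diff_L2 n)).1.
- by move=> z; exact: nc_ge0.
- by move=> z; exact: nc_ge0.
- exact: m_ge0.
- exact: W_ge0.
Qed.

Definition osc_test n t z' : R[i] :=
  integralC leb2 setT (fun z => osc_kernel t z' z * G n z).

Lemma osc_test_bound n t z' : nc (osc_test n t z') <= Num.sqrt (m * W).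
Proof.
apply: le_trans (osc_form_bound t z' (cint_good_version (dual_test_cint n))) _.
have h := dual_good_L1 n; rewrite -lee_fin fineK// ge0_fin_numE.
  by apply: le_lt_trans h _; rewrite ltry.
by apply: integral_ge0 => z _; rewrite lee_fin nc_ge0.
Qed.

(** Up to conjugation this is the pairing of the difference with the fixed
    bounded test function conj (osc_kernel t z') 1_A. *)
Lemma osc_test_cvg t z' : nc (osc_test n t z') @[n --> \oo] --> (0 : R).
Proof.
(* the fixed test function against which the difference is paired *)
pose h z := conjc (osc_kernel t z' z) * cindic A z.
have mh : cmeas (fun z => conjc (osc_kernel t z' z)).
  by apply: cmeas_conj; exact: cmeas_osc_kernel2.
have bh z : nc (conjc (osc_kernel t z' z)) <= 1 by rewrite nc_conj nc_osc_kernel.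
have Lh : L2le leb2 m h by apply: L2le_bM => //; exact: L2le_cindic.
have ih : cint leb2 h.
  apply: (cint_bM (k := 1)) => //; split; first exact: cmeas_cindic.
  under eq_integral do rewrite nc_cindic.
  by rewrite integral_indic// setIT; exact: A_lty.
have := born_jordan_pairing_cvg Lfn Lf wf ih Lh.
apply: cvg_trans; apply: near_eq_cvg; apply: nearW => n.
have iw := L2le_cint_mul (bj_diff_L2 n) Lh.
rewrite -intCB; [|exact: L2le_cint_mul (born_jordan_L2 (Lfn n)) Lh
                 |exact: L2le_cint_mul (born_jordan_L2 Lf) Lh].
have -> : osc_test n t z' = conjc (integralC leb2 setT (fun z => bj_diff n z * h z)).
  have ig := dual_test_cint n.
  rewrite /osc_test intC_good_version; last 3 first.
  - exact: ig.
  - exact: cmeas_osc_kernel2.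
  - exact: cint_osc_kernel ig.
  rewrite -intC_conj//; apply: eq_intC => z; rewrite /dual_test /h conjM (conjM (conjc (osc_kernel t z' z))) conjcK.
  have -> : conjc (cindic A z : R[i]) = cindic A z.
    by apply: complex_eqP; rewrite ?Re_conj ?Im_conj /= ?oppr0.
  ring.
by rewrite nc_conj; congr nc; apply: eq_intC => z; rewrite mulrBl.
Qed.

(** The factor G n is only bounded in L^2, but it vanishes off A; the other
    factor tends to zero in L^2 of A, by dominated convergence with a constant
    bound. *)
Lemma twisted_cvg t : nc (integralC leb2 setT (fun z' => conjc (G n z') * osc_test n t z'))
  @[n --> \oo] --> (0 : R).
Proof.
pose C := Num.sqrt (m * W).
have mo n : cmeas (fun z => cindic A z * osc_test n t z).
  apply: cmeasM; first exact: cmeas_cindic.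
  exact: cmeas_osc_form (cint_good_version (dual_test_cint n)).1.
pose b n := (\int[leb2]_z (nc (cindic A z * osc_test n t z) ^+ 2)%:E)%E.
have mC : measurable_fun setT (fun z : E * E => (C ^+ 2 * \1_A z)%:E).
  by apply/measurable_EFinP; apply: measurable_funM => //; exact: measurable_indic.
have C0 z : (0 <= (C ^+ 2 * \1_A z)%:E)%E by rewrite lee_fin mulr_ge0// sqr_ge0.
have iC : (\int[leb2]_z (C ^+ 2 * \1_A z)%:E < +oo)%E.
  under eq_integral do rewrite EFinM.
  rewrite ge0_integralZl//; last by rewrite lee_fin sqr_ge0.
    rewrite integral_indic// setIT; apply: lte_mul_pinfty => //; last exact: A_lty.
    by rewrite lee_fin sqr_ge0.
  by apply/measurable_EFinP; exact: measurable_indic.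
have ncb n z : (0 <= (nc (cindic A z * osc_test n t z) ^+ 2)%:E)%E by rewrite lee_fin sqr_ge0.
have bb n z : ((nc (cindic A z * osc_test n t z) ^+ 2)%:E <= (C ^+ 2 * \1_A z)%:E)%E.
  rewrite lee_fin Normc.normcM nc_cindic exprMn indicE.
  case: (z \in A); last by rewrite expr0n mul0r mulr0.
  rewrite expr1n mul1r mulr1 lerXn2r// ?nnegrE ?nc_ge0 ?sqrtr_ge0//.
  exact: osc_test_bound.
have b0 : b n @[n --> \oo] --> 0%E.
  apply: (@dominated_cvg0 _ _ _ leb2 (fun n z => (nc (cindic A z * osc_test n t z) ^+ 2)%:E)
     (fun z => (C ^+ 2 * \1_A z)%:E)) => //.
  - by move=> n; exact: measurable_nc2E.
  - by apply/nearW => z n.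
  - apply/nearW => z; apply: cvg_EFin; first by apply: nearW => n.
    rewrite -[X in _ --> X](mulr0 (0 : R)); under eq_fun do rewrite /= expr2.
    have H : nc (cindic A z * osc_test n t z) @[n --> \oo] --> (0 : R).
      rewrite -[X in _ --> X](mulr0 (nc (cindic A z : R[i]))).
      under eq_fun do rewrite Normc.normcM.
      by apply: cvgM; [exact: cvg_cst|exact: osc_test_cvg].
    by apply: cvgM; exact: H.
have Lb n : L2le leb2 (fine (b n)) (fun z => cindic A z * osc_test n t z).
  apply: L2le_fine => //; apply: le_lt_trans iC; apply: ge0_le_integral => //.
  exact: measurable_nc2E.
have bfin n : b n \is a fin_num.
  by rewrite ge0_fin_numE; [exact: L2le_lty (Lb n)|exact: integral_ge0].
apply: (@squeeze_cvgr _ _ _ _ (fun=> 0) (fun n => Num.sqrt (W * fine (b n)))).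
- apply: nearW => n; apply/andP; split; first exact: nc_ge0.
  have [_ _ LG] := dual_good n.
  have -> : integralC leb2 setT (fun z' => conjc (G n z') * osc_test n t z') =
     integralC leb2 setT (fun z' => conjc (G n z') * (cindic A z' * osc_test n t z')).
    apply: eq_intC => z; rewrite /good_version /dual_test.
    have [->|->] := cindic01 R A z; first by rewrite !mul1r.
    by rewrite !(mul0r, mulr0, rmorph0).
  exact: L2le_mul (L2le_conj LG) (Lb n).
- exact: cvg_cst.
- rewrite -[X in _ --> X](@sqrtr0 R); apply: continuous_cvg; first exact: sqrt_continuous.
  rewrite -[X in _ --> X](mulr0 W); apply: cvgM; first exact: cvg_cst.
  exact: fine_cvg.
Qed.

End strong_limit.

Section gram.
Context {R : realType} {d : nat}.
Local Notation E := (euclidean R d).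
Local Notation lam := (leb R d).
Local Notation leb2 := (prodm lam lam).
Local Notation nu := (@unit_measure R).
Implicit Types G : E * E -> R[i].

Definition sheared_ft G (p : measurableTypeR R * (E * E)) : R[i] :=
  partial_ft G (phase_shear p.1 p.2).

Lemma cmeas_sheared_ft G : cmeas G -> cmeas (sheared_ft G).
Proof.
move=> mG; apply: (cmeas_comp (phi := fun p : measurableTypeR R * (E * E) => phase_shear p.1 p.2) _
  (cmeas_partial_ft mG)).
have m1 : measurable_fun setT (fun p : measurableTypeR R * (E * E) => p.2.1).
  exact: (measurableT_comp measurable_fst measurable_snd).
have m2 : measurable_fun setT (fun p : measurableTypeR R * (E * E) => p.2.2).
  exact: (measurableT_comp measurable_snd measurable_snd).
have m3 : measurable_fun setT (fun p : measurableTypeR R * (E * E) => add_scaled p.2.1 (- 1) p.2.2).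
  exact: measurable_add_scaled.
apply/measurable_fun_pairP; split => //.
by apply: measurable_add_scaled => //; apply: measurableT_comp => //; exact: measurable_fst.
Qed.

Lemma L2le_sheared_ft M G tau : test_function M G -> L2le leb2 M (fun w => sheared_ft G (tau, w)).
Proof.
move=> tG; have := L2le_cov (measurable_phase_shear tau) ler01 (phase_shear_preserves tau) (L2le_partial_ft tG).
by rewrite mul1r.
Qed.

Definition gram G (tau sigma : R) : R[i] := integralC leb2 setT
  (fun w => sheared_ft G (tau, w) * conjc (sheared_ft G (sigma, w))).

Lemma cmeas_gram G : cmeas G ->
  cmeas (fun p : measurableTypeR R * measurableTypeR R => gram G p.1 p.2).
Proof.
move=> mG; have mK := cmeas_sheared_ft mG.
apply: (@cmeas_int1 _ _ (measurableTypeR R * measurableTypeR R)%type (E * E)%type R leb2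
  (fun q => sheared_ft G (q.1.1, q.2) * conjc (sheared_ft G (q.1.2, q.2)))).
pose R1 := measurableTypeR R.
apply: cmeasM.
  apply: (cmeas_comp (phi := fun q : (R1 * R1) * (E * E) => (q.1.1, q.2)) _ mK).
  apply/measurable_fun_pairP; split; last exact: measurable_snd.
  exact: (measurableT_comp measurable_fst measurable_fst).
apply: cmeas_conj.
apply: (cmeas_comp (phi := fun q : (R1 * R1) * (E * E) => (q.1.2, q.2)) _ mK).
apply/measurable_fun_pairP; split; last exact: measurable_snd.
exact: (measurableT_comp measurable_snd measurable_fst).
Qed.

Lemma gram_bound M G tau sigma : test_function M G -> nc (gram G tau sigma) <= M.
Proof.
move=> tG; have L1 := L2le_sheared_ft tau tG; have L2 := L2le_sheared_ft sigma tG.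
apply: le_trans (L2le_mul L1 (L2le_conj L2)) _.
by rewrite -expr2 sqrtr_sqr ger0_norm//; exact: L2le_ge0 L1.
Qed.

(** In the coordinates of the shear with parameter sigma, the shear with
    parameter tau is a translation by sigma - tau times y. *)
Lemma gram_twisted M G tau sigma : test_function M G ->
  gram G tau sigma = integralC leb2 setT (fun z =>
     partial_ft G (add_scaled z.1 (sigma - tau) z.2, z.2) * conjc (partial_ft G z)).
Proof.
move=> tG; have LV := L2le_partial_ft tG.
have mtr : measurable_fun setT (fun z : E * E => (add_scaled z.1 (sigma - tau) z.2, z.2)).
  apply/measurable_fun_pairP; split => /=; last exact: measurable_snd.
  exact: measurable_add_scaled.
have LV' := L2le_cov mtr ler01 (translate_preserves (sigma - tau)) LV.
have := intC_cov (phase_shear_preserves sigma) (L2le_cint_mul LV' (L2le_conj LV)).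
rewrite mul1r => <-; apply: eq_intC => w; rewrite /sheared_ft /phase_shear; cbn [fst snd].
by rewrite add_scaled_assoc (_ : - sigma + (sigma - tau) = - tau)//; ring.
Qed.

(** The norm of f (x) conj f factors out, and the averaged kernel is measured
    by its Gram kernel. *)
Lemma pairing_gram_bound (f : E -> R[i]) N M G : L2le lam N f -> test_function M G ->
  ((nc (integralC leb2 setT (fun z => born_jordan f z * G z)) ^+ 2)%:E <=
  (N * N)%:E * \int[nu]_tau \int[nu]_sigma (nc (gram G tau sigma))%:E)%E.
Proof.
move=> Lf tG; have [iG _ LG] := tG.
have := average_form_bound (L2le_tensor Lf (L2le_conj Lf)) (cmeas_sheared_ft iG.1)
  (fun tau => L2le_sheared_ft tau tG).
apply: le_trans; rewrite (born_jordan_pairing Lf tG) le_eqVlt; apply/orP; left; apply/eqP.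
apply: (congr1 (fun w : R[i] => (nc w ^+ 2)%:E)); apply: intC_ae_eq.
- apply: (@cmeas_int1 _ _ (measurableTypeR R) (E * E)%type R leb2
    (fun p => wigner p.1 f p.2 * G p.2)).
  apply: cmeasM; first exact: cmeas_wigner_joint Lf.1.
  by apply: (cmeas_comp _ iG.1); exact: measurable_snd.
- apply: (@cmeas_int1 _ _ (measurableTypeR R) (E * E)%type R leb2
    (fun p => f p.2.1 * conjc (f p.2.2) * sheared_ft G p)).
  apply: cmeasM; last exact: cmeas_sheared_ft iG.1.
  have mt := (L2le_tensor Lf (L2le_conj Lf)).1.
  by apply: (cmeas_comp _ mt); exact: measurable_snd.
- by apply: (ae_imp ae_unit_neq) => tau [t0 t1]; exact: (wigner_pairing t0 t1 Lf tG).2.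
Qed.

End gram.

Lemma ae_unit_neqx (R : realType) (x : R) : {ae @unit_measure R, forall y : R, x != y}.
Proof.
exists [set x]; split; first exact: measurable_set1.
  apply/eqP; rewrite eq_le measure_ge0 andbT.
  rewrite -(@lebesgue_measure_set1 R x).
  exact: (measureIl (@lebesgue_measure R) (measurable_set1 x) (measurable_itv `]0%R, 1%R[)).
by move=> y /= /negP; rewrite negbK => /eqP.
Qed.

Section strong_limit.
Context {R : realType} {d : nat}.
Local Notation E := (euclidean R d).
Local Notation lam := (leb R d).
Local Notation leb2 := (prodm lam lam).
Local Notation nu := (@unit_measure R).
Variables (N m : R) (f_ : nat -> E -> R[i]) (f : E -> R[i]) (A : set (E * E)).
Hypothesis Lfn : forall n, L2le lam N (f_ n).
Hypothesis Lf : L2le lam N f.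
Hypothesis wf : weakly_null lam (fun n x => f_ n x - f x).
Hypothesis mA : measurable A.
Hypothesis Am : leb2 A = m%:E.
Local Notation W := (4 * (4 * N ^+ 2)).
Local Notation G n := (good_version (dual_test f_ f A n)).

Let tG n : test_function W (G n).
Proof. exact: dual_good Am n. Qed.

Lemma gram_cvg tau sigma : tau != sigma ->
  nc (gram (G n) tau sigma) @[n --> \oo] --> (0 : R).
Proof.
move=> ts; have t0 : sigma - tau != 0 by rewrite subr_eq0 eq_sym.
pose c := `|(sigma - tau)^-1| ^- d : R.
have c0 : 0 < c by rewrite invr_gt0 exprn_gt0// normr_gt0 invr_neq0.
rewrite -[X in _ --> X](mulr0 c^-1).
have E1 n : nc (gram (G n) tau sigma) = c^-1 * nc (integralC leb2 setT
    (fun z' => conjc (G n z') * osc_test f_ f A n (sigma - tau) z')).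
  rewrite (gram_twisted _ _ (tG n)) /osc_test -(twisted_form t0 (tG n)) Normc.normcM nc_real.
  by rewrite (ger0_norm (ltW c0)) mulrA mulVf ?mul1r// gt_eqF.
under eq_fun do rewrite E1.
apply: cvgM; first exact: cvg_cst.
exact: twisted_cvg Lfn Lf wf mA Am _.
Qed.

Local Notation S n := (\int[nu]_tau \int[nu]_sigma (nc (gram (G n) tau sigma))%:E)%E.

Let mgram n : cmeas (fun p : measurableTypeR R * measurableTypeR R => gram (G n) p.1 p.2).
Proof. by have [[mG _] _ _] := tG n; exact: cmeas_gram mG. Qed.

(** The diagonal is a null set, off the diagonal the Gram kernel tends to zero,
    and it is bounded by a constant. *)
Lemma integral_gram_cvg : S n @[n --> \oo] --> 0%E.
Proof.
have W0 : 0 <= W by have [_ _ LG] := tG 0; exact: L2le_ge0 LG.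
have S0 n tau : (0 <= \int[nu]_sigma (nc (gram (G n) tau sigma))%:E)%E.
  by apply: integral_ge0 => sigma _; rewrite lee_fin nc_ge0.
have mS n tau : measurable_fun setT (fun sigma : measurableTypeR R => (nc (gram (G n) tau sigma))%:E).
  exact: (measurable_ncE (cmeas_sec1 tau (mgram n))).
have iW : (\int[nu]_t (cst W%:E t) < +oo)%E.
  by rewrite integral_cst// [X in (_ * X)%E]unit_interval_measureT mule1 ltry.
apply: (@dominated_cvg0 _ _ _ nu (fun n tau => \int[nu]_sigma (nc (gram (G n) tau sigma))%:E)%E
  (cst W%:E)) => //.
- by move=> n; exact: (measurable_int_nc1 nu (mgram n)).
- apply/nearW => tau n; apply: integral_unit_bound.
  + exact: mS.
  + by move=> s; rewrite lee_fin nc_ge0.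
  + by apply/nearW => s; rewrite lee_fin; exact: gram_bound (tG n).
- apply/nearW => tau.
  apply: (@dominated_cvg0 _ _ _ nu (fun n sigma => (nc (gram (G n) tau sigma))%:E) (cst W%:E)).
  + by move=> n; exact: mS.
  + by move=> n s; rewrite lee_fin nc_ge0.
  + by apply/nearW => s n; rewrite lee_fin; exact: gram_bound (tG n).
  + exact: measurable_cst.
  + exact: iW.
  + by move=> t; rewrite lee_fin.
  + apply: (ae_imp (ae_unit_neqx tau)) => s ts.
    apply: cvg_EFin; first by apply: nearW => n.
    exact: gram_cvg ts.
Qed.

(** The squared norm of the difference on A is the difference of the pairings
    of the two distributions with the same test function, and each pairing is
    controlled by the Gram kernel. *)
Lemma born_jordan_strong :
  (\int[leb2]_z (\1_A z * nc (born_jordan (f_ n) z - born_jordan f z) ^+ 2)%:E)%E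
    @[n --> \oo] --> 0%E.
Proof.
have W0 : 0 <= W by have [_ _ LG] := tG 0; exact: L2le_ge0 LG.
have LD n := bj_diff_L2 Lfn Lf n.
have iD n : cint leb2 (fun z => bj_diff f_ f n z * dual_test f_ f A n z).
  exact: L2le_cint_mul (LD n) (dual_test_L2 Lfn Lf mA n).
have Sfin n : S n \is a fin_num.
  rewrite ge0_fin_numE; last first.
    by apply: integral_ge0 => t _; apply: integral_ge0 => s _; rewrite lee_fin nc_ge0.
  apply: (@le_lt_trans _ _ W%:E); last by rewrite ltry.
  apply: integral_unit_bound.
  - by exact: (measurable_int_nc1 nu (mgram n)).
  - by move=> t; apply: integral_ge0 => s _; rewrite lee_fin nc_ge0.
  apply/nearW => tau; apply: integral_unit_bound.
  - exact: (measurable_ncE (cmeas_sec1 tau (mgram n))).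
  - by move=> s; rewrite lee_fin nc_ge0.
  - by apply/nearW => s; rewrite lee_fin; exact: gram_bound (tG n).
have S0 n : 0 <= fine (S n).
  by apply: fine_ge0; apply: integral_ge0 => t _; apply: integral_ge0 => s _; rewrite lee_fin nc_ge0.
have N0 : 0 <= N by exact: L2le_ge0 Lf.
have bnd n g : L2le lam N g ->
    nc (integralC leb2 setT (fun z => born_jordan g z * G n z)) <= Num.sqrt (N * N * fine (S n)).
  move=> Lg; have := pairing_gram_bound Lg (tG n).
  rewrite -[X in (_ * X)%E]fineK// -EFinM lee_fin => h.
  rewrite -[leLHS]ger0_norm ?nc_ge0// -sqrtr_sqr ler_wsqrtr//.
pose r n := (\int[leb2]_z (\1_A z * nc (bj_diff f_ f n z) ^+ 2)%:E)%E.
have ptw n z : ((\1_A z * nc (bj_diff f_ f n z) ^+ 2)%:C)%C = bj_diff f_ f n z * dual_test f_ f A n z.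
  by rewrite /dual_test [RHS]mulrCA mul_conj -[RHS]rmorphM.
have ptw2 n z : \1_A z * nc (bj_diff f_ f n z) ^+ 2 = nc (bj_diff f_ f n z * dual_test f_ f A n z).
  by rewrite -ptw nc_real ger0_norm// mulr_ge0 ?sqr_ge0// indicE ler0n.
have r0 n : (0 <= r n)%E.
  by apply: integral_ge0 => z _; rewrite lee_fin ptw2 nc_ge0.
have rfin n : r n \is a fin_num.
  by rewrite ge0_fin_numE// /r; under eq_integral do rewrite ptw2; exact: (iD n).2.
have rE n : ((fine (r n))%:C)%C = integralC leb2 setT (fun z => born_jordan (f_ n) z * G n z) -
    integralC leb2 setT (fun z => born_jordan f z * G n z).
  have tg := tG n; have [ig _ Lg] := tg.
  rewrite -intCB; [|exact: L2le_cint_mul (born_jordan_L2 (Lfn n)) Lg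
                 |exact: L2le_cint_mul (born_jordan_L2 Lf) Lg].
  transitivity (integralC leb2 setT (fun z => bj_diff f_ f n z * G n z)); last first.
    by apply: eq_intC => z; rewrite /bj_diff mulrBl.
  rewrite (intC_good_version (dual_test_cint Lfn Lf mA Am n) (LD n).1 (iD n)).
  rewrite -[LHS](intC_real leb2 (fun z => \1_A z * nc (bj_diff f_ f n z) ^+ 2)).
  by apply: eq_intC => z; rewrite ptw.
apply: cvg_trans (_ : (fine (r n))%:E @[n --> \oo] --> 0%E).
  by apply: near_eq_cvg; apply: nearW => n; rewrite (fineK (rfin n)).
apply: cvg_EFin; first exact: nearW.
apply: (@squeeze_cvgr _ _ _ _ (fun=> 0) (fun n => Num.sqrt (N * N * fine (S n)) + Num.sqrt (N * N * fine (S n)))).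
- apply: nearW => n; apply/andP; split; first exact: fine_ge0 (r0 n).
  rewrite -[leLHS]ger0_norm ?(fine_ge0 (r0 n))// -nc_real rE.
  by apply: le_trans (ncD _ _) _; rewrite ncN; apply: lerD; exact: bnd.
- exact: cvg_cst.
- have sc : Num.sqrt (N * N * fine (S n)) @[n --> \oo] --> (0 : R).
    rewrite -[X in _ --> X](@sqrtr0 R); apply: continuous_cvg; first exact: sqrt_continuous.
    rewrite -[X in _ --> X](mulr0 (N * N)); apply: cvgM; first exact: cvg_cst.
    by apply: fine_cvg; exact: integral_gram_cvg.
  by rewrite -[X in _ --> X](addr0 (0 : R)); apply: cvgD.
Qed.

End strong_limit.

(** * Completion of a measure *)

Section completion.
Context {disp} {T : measurableType disp} {R : realType}.
Variable mu : {measure set T -> \bar R}.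
Local Notation cT := (caratheodory_type mu^*%mu).

Definition completion : {measure set cT -> \bar R} := @completed_measure_extension _ _ _ mu.

Lemma completion_measurable (A : set T) : measurable A -> measurable (A : set cT).
Proof. exact: caratheodory_measurable_mu_ext. Qed.

Lemma completionE (A : set T) : measurable A -> completion A = mu A.
Proof. exact: measurable_mu_extE. Qed.

Lemma completion_measurable_fun (h : T -> \bar R) : measurable_fun setT h ->
  measurable_fun setT (h : cT -> \bar R).
Proof. by move=> mh _ Y mY; apply: completion_measurable; exact: mh. Qed.

(** The completed measure is carried to the original one by the identity map,
    which is measurable from the completed sigma-algebra to the original one.
    *)
Lemma integral_completion (h : T -> \bar R) : measurable_fun setT h ->
  (forall x, 0 <= h x)%E -> (\int[completion]_x h x = \int[mu]_x h x)%E.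
Proof.
move=> mh h0.
have mid : measurable_fun setT (id : cT -> T).
  by move=> _ Y mY; rewrite setTI; exact: completion_measurable.
have := ge0_integral_pushforward mid completion measurableT mh (fun x _ => h0 x).
rewrite preimage_setT => <-.
apply: eq_measure_integral => A mA _; exact: completionE.
Qed.

(** Intersect countable covers of O whose measures approach the outer measure.
    *)
Lemma measurable_hull (O : set cT) : measurable O -> (completion O < +oo)%E ->
  exists A : set T, [/\ measurable A, O `<=` A, mu A = completion O &
    completion ((A : set cT) `\` O) = 0%E].
Proof.
move=> mO Ofin.
have fO : completion O \is a fin_num by rewrite ge0_fin_numE.
have cov n : exists A : set T, [/\ measurable A, O `<=` A &
    (mu A <= completion O + (n.+1%:R^-1)%:E)%E].
  have e0 : 0 < n.+1%:R^-1 :> R by rewrite invr_gt0.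
  have [x [F [mF sF] <-] xlt] := lb_ereal_inf_adherent e0 fO.
  exists (\bigcup_k F k); split => //; first exact: bigcupT_measurable.
  apply: le_trans (ltW xlt); apply: measure_sigma_subadditive => //.
  exact: bigcupT_measurable.
have {cov} [F FP] := choice cov.
have mA : measurable (\bigcap_n F n) by apply: bigcapT_measurable => n; have [] := FP n.
have sA : O `<=` \bigcap_n F n by move=> x Ox n _; have [_ s _] := FP n; exact: s.
have E1 : mu (\bigcap_n F n) = completion O.
  apply/eqP; rewrite eq_le; apply/andP; split.
    apply/lee_addgt0Pr => e e0.
    have [n _ /(_ n (leqnn n))/= ne] := near_infty_natSinv_lt (PosNum e0).
    have [mF _ bF] := FP n; apply: (@le_trans _ _ (mu (F n))).
      by apply: le_measure; rewrite ?inE//; exact: bigcap_inf.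
    by apply: le_trans bF _; rewrite leeD2l// lee_fin ltW.
  rewrite -completionE//; apply: le_measure; rewrite ?inE//.
  exact: completion_measurable.
exists (\bigcap_n F n); split => //.
have mA' := completion_measurable mA.
rewrite measureD//=; last by rewrite completionE// E1.
by rewrite setIidr// completionE// E1 subee.
Qed.

End completion.
Arguments completion_measurable_fun {disp T R} mu [h] _.

(** * L^p norms on a set of finite measure *)

Section elementary.
Context {R : realType}.
Implicit Types t p q : R.

(** For t near 0 the power t^p is at most eta, for t large it is at most eta
    t^q, and in between both t^p and t^2 are bounded above and below. *)
Lemma powR_interpolation p q (eta : R) : 1 <= p -> p < q -> 0 < eta ->
  exists2 C, 0 <= C & forall t, 0 <= t -> t `^ p <= eta * (1 + t `^ q) + C * t ^+ 2.
Proof.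
(* below delta the power is at most eta; T is the point where t^(p - q) = delta
   *)
move=> p1 pq eta0; pose delta := Num.min 1 eta; pose T := delta `^ (- (q - p)^-1).
have d0 : 0 < delta by rewrite lt_min ltr01.
have d1 : delta <= 1 by rewrite ge_min lexx.
have de : delta <= eta by rewrite ge_min lexx orbT.
have p0 : 0 <= p by apply: le_trans p1.
have C0 : 0 <= T `^ p / delta ^+ 2 by rewrite divr_ge0 ?powR_ge0// sqr_ge0.
exists (T `^ p / delta ^+ 2) => // t t0.
have etq : 0 <= eta * t `^ q by rewrite mulr_ge0 ?powR_ge0// ltW.
have Ct : 0 <= T `^ p / delta ^+ 2 * t ^+ 2 by rewrite mulr_ge0// sqr_ge0.
rewrite mulrDr mulr1.
have [td|td] := leP t delta.
  have t1 : t <= 1 by apply: le_trans d1.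
  have : t `^ p <= t.
    have [->|tn0] := eqVneq t 0; first by rewrite powR0// gt_eqF// (lt_le_trans ltr01).
    by apply: ge1r_powR => //; rewrite lt_neqAle eq_sym tn0 t0.
  lra.
have [tT|tT] := leP t T.
  have h1 : t `^ p <= T `^ p by rewrite ge0_ler_powR ?nnegrE// powR_ge0.
  have h2 : T `^ p <= T `^ p / delta ^+ 2 * t ^+ 2.
    rewrite -mulrA ler_peMr ?powR_ge0// mulrC ler_pdivlMr ?exprn_gt0// mul1r.
    by rewrite lerXn2r ?nnegrE// ltW.
  lra.
have tp0 : 0 < t by apply: le_lt_trans tT; rewrite powR_ge0.
have h : t `^ p <= eta * t `^ q.
  have -> : t `^ p = t `^ (p - q) * t `^ q.
    by rewrite -powRD ?subrK//; apply/implyP => _; rewrite gt_eqF.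
  rewrite ler_wpM2r ?powR_ge0//; apply: le_trans de.
  have -> : p - q = - (q - p) by rewrite opprB.
  rewrite powRN.
  have -> : delta = (T `^ (q - p))^-1.
    rewrite /T -powRrM mulNr mulVf ?powR_inv1 ?invrK ?ltW//.
    by rewrite subr_eq0 gt_eqF.
  have Tp : 0 < T by rewrite powR_gt0.
  rewrite lef_pV2 ?posrE ?powR_gt0//.
  by rewrite ge0_ler_powR ?nnegrE ?subr_ge0 ?powR_ge0// ltW.
lra.
Qed.

Lemma powR_addD (a b q : R) : 0 <= a -> 0 <= b -> 0 < q ->
  (a + b) `^ q <= 2 `^ q * (a `^ q + b `^ q).
Proof.
wlog ab : a b / a <= b => [hw a0 b0 q0|a0 b0 q0].
  have [ab|/ltW ab] := leP a b; first exact: hw.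
  by rewrite addrC [X in _ * X]addrC; exact: hw.
apply: (@le_trans _ _ ((2 * b) `^ q)).
  apply: ge0_ler_powR; rewrite ?nnegrE; lra.
by rewrite powRM// ler_wpM2l ?powR_ge0// lerDr powR_ge0.
Qed.

End elementary.

Section Lp_on_set.
Context {disp} {T : measurableType disp} {R : realType}.
Variables (mu : {measure set T -> \bar R}) (A : set T) (m : R).
Hypothesis mA : measurable A.
Hypothesis Am : mu A = m%:E.
Implicit Types (u v w : T -> R) (p q : R).

(** The p-th power of the L^p norm on A of a nonnegative function, which is the
    quantity that passes easily through integration. *)
Definition Lp_mass p u : \bar R := (\int[mu]_x (\1_A x * u x `^ p)%:E)%E.

Lemma Lp_mass_ge0 p u : (0 <= Lp_mass p u)%E.
Proof. by apply: integral_ge0 => x _; rewrite lee_fin mulr_ge0 ?powR_ge0. Qed.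

Lemma measurable_Lp_mass p u : measurable_fun setT u ->
  measurable_fun setT (fun x => (\1_A x * u x `^ p)%:E).
Proof.
move=> mu0; apply/measurable_EFinP; apply: measurable_funM => //.
exact: (measurableT_comp (measurable_powR p) mu0).
Qed.

Lemma measurable_powRE p u : measurable_fun setT u ->
  measurable_fun setT (fun x => (u x `^ p)%:E).
Proof.
by move=> mu0; apply/measurable_EFinP; exact: (measurableT_comp (measurable_powR p) mu0).
Qed.

Lemma integral_cindic : (\int[mu]_x (\1_A x : R)%:E = m%:E)%E.
Proof. by rewrite integral_indic// setIT. Qed.

Lemma Lp_mass_le p q (B eta C : R) u (b : \bar R) : 0 <= eta -> 0 <= C ->
  (forall t, 0 <= t -> t `^ p <= eta * (1 + t `^ q) + C * t ^+ 2) ->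
  measurable_fun setT u -> (forall x, 0 <= u x) ->
  (\int[mu]_x (u x `^ q)%:E <= B%:E)%E ->
  (\int[mu]_x (\1_A x * u x ^+ 2)%:E <= b)%E ->
  (Lp_mass p u <= (eta * (m + B))%:E + C%:E * b)%E.
Proof.
move=> eta0 C0 ineq mu0 u0 uq u2.
have m1 : measurable_fun setT (fun x => (\1_A x : R)%:E) by apply/measurable_EFinP.
have mq := measurable_powRE q mu0.
have m2 : measurable_fun setT (fun x => (\1_A x * u x ^+ 2)%:E).
  by apply/measurable_EFinP; apply: measurable_funM => //; exact: measurable_funX.
have q0 x : (0 <= (u x `^ q)%:E)%E by rewrite lee_fin powR_ge0.
have s0 x : (0 <= (\1_A x * u x ^+ 2)%:E)%E by rewrite lee_fin mulr_ge0// sqr_ge0.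
have i0 x : (0 <= (\1_A x : R)%:E)%E by rewrite lee_fin.
have m1q : measurable_fun setT (fun x => (\1_A x : R)%:E + (u x `^ q)%:E)%E.
  exact: emeasurable_funD.
apply: (@le_trans _ _ (\int[mu]_x (eta%:E * ((\1_A x : R)%:E + (u x `^ q)%:E) +
    C%:E * (\1_A x * u x ^+ 2)%:E))%E).
  apply: ge0_le_integral.
  - exact: measurableT.
  - by move=> x _; rewrite lee_fin mulr_ge0 ?powR_ge0.
  - exact: measurable_Lp_mass.
  - by apply: emeasurable_funD; apply: (emeasurable_funM (measurable_cst _)).
  - move=> x _; rewrite -(EFinD (\1_A x) (u x `^ q)) -EFinM -EFinM -EFinD lee_fin.
    have := ineq (u x) (u0 x); rewrite indicE; case: (x \in A).
      by rewrite !mul1r.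
    by rewrite !mul0r mulr0 add0r addr0 => _; rewrite mulr_ge0// powR_ge0.
rewrite ge0_integralD//; last 4 first.
- by move=> x _; rewrite mule_ge0// adde_ge0.
- exact: (emeasurable_funM (measurable_cst _)).
- by move=> x _; rewrite mule_ge0.
- exact: (emeasurable_funM (measurable_cst _)).
rewrite ge0_integralZl//; last by move=> x _; rewrite adde_ge0.
rewrite ge0_integralZl// ge0_integralD// integral_cindic.
rewrite EFinM EFinD; apply: leeD; apply: lee_wpmul2l => //.
by rewrite leeD2l.
Qed.

Lemma Lp_mass_fin p q (B : R) u : 1 <= p -> p < q -> measurable_fun setT u ->
  (forall x, 0 <= u x) -> (\int[mu]_x (u x `^ q)%:E <= B%:E)%E ->
  (\int[mu]_x (\1_A x * u x ^+ 2)%:E < +oo)%E -> (Lp_mass p u < +oo)%E.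
Proof.
move=> p1 pq mu0 u0 uq u2; have [C C0 ineq] := powR_interpolation p1 pq ltr01.
apply: le_lt_trans (Lp_mass_le ler01 C0 ineq mu0 u0 uq (lexx _)) _.
by rewrite lte_add_pinfty ?ltry// lte_mul_pinfty ?lee_fin.
Qed.

(** The part of the bound proportional to eta is made small first, uniformly in
    n, and then the quadratic part tends to zero. *)
Lemma Lp_mass_cvg0 p q (B : R) (u_ : nat -> T -> R) : 1 <= p -> p < q ->
  (forall n, measurable_fun setT (u_ n)) -> (forall n x, 0 <= u_ n x) ->
  (forall n, \int[mu]_x (u_ n x `^ q)%:E <= B%:E)%E ->
  (forall n, \int[mu]_x (\1_A x * u_ n x ^+ 2)%:E < +oo)%E ->
  (\int[mu]_x (\1_A x * u_ n x ^+ 2)%:E)%E @[n --> \oo] --> 0%E ->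
  Lp_mass p (u_ n) @[n --> \oo] --> 0%E.
Proof.
move=> p1 pq mu_ u0 uq u2fin u2.
have m0 : 0 <= m by rewrite -lee_fin -Am.
have B0 : 0 <= B.
  by rewrite -lee_fin; apply: le_trans (uq 0); apply: integral_ge0 => x _; rewrite lee_fin powR_ge0.
have pfin n : Lp_mass p (u_ n) \is a fin_num.
  by rewrite ge0_fin_numE ?Lp_mass_ge0//; exact: Lp_mass_fin p1 pq _ _ (uq n) (u2fin n).
pose s n := (\int[mu]_x (\1_A x * u_ n x ^+ 2)%:E)%E.
have s0 n : (0 <= s n)%E.
  by apply: integral_ge0 => x _; rewrite lee_fin mulr_ge0// sqr_ge0.
have sfin n : s n \is a fin_num by rewrite ge0_fin_numE//; exact: u2fin.
have fs : fine (s n) @[n --> \oo] --> (0 : R) by apply: fine_cvg; exact: u2.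
apply: cvg_trans (_ : (fine (Lp_mass p (u_ n)))%:E @[n --> \oo] --> 0%E).
  by apply: near_eq_cvg; apply: nearW => n; rewrite (fineK (pfin n)).
apply: cvg_EFin; first exact: nearW.
apply/cvgrPdist_lt => e e0.
have K0 : 0 < 2 * (m + B + 1) by lra.
have eta0 : 0 < e / (2 * (m + B + 1)) by rewrite divr_gt0.
have [C C0 ineq] := powR_interpolation p1 pq eta0.
have Cs : C * fine (s n) @[n --> \oo] --> (0 : R).
  by rewrite -[X in _ --> X](mulr0 C); apply: cvgM => //; exact: cvg_cst.
have e2 : 0 < e / 2 by lra.
move/cvgrPdist_lt : Cs => /(_ _ e2); apply: filterS => n; rewrite !sub0r !normrN.
rewrite ger0_norm ?mulr_ge0 ?fine_ge0// => hn.
rewrite (ger0_norm (fine_ge0 (Lp_mass_ge0 p (u_ n)))).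
have := Lp_mass_le (ltW eta0) C0 ineq (mu_ n) (u0 n) (uq n) (lexx _).
rewrite -/(s n) -(fineK (pfin n)) -(fineK (sfin n)) -EFinM -EFinD lee_fin => h.
apply: le_lt_trans h _.
have : e / (2 * (m + B + 1)) * (m + B) <= e / 2.
  have K1 : 0 < m + B + 1 by lra.
  have -> : e / (2 * (m + B + 1)) * (m + B) = e / 2 * ((m + B) / (m + B + 1)).
    by field; rewrite gt_eqF.
  apply: ler_piMr; first lra.
  by rewrite ler_pdivrMr// mul1r lerDl.
lra.
Qed.

Definition Lp_norm p u : \bar R := (Lp_mass p u `^ p^-1)%E.

Lemma Lp_normE p u : p != 0 -> (forall x, 0 <= u x) ->
  Lp_norm p u = Lnorm mu p%:E (EFin \o (fun x => (\1_A x * u x : R))).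
Proof.
move=> p0 u0; rewrite unlock /Lnorm /Lp_norm /Lp_mass; congr (_ `^ _)%E.
apply: eq_integral => x _; rewrite /= ger0_norm ?mulr_ge0// powRM//.
by rewrite indicE; case: (x \in A); rewrite ?powR1 ?powR0.
Qed.

Lemma Lp_norm_triangle p u v w : 1 <= p ->
  measurable_fun setT u -> measurable_fun setT v -> measurable_fun setT w ->
  (forall x, 0 <= u x) -> (forall x, 0 <= v x) -> (forall x, 0 <= w x) ->
  (forall x, w x <= u x + v x) -> (Lp_norm p w <= Lp_norm p u + Lp_norm p v)%E.
Proof.
move=> p1 mu0 mv mw u0 v0 w0 wuv.
have p0 : 0 < p by apply: lt_le_trans p1.
have pn0 : p != 0 by rewrite gt_eqF.
have mi (g : T -> R) : measurable_fun setT g -> measurable_fun setT (fun x => \1_A x * g x).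
  by move=> mg; apply: measurable_funM.
have uv0 x : 0 <= u x + v x by rewrite addr_ge0.
apply: (@le_trans _ _ (Lp_norm p (fun x => u x + v x))).
  rewrite /Lp_norm; apply: gt0_ler_poweR; rewrite ?invr_ge0 ?(ltW p0) ?in_itv/= ?andbT ?leey ?Lp_mass_ge0//.
  apply: ge0_le_integral => //.
  - by move=> x _; rewrite lee_fin mulr_ge0 ?powR_ge0.
  - exact: measurable_Lp_mass.
  - by apply: measurable_Lp_mass; exact: measurable_funD.
  - move=> x _; rewrite lee_fin ler_wpM2l//.
    by rewrite ge0_ler_powR ?nnegrE// ltW.
rewrite !Lp_normE//.
have -> : EFin \o (fun x => \1_A x * (u x + v x)) =
    EFin \o ((fun x => \1_A x * u x) \+ (fun x => \1_A x * v x)).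
  by apply/funext => x /=; rewrite mulrDr.
by apply: minkowski_EFin => //; exact: mi.
Qed.

Lemma Lp_norm_cvg p (u_ v_ : nat -> T -> R) u : 1 <= p ->
  measurable_fun setT u -> (forall n, measurable_fun setT (u_ n)) ->
  (forall n, measurable_fun setT (v_ n)) ->
  (forall x, 0 <= u x) -> (forall n x, 0 <= u_ n x) -> (forall n x, 0 <= v_ n x) ->
  (forall n x, u_ n x <= u x + v_ n x) -> (forall n x, u x <= u_ n x + v_ n x) ->
  (Lp_mass p u < +oo)%E -> (forall n, Lp_mass p (u_ n) < +oo)%E ->
  (forall n, Lp_mass p (v_ n) < +oo)%E ->
  Lp_mass p (v_ n) @[n --> \oo] --> 0%E ->
  Lp_norm p (u_ n) @[n --> \oo] --> Lp_norm p u.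
Proof.
move=> p1 mu0 mu_ mv_ u0 un0 vn0 h1 h2 uf unf vnf vc.
have p0 : 0 < p by apply: lt_le_trans p1.
have fin (g : T -> R) : (Lp_mass p g < +oo)%E -> Lp_norm p g \is a fin_num.
  by move=> gf; rewrite ge0_fin_numE ?poweR_ge0// poweR_lty.
have fN (g : T -> R) : (Lp_mass p g < +oo)%E -> Lp_norm p g = (fine (Lp_mass p g) `^ p^-1)%:E.
  move=> gf; rewrite /Lp_norm -[in LHS](@fineK _ (Lp_mass p g)) ?poweR_EFin//.
  by rewrite ge0_fin_numE ?Lp_mass_ge0.
pose b n := fine (Lp_mass p (v_ n)) `^ p^-1.
have b0 : b n @[n --> \oo] --> (0 : R).
  have H : fine (Lp_mass p (v_ n)) @[n --> \oo] --> (0 : R) by apply: fine_cvg.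
  rewrite -[X in _ --> X](@powR0 _ p^-1) ?invr_eq0 ?gt_eqF//.
  apply/cvgrPdist_lt => e e0; rewrite powR0 ?invr_eq0 ?gt_eqF//.
  have ep : 0 < e `^ p by rewrite powR_gt0.
  move/cvgrPdist_lt : H => /(_ _ ep); apply: filterS => n; rewrite !sub0r !normrN.
  rewrite (ger0_norm (fine_ge0 (Lp_mass_ge0 p (v_ n)))) ger0_norm ?powR_ge0// => hn.
  have -> : e = (e `^ p) `^ p^-1 by rewrite -powRrM mulfV ?gt_eqF// powRr1// ltW.
  by rewrite gt0_ltr_powR ?invr_gt0 ?nnegrE ?(fine_ge0 (Lp_mass_ge0 _ _)) ?powR_ge0.
pose a n := fine (Lp_norm p (u_ n)); pose a0 := fine (Lp_norm p u).
have aE n : Lp_norm p (u_ n) = (a n)%:E := esym (fineK (fin _ (unf n))).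
have a0E : Lp_norm p u = a0%:E := esym (fineK (fin _ uf)).
have k1 n : a n <= a0 + b n.
  have H : (Lp_norm p (u_ n) <= Lp_norm p u + Lp_norm p (v_ n))%E by exact: Lp_norm_triangle.
  by rewrite (aE n) a0E (fN _ (vnf n)) -EFinD lee_fin in H.
have k2 n : a0 <= a n + b n.
  have H : (Lp_norm p u <= Lp_norm p (u_ n) + Lp_norm p (v_ n))%E by exact: Lp_norm_triangle.
  by rewrite (aE n) a0E (fN _ (vnf n)) -EFinD lee_fin in H.
rewrite a0E; apply: cvg_trans (_ : (a n)%:E @[n --> \oo] --> a0%:E).
  by apply: near_eq_cvg; apply: nearW => n; first [exact: aE | exact: (esym (aE n))].
apply: cvg_EFin; first exact: nearW.
apply/cvgrPdist_lt => e e0; move/cvgrPdist_lt : b0 => /(_ _ e0); apply: filterS => n.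
rewrite sub0r normrN (ger0_norm (powR_ge0 _ _)) -/(b n) => hb.
have := k1 n; have := k2 n; rewrite ltr_norml => h3 h4; rewrite [X in a0 - X]/=.
by apply/andP; split; lra.
Qed.

End Lp_on_set.

(** * Continuity of the functional *)

(** The condition on q is strict and open, so any q strictly between max (p, 2)
    and the critical exponent works; in dimension 2 every q does. *)
Lemma subcritical_exponent (R : realType) d (p : R) : (2 <= d)%N -> 1 <= p ->
  (p%:E < critical_exponent R d)%E ->
  exists q : R, [/\ p < q, 2 <= q & d%:R / 2 * ((q - 2) / q) < 1].
Proof.
move=> d2 p1; rewrite /critical_exponent; case: ifPn => [d2'|].
  have -> : d = 2 by apply/eqP; rewrite eqn_leq d2' d2.
  move=> _; exists (p + 2); split; [lra|lra|].
  have q0 : 0 < p + 2 by lra.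
  by rewrite divff ?pnatr_eq0// mul1r ltr_pdivrMr// mul1r; lra.
rewrite -ltnNge => d3; rewrite lte_fin.
have D3 : (3 : R) <= d%:R by rewrite (ler_nat _ 3 d).
move: (d%:R) D3 => D D3 pP.
have D0 : D != 0 by rewrite gt_eqF//; lra.
have D2 : D - 2 != 0 by rewrite gt_eqF//; lra.
have PE : (2^-1 - D^-1)^-1 = 2 * D / (D - 2).
  by rewrite -[RHS]invrK; congr (_^-1); field; rewrite D0 D2.
move: pP; rewrite PE => pP.
have P2 : 2 < 2 * D / (D - 2) by rewrite ltr_pdivlMr; lra.
(* the midpoint between max (p, 2) and the critical exponent 2 D / (D - 2) *)
pose q := (Num.max p 2 + 2 * D / (D - 2)) / 2.
have mP : Num.max p 2 < 2 * D / (D - 2) by rewrite gt_max pP.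
have [pm m2] : p <= Num.max p 2 /\ 2 <= Num.max p 2 by rewrite !le_max !lexx orbT.
have qm : Num.max p 2 < q by rewrite /q; lra.
have qP : q < 2 * D / (D - 2) by rewrite /q; lra.
exists q; split; [lra|lra|].
have q0 : 0 < q by lra.
rewrite mulrA ltr_pdivrMr// mul1r.
move: qP; rewrite ltr_pdivlMr; last by lra.
move=> qP.
rewrite (_ : D / 2 * (q - 2) = (D * (q - 2)) / 2); last by ring.
by rewrite ltr_pdivrMr//; lra.
Qed.

Section norms.
Context {R : realType} {d : nat}.
Local Notation E := (euclidean R d).
Local Notation lam := (leb R d).
Implicit Types f : E -> R[i].

Lemma normL2E f : normL2 f = ((\int[lam]_x (nc (f x) ^+ 2)%:E) `^ 2^-1)%E.
Proof.
rewrite /normL2 /normLp unlock /Lnorm; congr (_ `^ _)%E.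
apply: eq_integral => x _; rewrite patchE mem_setT abse_EFin poweR_EFin.
by rewrite ger0_norm ?nc_ge0// powR_mulrn// nc_ge0.
Qed.

Lemma normL2_sqr f : (normL2 f ^+ 2 = \int[lam]_x (nc (f x) ^+ 2)%:E)%E.
Proof.
rewrite normL2E; set I := integral _ _ _.
have I0 : (0 <= I)%E by apply: integral_ge0 => x _; rewrite lee_fin sqr_ge0.
have E1 : 2^-1 + 2^-1 = 1 :> R by lra.
rewrite expe2 -poweRD ?E1 ?poweRe1//; apply: add_neq0_poweRD_def.
by rewrite E1 oner_neq0.
Qed.

Lemma inL2P f : inL2 f <-> cmeas f /\ (\int[lam]_x (nc (f x) ^+ 2)%:E < +oo)%E.
Proof.
rewrite /inL2 /inLp -/(normL2 f) normL2E; split => [[m1 m2 h]|[[m1 m2] h]]; split=> //.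
  by apply: lty_poweRy h; rewrite invr_eq0.
exact: poweR_lty.
Qed.

Lemma inL2_L2le f : inL2 f -> L2le lam (fine (\int[lam]_x (nc (f x) ^+ 2)%:E)%E) f.
Proof. by move=> /inL2P[mf h]; exact: L2le_fine. Qed.

Lemma L2le_inL2 N f : L2le lam N f -> inL2 f.
Proof. by move=> Lf; apply/inL2P; split; [exact: Lf.1|exact: L2le_lty Lf]. Qed.

End norms.

Section J_BJ_hull.

Context {R : realType} {d : nat}.
Local Notation E := (euclidean R d).
Local Notation lam := (leb R d).
Local Notation leb2 := (prodm lam lam).
Local Notation M2 := ((lam \x lam)%E : {measure set (E * E) -> \bar R}).
Variables (Omega : set (phase_space R d)) (A : set (E * E)) (p m : R).
Hypothesis mO : measurable Omega.
Hypothesis mA : measurable A.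
Hypothesis sA : Omega `<=` A.
Hypothesis Am : leb2 A = m%:E.
Hypothesis AO : leb_phase R d ((A : set (phase_space R d)) `\` Omega) = 0%E.
Hypothesis p1 : 1 <= p.

(** Omega and A differ by a null set of the completed measure, and on Borel
    functions the completed measure agrees with the product measure. *)
Lemma normLp_hull (g : E * E -> R[i]) : cmeas g ->
  normLp (leb_phase R d) Omega p g = Lp_norm leb2 A p (fun z => nc (g z)).
Proof.
move=> mg; have p0 : 0 < p by apply: lt_le_trans p1.
rewrite /normLp unlock /Lnorm /Lp_norm /Lp_mass; congr (_ `^ _)%E.
have mG := measurable_Lp_mass mA p (measurable_nc mg).
have G0 z : (0 <= (\1_A z * nc (g z) `^ p)%:E)%E by rewrite lee_fin mulr_ge0// powR_ge0.
have mGO : measurable_fun setT (fun z : phase_space R d => (\1_Omega z * nc (g z) `^ p)%:E).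
  have mgp := completion_measurable_fun M2 (measurable_powRE p (measurable_nc mg)).
  under eq_fun do rewrite EFinM.
  apply: emeasurable_funM; last exact: mgp.
  by apply/measurable_EFinP; exact: measurable_indic.
transitivity (\int[leb_phase R d]_z (\1_Omega z * nc (g z) `^ p)%:E)%E.
  apply: eq_integral => z _; rewrite patchE indicE; case: (z \in Omega).
    by rewrite abse_EFin poweR_EFin ger0_norm ?nc_ge0// mul1r.
  by rewrite abse0 poweR0r ?gt_eqF// mul0r.
transitivity (\int[leb_phase R d]_z (\1_A z * nc (g z) `^ p)%:E)%E; last first.
  exact: (integral_completion M2 mG G0).
apply: ge0_ae_eq_integral.
- exact: measurableT.
- exact: mGO.
- exact: (completion_measurable_fun M2 mG).
- by move=> z _; rewrite lee_fin mulr_ge0// powR_ge0.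
- by move=> z _; rewrite lee_fin mulr_ge0// powR_ge0.
exists ((A : set (phase_space R d)) `\` Omega); split => //.
  by apply: measurableD => //; exact: (completion_measurable M2 mA).
move=> z /= nz; apply: contrapT => nAO; apply: nz => _; congr (_ * _)%:E.
rewrite !indicE; have [Oz|nOz] := pselect (Omega z).
  by rewrite !mem_set//; exact: sA.
by rewrite !memNset// => Az; apply: nAO.
Qed.

Lemma J_BJE (f : E -> R[i]) : cmeas f ->
  J_BJ Omega p f = Lp_norm leb2 A p (fun z => nc (born_jordan f z)).
Proof. by move=> mf; apply: normLp_hull; exact: cmeas_born_jordan. Qed.

Variable q : R.
Hypothesis pq : p < q.
Hypothesis q2 : 2 <= q.
Hypothesis qd : d%:R / 2 * ((q - 2) / q) < 1.

Lemma indic_L2_lt N (g : E * E -> R[i]) : L2le leb2 N g ->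
  (\int[leb2]_z (\1_A z * nc (g z) ^+ 2)%:E < +oo)%E.
Proof.
move=> Lg; apply: le_lt_trans (L2le_lty Lg); apply: ge0_le_integral.
- exact: measurableT.
- by move=> z _; rewrite lee_fin mulr_ge0// sqr_ge0.
- under eq_fun do rewrite EFinM.
  apply: emeasurable_funM; last exact: measurable_nc2E Lg.1.
  by apply/measurable_EFinP; exact: measurable_indic.
- exact: measurable_nc2E Lg.1.
- by move=> z _; rewrite lee_fin ler_piMl ?sqr_ge0// indicE lern1 leq_b1.
Qed.

Lemma Lp_mass_BJ N (f : E -> R[i]) : L2le lam N f ->
  (Lp_mass leb2 A p (fun z => nc (born_jordan f z)) < +oo)%E.
Proof.
move=> Lf; apply: (Lp_mass_fin mA Am p1 pq _ _ (born_jordan_Lq q2 qd Lf)).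
- exact: measurable_nc (cmeas_born_jordan Lf.1).
- by move=> z; exact: nc_ge0.
- exact: indic_L2_lt (born_jordan_L2 Lf).
Qed.

Lemma J_BJ_fin N (f : E -> R[i]) : L2le lam N f -> (J_BJ Omega p f < +oo)%E.
Proof. by move=> Lf; rewrite (J_BJE Lf.1); apply: poweR_lty; exact: Lp_mass_BJ Lf. Qed.

(** The strong L^2 convergence on A is upgraded to L^p by the uniform L^q
    bound, and Minkowski's inequality transfers it to the norms. *)
Lemma J_BJ_cvg N (f_ : nat -> E -> R[i]) (f : E -> R[i]) :
  (forall n, L2le lam N (f_ n)) -> L2le lam N f ->
  weakly_null lam (fun n x => f_ n x - f x) ->
  J_BJ Omega p (f_ n) @[n --> \oo] --> J_BJ Omega p f.
Proof.
move=> Lfn Lf wf.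
pose v n z := nc (born_jordan (f_ n) z - born_jordan f z).
have Lv n := bj_diff_L2 Lfn Lf n.
pose I := weight_bound (d%:R / 2 * ((q - 2) / q)) `^ q * N `^ q.
have mb (g : E -> R[i]) : L2le lam N g -> measurable_fun setT (fun z => nc (born_jordan g z)).
  by move=> Lg; exact: measurable_nc (cmeas_born_jordan Lg.1).
have q0 : 0 < q by apply: lt_le_trans q2.
have vq n : (\int[leb2]_z (v n z `^ q)%:E <= (2 `^ q * (I + I))%:E)%E.
  apply: (@le_trans _ _ (\int[leb2]_z ((2 `^ q)%:E * ((nc (born_jordan (f_ n) z) `^ q)%:E +
     (nc (born_jordan f z) `^ q)%:E)))%E).
    apply: ge0_le_integral.
    - exact: measurableT.
    - by move=> z _; rewrite lee_fin powR_ge0.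
    - exact: measurable_powRE (measurable_nc (Lv n).1).
    - apply: (emeasurable_funM (measurable_cst _)); apply: emeasurable_funD;
        apply: measurable_powRE; exact: mb.
    - move=> z _; rewrite -EFinD -EFinM lee_fin.
      apply: le_trans (powR_addD (nc_ge0 _) (nc_ge0 _) q0).
      apply: ge0_ler_powR; rewrite ?nnegrE ?nc_ge0 ?addr_ge0 ?nc_ge0//; first exact: ltW.
      by apply: le_trans (ncD _ _) _; rewrite ncN.
  have mpow (g : E -> R[i]) : L2le lam N g -> measurable_fun setT (fun z => (nc (born_jordan g z) `^ q)%:E).
    by move=> Lg; apply: measurable_powRE; exact: mb.
  have pow0 (g : E -> R[i]) z : (0 <= (nc (born_jordan g z) `^ q)%:E)%E by rewrite lee_fin powR_ge0.
  rewrite ge0_integralZl.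
  - rewrite EFinM; apply: lee_wpmul2l; first by rewrite lee_fin powR_ge0.
    rewrite ge0_integralD; [|exact: measurableT|by move=> z _; exact: pow0|exact: mpow
      |by move=> z _; exact: pow0|exact: mpow].
    by rewrite EFinD; apply: leeD; exact: born_jordan_Lq.
  - exact: measurableT.
  - by apply: emeasurable_funD; exact: mpow.
  - by move=> z _; rewrite adde_ge0.
  - by rewrite lee_fin powR_ge0.
have v2 n := indic_L2_lt (Lv n).
have mv n : measurable_fun setT (v n) by exact: measurable_nc (Lv n).1.
have v0 n z : 0 <= v n z by exact: nc_ge0.
have v2c : (\int[leb2]_z (\1_A z * v n z ^+ 2)%:E)%E @[n --> \oo] --> 0%E.
  exact: born_jordan_strong Lfn Lf wf mA Am.
have vc := Lp_mass_cvg0 mA Am p1 pq mv v0 vq v2 v2c.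
rewrite (J_BJE Lf.1); under eq_fun do rewrite (J_BJE (Lfn _).1).
apply: (Lp_norm_cvg (v_ := v) mA p1) => //.
- exact: mb.
- by move=> n; exact: mb.
- by move=> z; exact: nc_ge0.
- by move=> n z; exact: nc_ge0.
- move=> n z; rewrite -[born_jordan (f_ n) z](subrK (born_jordan f z)) addrC.
  exact: ncD.
- move=> n z; rewrite -[X in nc X <= _](subKr (born_jordan (f_ n) z)).
  by apply: le_trans (ncD _ _) _; rewrite ncN.
- exact: Lp_mass_BJ Lf.
- by move=> n; exact: Lp_mass_BJ (Lfn n).
- by move=> n; exact: (Lp_mass_fin mA Am p1 pq (mv n) (v0 n) (vq n) (v2 n)).
Qed.

End J_BJ_hull.

(** * Uniform boundedness and weak compactness in Hilbert spaces *)

Lemma ler_div_add1 (R : realType) (e y : R) : 0 <= e -> 0 <= y -> e / (y + 1) * y <= e.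
Proof.
move=> e0 y0; have y1 : 0 < y + 1 by lra.
by rewrite mulrAC ler_pdivrMr// ler_wpM2l// lerDl.
Qed.

Section pre_hilbert.
Context {R : realType} {H : lmodType R}.
Variable ip : H -> H -> R.
Hypothesis ipC : forall x y, ip x y = ip y x.
Hypothesis ipD : forall x y z, ip (x + y) z = ip x z + ip y z.
Hypothesis ipZ : forall a x y, ip (a *: x) y = a * ip x y.
Hypothesis ip_ge0 : forall x, 0 <= ip x x.
Implicit Types (x y z h : H).

Lemma ipN x y : ip (- x) y = - ip x y.
Proof. by rewrite -scaleN1r ipZ mulN1r. Qed.

Lemma ipB x y z : ip (x - y) z = ip x z - ip y z.
Proof. by rewrite ipD ipN. Qed.

Lemma ipDr x y z : ip z (x + y) = ip z x + ip z y.
Proof. by rewrite ipC ipD ![ip _ z]ipC. Qed.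

Lemma ipZr a x y : ip y (a *: x) = a * ip y x.
Proof. by rewrite ipC ipZ ipC. Qed.

Lemma ipBr x y z : ip z (x - y) = ip z x - ip z y.
Proof. by rewrite ipC ipB ![ip _ z]ipC. Qed.

Lemma ipNr x y : ip y (- x) = - ip y x.
Proof. by rewrite ipC ipN ipC. Qed.

Definition ipE := (ipD, ipDr, ipN, ipNr, ipZ, ipZr).

Definition nrm x := Num.sqrt (ip x x).

Lemma nrm_ge0 x : 0 <= nrm x. Proof. exact: sqrtr_ge0. Qed.

Lemma nrm_sqr x : nrm x ^+ 2 = ip x x. Proof. by rewrite sqr_sqrtr. Qed.

(** A nonnegative quadratic polynomial in t has nonpositive discriminant; the
    degenerate case c = 0 has to be treated separately. *)
Lemma discriminant (a b c : R) : 0 <= c ->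
  (forall t, 0 <= a - 2 * t * b + t ^+ 2 * c) -> b ^+ 2 <= a * c.
Proof.
rewrite le_eqVlt => /predU1P[<-|c0] h.
  have [->|b0] := eqVneq b 0; first by rewrite expr0n mulr0.
  have := h ((a + 1) / (2 * b)).
  rewrite (_ : a - _ + _ = -1); last by field.
  by rewrite ler0N1.
have := h (b / c); rewrite (_ : a - _ + _ = (a * c - b ^+ 2) / c); last first.
  by field; rewrite gt_eqF.
by rewrite pmulr_lge0 ?invr_gt0// subr_ge0.
Qed.

(** If x is within e of being a shortest vector of the line x + R y, then it is
    nearly orthogonal to y; for e = |x| this is the Cauchy-Schwarz inequality.
    *)
Lemma almost_orthogonal (e : R) x y : 0 <= e ->
  (forall t, ip x x - e ^+ 2 <= ip (x - t *: y) (x - t *: y)) -> `|ip x y| <= e * nrm y.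
Proof.
move=> e0 h; rewrite -[leRHS]ger0_norm ?mulr_ge0 ?nrm_ge0// -ler_sqr ?nnegrE//.
rewrite !real_normK ?num_real// exprMn nrm_sqr; apply: discriminant => // t.
have := h t; rewrite !ipE (ipC y x); lra.
Qed.

Lemma ip_le x y : `|ip x y| <= nrm x * nrm y.
Proof. by apply: almost_orthogonal => [|t]; rewrite ?nrm_ge0// nrm_sqr subrr. Qed.

Lemma nrm_triangle x y : nrm (x + y) <= nrm x + nrm y.
Proof.
rewrite -ler_sqr ?nnegrE ?nrm_ge0 ?addr_ge0 ?nrm_ge0// sqrrD !nrm_sqr !ipE (ipC y x).
have := le_trans (ler_norm _) (ip_le x y); rewrite mulr2n; lra.
Qed.

Lemma nrmZ a x : nrm (a *: x) = `|a| * nrm x.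
Proof. by rewrite /nrm !ipE mulrA -expr2 sqrtrM ?sqr_ge0// sqrtr_sqr. Qed.

Lemma nrm_le (M : R) x : ip x x <= M -> nrm x <= Num.sqrt M.
Proof. by move=> h; exact: ler_wsqrtr. Qed.

Hypothesis complete : forall x_ : nat -> H,
  (forall n, nrm (x_ n.+1 - x_ n) <= 3^-1 ^+ n) ->
  exists x, forall n, nrm (x_ n - x) <= 3 / 2 * 3^-1 ^+ n.

(** A gliding hump: along a subfamily with |G_k| > (k + 1) 3^k one adds to x
    the vector of length 3^(-k) in the direction of G_k, with the sign that
    does not decrease the pairing of G_k with x. The later corrections have
    total length at most half of 3^(-k), so that the pairing of G_k with the
    limit is at least (k + 1)/2. *)
Lemma uniform_boundedness (g_ : nat -> H) :
  (forall x, exists B, forall n, `|ip (g_ n) x| <= B) ->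
  exists B, forall n, ip (g_ n) (g_ n) <= B.
Proof.
move=> bnd; apply: contrapT => /forallNP unb.
have ex k : exists n, k.+1%:R * 3 ^+ k < nrm (g_ n).
  apply: contrapT => /forallNP hk; apply: (unb ((k.+1%:R * 3 ^+ k) ^+ 2)) => n.
  rewrite -nrm_sqr lerXn2r// ?nnegrE ?nrm_ge0 ?mulr_ge0 ?exprn_ge0//.
  by rewrite leNgt; apply/negP/hk.
have {ex} [phi phiP] := choice ex.
pose G k := g_ (phi k).
(* the sign is chosen so that the pairing of G k with x does not decrease in
   absolute value *)
pose step k x := x + (((if 0 <= ip (G k) x then 1 else -1) * 3^-1 ^+ k / nrm (G k)) *: G k).
pose x_ := fix F k := if k is j.+1 then step j (F j) else 0.
have nG k : 0 < nrm (G k).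
  by apply: le_lt_trans (phiP k); rewrite mulr_ge0 ?exprn_ge0.
have p3 k : 0 <= 3^-1 ^+ k :> R by rewrite exprn_ge0.
have [|x hx] := complete (x_ := x_).
  move=> k; rewrite /= /step addrC addKr nrmZ !normrM (ger0_norm (p3 k)) normfV.
  rewrite (ger0_norm (nrm_ge0 _)) mulrVK ?unitfE ?gt_eqF//.
  by case: ifP => _; rewrite ?normrN normr1 mul1r.
have big k : 3^-1 ^+ k * nrm (G k) <= `|ip (G k) (x_ k.+1)|.
  have p : 0 <= 3^-1 ^+ k * nrm (G k) by rewrite mulr_ge0 ?nrm_ge0.
  have eZ (s : R) : s * 3^-1 ^+ k / nrm (G k) * ip (G k) (G k) = s * (3^-1 ^+ k * nrm (G k)).
    by rewrite -nrm_sqr; field; rewrite gt_eqF.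
  rewrite /= /step !ipE eZ; case: ifPn => [|]; rewrite -?ltNge => i0.
    by rewrite mul1r ger0_norm ?addr_ge0// lerDr.
  by rewrite mulN1r ltr0_norm; lra.
have [B hB] := bnd x.
have low k : k.+1%:R / 2 <= B.
  have h1 := hB (phi k); rewrite -/(G k) in h1.
  have h2 := le_trans (ip_le (G k) (x_ k.+1 - x)) (ler_wpM2l (nrm_ge0 _) (hx k.+1)).
  have h3 := big k; have h4 := phiP k; rewrite -/(G k) in h4.
  have h5 : `|ip (G k) (x_ k.+1)| <= `|ip (G k) x| + `|ip (G k) (x_ k.+1 - x)|.
    by apply: le_trans (ler_normD _ _); rewrite ipBr addrCA subrr addr0.
  have E1 : nrm (G k) * (3 / 2 * 3^-1 ^+ k.+1) = 3^-1 ^+ k * nrm (G k) / 2.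
    by rewrite exprS; field.
  rewrite E1 in h2.
  have h6 : k.+1%:R <= 3^-1 ^+ k * nrm (G k).
    by rewrite exprVn mulrC ler_pdivlMr ?exprn_gt0// ltW.
  lra.
have [n Bn] : exists n : nat, 2 * B < n%:R.
  exists (Num.Def.archi_bound (2 * B)); apply: archi_boundP.
  by have := low 0; lra.
have := low n; rewrite -natr1; lra.
Qed.

Section weak_compactness.
Variables (f_ : nat -> H) (M : R).
Hypothesis bf : forall n, ip (f_ n) (f_ n) <= M.

(** The epsilon form of convergence, convenient for the explicit estimates
    below. *)
Definition tends (u : nat -> R) (l : R) : Prop :=
  forall e, 0 < e -> exists N, forall n, (N <= n)%N -> `|u n - l| <= e.

(** An ultrafilter finer than the cofinite filter gives limits of all the
    bounded sequences at once; since its members are closed under finite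
    intersections, one can choose phi n >= n to be within 1/(n+1) of the first
    n + 1 limits. *)
Lemma diagonal_extraction : exists (phi : nat -> nat) (l : nat -> R),
  (forall n, (n <= phi n)%N) /\ forall m, tends (fun n => ip (f_ m) (f_ (phi n))) (l m).
Proof.
have [U [UU sU]] := @ultraFilterLemma nat \oo _.
have lim m : exists l : R, ip (f_ m) (f_ n) @[n --> U] --> l.
  have nf n : nrm (f_ n) <= Num.sqrt M by exact: nrm_le.
  pose S := `[- (Num.sqrt M * Num.sqrt M), Num.sqrt M * Num.sqrt M]%classic : set R.
  have cS : compact S by exact: segment_compact.
  have US : (ip (f_ m) (f_ n) @[n --> U]) S.
    apply: (@filterS _ U _ setT); last exact: filterT.
    move=> n _; rewrite /S /= in_itv /= -ler_norml.
    by apply: le_trans (ip_le _ _) _; apply: ler_pM; rewrite ?nrm_ge0.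
  have [l [_ hl]] := cS _ _ US; exists l => V Vl.
  have [//|UC] := in_ultra_setVsetC ((fun n => ip (f_ m) (f_ n)) @^-1` V) UU.
  have [y [Cy Vy]] := hl (~` V) V UC Vl.
  by case: Cy.
have {lim} [l lP] := choice lim.
have ex n : exists k, (n <= k)%N /\
    forall m, (m <= n)%N -> `|ip (f_ m) (f_ k) - l m| <= n.+1%:R^-1.
  have e0 : 0 < n.+1%:R^-1 :> R by rewrite invr_gt0.
  have Um m : U [set k | `|ip (f_ m) (f_ k) - l m| <= n.+1%:R^-1].
    move: (lP m) => /cvgrPdist_le /(_ _ e0); apply: filterS => k /=.
    by rewrite distrC.
  have Uall : U [set k | forall m, (m <= n)%N -> `|ip (f_ m) (f_ k) - l m| <= n.+1%:R^-1].
    have : forall b, U [set k | forall m, (m < b)%N -> `|ip (f_ m) (f_ k) - l m| <= n.+1%:R^-1].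
      elim=> [|b IH]; first by apply: (@filterS _ U _ setT) => //; exact: filterT.
      apply: (filterS _ (filterI IH (Um b))) => k [h1 h2] m.
      by rewrite ltnS leq_eqVlt => /predU1P[->|/h1].
    by move=> /(_ n.+1).
  have Un : U [set k | (n <= k)%N] by apply: sU; exists n.
  have [k [h1 h2]] := filter_ex (filterI Un Uall).
  by exists k.
have {ex} [phi phiP] := choice ex.
exists phi, l; split => [n|m e e0]; first exact: (phiP n).1.
have [N0 _ /(_ N0 (leqnn N0)) hN] := near_infty_natSinv_lt (PosNum e0).
exists (maxn m N0) => n; rewrite geq_max => /andP[mn Nn].
apply: le_trans ((phiP n).2 m mn) _; apply: le_trans (ltW hN).
by rewrite lef_pV2 ?posrE// ler_nat.
Qed.

(** Iterated midpoints suffice in place of all convex combinations. *)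
Inductive tail_hull (g : nat -> H) (n : nat) : H -> Prop :=
| Tail_point k of (n <= k)%N : tail_hull g n (g k)
| Tail_midpoint x y of tail_hull g n x & tail_hull g n y :
    tail_hull g n (2^-1 *: (x + y)).

Inductive spanned (g : nat -> H) : H -> Prop :=
| Spanned_point k : spanned g (g k)
| Spanned_add x y of spanned g x & spanned g y : spanned g (x + y)
| Spanned_scale a x of spanned g x : spanned g (a *: x).

Lemma tail_hull_mono g n n' x : (n <= n')%N -> tail_hull g n' x -> tail_hull g n x.
Proof.
move=> nn'; elim=> [k nk|y z _ IHy _ IHz]; last exact: Tail_midpoint.
by apply: Tail_point; exact: leq_trans nk.
Qed.

Lemma ip_midpoint x y :
  ip (2^-1 *: (x + y)) (2^-1 *: (x + y)) =
  (ip x x + ip y y) / 2 - ip (x - y) (x - y) / 4.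
Proof. by rewrite !ipE (ipC y x); field. Qed.

Lemma tail_hull_le g n x : (forall n, ip (g n) (g n) <= M) -> tail_hull g n x -> ip x x <= M.
Proof.
move=> bg; elim=> [//|y z _ IHy _ IHz].
by rewrite ip_midpoint; have := ip_ge0 (y - z); lra.
Qed.

Lemma tail_hull_tends g n x h l e : (forall k, (n <= k)%N -> `|ip (g k) h - l| <= e) ->
  tail_hull g n x -> `|ip x h - l| <= e.
Proof.
move=> hg; elim=> [//|y z _ + _]; rewrite !ipE !ler_norml => /andP[a1 a2] /andP[b1 b2].
by apply/andP; split; lra.
Qed.

Lemma tail_hull_spanned (phi : nat -> nat) n x :
  tail_hull (fun k => f_ (phi k)) n x -> spanned f_ x.
Proof.
elim=> [k _|y z _ sy _ sz]; first exact: Spanned_point.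
by apply: Spanned_scale; exact: Spanned_add.
Qed.

(** The infimum of the squared norm over the n-th tail increases with n to a
    finite limit. Near-minimizers far out have midpoints that still belong to
    an earlier tail, so the parallelogram law makes their distance small;
    taking errors of order 9^(-j) gives a fast Cauchy sequence. *)
Lemma tail_hull_limit g : (forall n, ip (g n) (g n) <= M) ->
  exists (y_ : nat -> H) (y : H),
    forall j, tail_hull g j (y_ j) /\ nrm (y_ j - y) <= 3 / 2 * 3^-1 ^+ j.
Proof.
move=> bg; pose S n := [set ip x x | x in tail_hull g n].
have S0 n : S n !=set0 by exists (ip (g n) (g n)); exists (g n) => //; exact: Tail_point.
have Slb n : has_lbound (S n) by exists 0 => _ [x _ <-].
have Sinf n : has_inf (S n) by split.
pose dd n := inf (S n).
have dle n x : tail_hull g n x -> dd n <= ip x x.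
  by move=> tx; apply: ge_inf => //; exists x.
have dmono n n' : (n <= n')%N -> dd n <= dd n'.
  move=> nn'; apply: lb_le_inf => // _ [x tx <-]; apply: dle.
  exact: tail_hull_mono tx.
have dM n : dd n <= M by apply: le_trans (bg n); apply: dle; exact: Tail_point.
have rsup : has_sup (range dd) by split; [exists (dd 0); exists 0|exists M => _ [n _ <-]].
pose D := sup (range dd).
have dD n : dd n <= D by apply: sup_upper_bound => //; exists n.
pose delta j : R := 9^-1 ^+ j / 8.
have delta0 j : 0 < delta j by rewrite divr_gt0// exprn_gt0.
have exN j : exists N, D - delta j < dd N.
  by have [_ [N _ <-] hN] := sup_adherent (delta0 j) rsup; exists N.
have {exN} [Nx NxP] := choice exN.
(* a nondecreasing sequence of tails with N' j >= j and N' j >= Nx j *)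
pose N' j := (\sum_(i < j.+1) Nx i + j)%N.
have N'j j : (j <= N' j)%N by rewrite leq_addl.
have NxN' j : (Nx j <= N' j)%N by rewrite /N' big_ord_recr /= -addnA addnCA leq_addr.
have N'S j : (N' j <= N' j.+1)%N.
  by rewrite /N' [X in (_ <= X + _)%N]big_ord_recr /= leq_add// leq_addr.
have dN' j : D - delta j < dd (N' j) by apply: lt_le_trans (NxP j) _; exact: dmono.
have exy j : exists y, tail_hull g (N' j) y /\ ip y y < D + delta j.
  have [_ [y ty <-] hy] := inf_adherent (delta0 j) (Sinf (N' j)).
  by exists y; split => //; apply: lt_le_trans hy _; rewrite lerD2r; exact: dD.
have {exy} [y_ yP] := choice exy.
have [|y hy] := complete (x_ := y_).
  move=> j; rewrite -ler_sqr ?nnegrE ?nrm_ge0 ?exprn_ge0// nrm_sqr.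
  have [t1 b1] := yP j; have [t2 b2] := yP j.+1.
  have := dle _ _ (Tail_midpoint (tail_hull_mono (N'S j) t2) t1).
  have := dN' j; rewrite ip_midpoint.
  have -> : (3^-1 ^+ j) ^+ 2 = 8 * delta j.
    have e9 : 3^-1 ^+ 2 = 9^-1 :> R by rewrite exprVn; congr (_^-1); ring.
    by rewrite /delta -exprM mulnC exprM e9 mulrC divfK// pnatr_eq0.
  have : delta j.+1 <= delta j.
    have p : 0 <= 9^-1 ^+ j :> R by rewrite exprn_ge0.
    by rewrite /delta exprS; lra.
  lra.
exists y_, y => j; split; last exact: hy.
exact: tail_hull_mono (yP j).1.
Qed.

Lemma tends_geometric (e : R) : 0 < e -> exists j : nat, 3 / 2 * 3^-1 ^+ j <= e.
Proof.
move=> e0; have h : (3 / 2 * 3^-1 ^+ j : R) @[j --> \oo] --> (0 : R).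
  rewrite -[X in _ --> X](mulr0 (3 / 2)); apply: cvgM; first exact: cvg_cst.
  by apply: cvg_expr; rewrite ger0_norm// invf_lt1//; lra.
move/cvgrPdist_le : h => /(_ _ e0)[n _ /(_ n (leqnn n))].
by rewrite sub0r normrN ger0_norm; [exists n|rewrite mulr_ge0 ?exprn_ge0//; lra].
Qed.

(** The limit f of near-minimizers of the tails has the right inner products
    with all vectors spanned by the sequence. A general h is split as s + (h -
    s) with s in the span nearly closest to h; then h - s is nearly orthogonal
    to the whole sequence and to f. This avoids both the orthogonal projection
    and the representation theorem. *)
Lemma weak_compactness : exists (phi : nat -> nat) (f : H),
  [/\ forall n, (n <= phi n)%N, ip f f <= M &
      forall h, tends (fun n => ip (f_ (phi n)) h) (ip f h)].
Proof.
have [phi [l [phin lP]]] := diagonal_extraction.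
pose g n := f_ (phi n).
have bg n : ip (g n) (g n) <= M by exact: bf.
have [y_ [f yP]] := tail_hull_limit bg.
have M0 : 0 <= M by exact: le_trans (ip_ge0 _) (bf 0).
pose K := Num.sqrt M; have K0 : 0 <= K by exact: sqrtr_ge0.
have nf : nrm f <= K.
  apply/ler_addgt0Pr => e e0; have [j hj] := tends_geometric e0.
  have [tj nj] := yP j; rewrite -(subKr (y_ j) f).
  apply: le_trans (nrm_triangle _ _) _; apply: lerD.
    by apply: nrm_le; exact: tail_hull_le bg tj.
  by rewrite -scaleN1r nrmZ normrN1 mul1r; exact: le_trans hj.
have ff : ip f f <= M.
  by rewrite -nrm_sqr -[leRHS]sqr_sqrtr// lerXn2r// ?nnegrE ?nrm_ge0.
exists phi, f; split => //.
have spanl s : spanned f_ s -> exists L, tends (fun n => ip (g n) s) L.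
  elim=> [m|x y _ [L1 h1] _ [L2 h2]|a x _ [L h]].
  - exists (l m) => e e0; have [N hN] := lP m _ e0.
    by exists N => n /hN; rewrite ipC.
  - exists (L1 + L2) => e e0; have e2 : 0 < e / 2 by lra.
    have [N1 k1] := h1 _ e2; have [N2 k2] := h2 _ e2.
    exists (maxn N1 N2) => n; rewrite geq_max => /andP[/k1 + /k2].
    rewrite ipDr !ler_norml => /andP[a1 a2] /andP[b1 b2].
    by apply/andP; split; lra.
  - exists (a * L) => e e0; have a0 : 0 < `|a| + 1 by rewrite ltr_wpDl.
    have [|N hN] := h (e / (`|a| + 1)); first by rewrite divr_gt0.
    exists N => n /hN; rewrite ipZr -mulrBr normrM => hn.
    apply: le_trans (ler_wpM2l (normr_ge0 _) hn) _.
    by rewrite mulrC; exact: ler_div_add1 (ltW e0) (normr_ge0 _).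
have spanf s : spanned f_ s -> tends (fun n => ip (g n) s) (ip f s).
  move=> ss; have [L hL] := spanl s ss.
  suff -> : ip f s = L by [].
  apply/eqP; rewrite -subr_eq0 -normr_le0; apply/ler_addgt0Pr => e e0; rewrite add0r.
  have e2 : 0 < e / 2 by lra.
  have [N hN] := hL _ e2.
  have p0 : 0 < nrm s + 1 by rewrite ltr_wpDl ?nrm_ge0.
  have e3 : 0 < e / 2 / (nrm s + 1) by rewrite divr_gt0.
  have [j0 hj0] := tends_geometric e3.
  pose j := maxn N j0.
  have hj : 3 / 2 * 3^-1 ^+ j <= e / 2 / (nrm s + 1).
    apply: le_trans hj0; apply: ler_wpM2l; first lra.
    by apply: ler_wiXn2l; [lra|lra|exact: leq_maxr].
  have [tj nj] := yP j.
  have h1 : `|ip (y_ j) s - L| <= e / 2.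
    apply: (tail_hull_tends _ tj) => k jk; apply: hN.
    by apply: leq_trans jk; rewrite leq_maxl.
  have h2 : `|ip (y_ j - f) s| <= e / 2.
    apply: le_trans (ip_le _ _) _.
    apply: le_trans (ler_wpM2r (nrm_ge0 _) (le_trans nj hj)) _.
    exact: ler_div_add1 (ltW e2) (nrm_ge0 _).
  have -> : ip f s - L = (ip (y_ j) s - L) - ip (y_ j - f) s by rewrite !ipE; ring.
  by apply: le_trans (ler_normB _ _) _; lra.
move=> h e e0.
pose S := [set ip (h - s) (h - s) | s in spanned f_].
have Sinf : has_inf S.
  by split; [exists (ip (h - f_ 0) (h - f_ 0)); exists (f_ 0) => //; exact: Spanned_point
            |exists 0 => _ [s _ <-]].
have q0 : 0 < K + 1 by lra.
pose eps := e / 4 / (K + 1).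
have eps0 : 0 < eps by rewrite !divr_gt0.
have epsK : eps * (K + 1) = e / 4 by rewrite /eps divfK// gt_eqF.
have [_ [s ss <-] hs] := inf_adherent (exprn_gt0 2 eps0) Sinf.
have ortho x : spanned f_ x -> `|ip (h - s) x| <= eps * nrm x.
  move=> sx; apply: almost_orthogonal => [|t]; first exact: ltW.
  rewrite lerBlDr; apply: le_trans (ltW hs) _; rewrite lerD2r.
  apply: ge_inf; first exact: Sinf.2.
  exists (s + t *: x); first by apply: Spanned_add => //; exact: Spanned_scale.
  by rewrite opprD addrA.
have orthof : `|ip (h - s) f| <= e / 4.
  apply/ler_addgt0Pr => e' e'0.
  have p0 : 0 < nrm (h - s) + 1 by rewrite ltr_wpDl ?nrm_ge0.
  have e3 : 0 < e' / (nrm (h - s) + 1) by rewrite divr_gt0.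
  have [j hj] := tends_geometric e3; have [tj nj] := yP j.
  rewrite -(subKr (y_ j) f) ipBr; apply: le_trans (ler_normB _ _) _; apply: lerD.
    apply: le_trans (ortho _ (tail_hull_spanned tj)) _; rewrite -epsK.
    rewrite ler_wpM2l ?(ltW eps0)//.
    have := nrm_le (tail_hull_le bg tj); rewrite -/K; lra.
  apply: le_trans (ip_le _ _) _.
  apply: le_trans (ler_wpM2l (nrm_ge0 _) (le_trans nj hj)) _.
  by rewrite mulrC; exact: ler_div_add1 (ltW e'0) (nrm_ge0 _).
have e4 : 0 < e / 4 by lra.
have [N hN] := spanf s ss _ e4; exists N => n /hN h1.
have h2 : `|ip (h - s) (g n)| <= e / 4.
  apply: le_trans (ortho _ (Spanned_point _ _)) _; rewrite -epsK.
  rewrite ler_wpM2l ?(ltW eps0)//.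
  by have := nrm_le (bg n); rewrite -/K; lra.
have -> : ip (f_ (phi n)) h - ip f h =
    (ip (g n) s - ip f s) + ip (h - s) (g n) - ip (h - s) f.
  by rewrite /g !ipE (ipC h) (ipC s) (ipC h f) (ipC s f); ring.
apply: le_trans (ler_normB _ _) _.
by apply: le_trans (lerD (ler_normD _ _) (lexx _)) _; lra.
Qed.

End weak_compactness.

End pre_hilbert.

(** * L^2 as a Hilbert space *)

Lemma fast_cauchy_cvg (R : realType) (a : nat -> R) (K : R) :
  (forall n, `|a n.+1 - a n| <= K * 2^-1 ^+ n) -> cvgn a.
Proof.
move=> ha; pose u k := a k.+1 - a k.
have K0 : 0 <= K by have := ha 0; rewrite expr0 mulr1; exact: le_trans.
have cu : cvgn (series u).
  apply: normed_cvg; apply: (@series_le_cvg _ _ (geometric K 2^-1)).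
  - by move=> n; exact: normr_ge0.
  - by move=> n; rewrite /= mulr_ge0// exprn_ge0.
  - exact: ha.
  - by apply: is_cvg_geometric_series; rewrite ger0_norm; lra.
have -> : a = (fun n => a 0 + series u n).
  apply/funext => n; rewrite /series /= /u telescope_sumr//; ring.
by apply: is_cvgD => //; exact: is_cvg_cst.
Qed.

Section L2_complete.
Context {disp} {T : measurableType disp} {R : realType}.
Variable mu : {measure set T -> \bar R}.
Variable x_ : nat -> T -> R[i].
Hypothesis mx : forall n, cmeas (x_ n).
Hypothesis fast : forall n, L2le mu (9^-1 ^+ n) (fun w => x_ n.+1 w - x_ n w).
Hypothesis cauchy : forall n m, (n <= m)%N ->
  L2le mu (9 / 4 * 9^-1 ^+ n) (fun w => x_ n w - x_ m w).

Let h n w := (4 ^+ n * nc (x_ n.+1 w - x_ n w) ^+ 2)%:E.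

(** The series of 4^n |x_(n+1) - x_n|^2 has a finite integral, so it converges
    almost everywhere and its terms are bounded. *)
Lemma ae_fast_cauchy : {ae mu, forall w, exists K, forall n,
  nc (x_ n.+1 w - x_ n w) <= K * 2^-1 ^+ n}.
Proof.
have h0 n w : (0 <= h n w)%E by rewrite lee_fin mulr_ge0 ?exprn_ge0 ?nc_ge0.
have mh n : measurable_fun setT (h n).
  rewrite /h; under eq_fun do rewrite EFinM.
  by apply: (emeasurable_funM (measurable_cst _)); exact: measurable_nc2E (fast n).1.
have ih n : (\int[mu]_w h n w <= ((4 / 9) ^+ n)%:E)%E.
  rewrite /h; under eq_integral do rewrite EFinM.
  rewrite ge0_integralZl; [|exact: measurableT|exact: measurable_nc2E (fast n).1
    |by move=> w _; rewrite lee_fin sqr_ge0|by rewrite lee_fin exprn_ge0].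
  rewrite exprMn EFinM; apply: lee_wpmul2l; first by rewrite lee_fin exprn_ge0.
  exact: (fast n).2.
have geo n : \sum_(0 <= k < n) (4 / 9) ^+ k <= 9 / 5 :> R.
  have -> : \sum_(0 <= k < n) (4 / 9) ^+ k = 9 / 5 * (1 - (4 / 9) ^+ n) :> R.
    elim: n => [|n IH]; first by rewrite big_nil expr0 subrr mulr0.
    by rewrite big_nat_recr//= IH exprS; field.
  have : 0 <= (4 / 9) ^+ n :> R by rewrite exprn_ge0//; lra.
  lra.
have ae1 : {ae mu, forall w, (\sum_(k <oo) h k w < +oo)%E}.
  apply: ae_ltey.
  - by apply: ge0_emeasurable_sum => //.
  - by move=> w; exact: nneseries_ge0.
  - rewrite integral_nneseries//; apply: (@le_lt_trans _ _ (9 / 5 : R)%:E); last by rewrite ltry.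
    apply: lime_le; first by apply: is_cvg_nneseries => n _ _; exact: integral_ge0.
    apply: nearW => n; apply: (@le_trans _ _ (\sum_(0 <= k < n) ((4 / 9) ^+ k)%:E)%E).
      by apply: lee_sum => k _; exact: ih.
    by rewrite sumEFin lee_fin.
apply: (ae_imp ae1) => w hw; pose C := fine (\sum_(k <oo) h k w)%E.
have CE : (\sum_(k <oo) h k w)%E = C%:E.
  by rewrite fineK// ge0_fin_numE//; exact: nneseries_ge0.
exists (Num.sqrt C) => n.
have : (h n w <= C%:E)%E.
  rewrite -CE; apply: le_trans (nneseries_lim_ge n.+1 (fun k _ _ => h0 k w)).
  rewrite big_nat_recr//= leeDr//; exact: sume_ge0.
rewrite lee_fin => hn.
have -> : nc (x_ n.+1 w - x_ n w) = Num.sqrt (4 ^+ n * nc (x_ n.+1 w - x_ n w) ^+ 2) * 2^-1 ^+ n.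
  have -> : 4 ^+ n = (2 ^+ n) ^+ 2 :> R by rewrite -exprM mulnC exprM; congr (_ ^+ _); ring.
  rewrite -exprMn sqrtr_sqr ger0_norm ?mulr_ge0 ?exprn_ge0 ?nc_ge0//.
  by rewrite exprVn mulrAC mulfV ?mul1r// expf_neq0.
by rewrite ler_wpM2r ?exprn_ge0// ler_wsqrtr.
Qed.

(** The upper limit is measurable everywhere and equals the limit wherever the
    latter exists. *)
Definition fast_limit (w : T) : R[i] :=
  (fine (limn_esup (fun n => (complex.Re (x_ n w))%:E)) +i*
   fine (limn_esup (fun n => (complex.Im (x_ n w))%:E)))%C.

Lemma cmeas_fast_limit : cmeas fast_limit.
Proof.
by split => /=; apply: measurableT_comp => //; apply: measurable_fun_limn_esup => n;
  apply/measurable_EFinP; have [] := mx n.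
Qed.

Lemma fast_limitP : {ae mu, forall w,
  complex.Re (x_ n w) @[n --> \oo] --> complex.Re (fast_limit w) /\
  complex.Im (x_ n w) @[n --> \oo] --> complex.Im (fast_limit w)}.
Proof.
have lim (a : nat -> R) : cvgn a -> a n @[n --> \oo] --> fine (limn_esup (fun n => (a n)%:E)).
  move=> ca.
  have H : (a n)%:E @[n --> \oo] --> (limn a)%:E by apply: cvg_EFin => //; exact: nearW.
  by have [_ ->] := cvg_limn_einf_sup H.
apply: (ae_imp ae_fast_cauchy) => w [K hK]; split; apply: lim;
  apply: (@fast_cauchy_cvg _ _ K) => n; apply: le_trans (hK n).
  by rewrite -ReN -ReD; exact: le_Re_nc.
by rewrite -ImN -ImD; exact: le_Im_nc.
Qed.

(** Fatou's lemma applied to |x_n - x_m|^2 as m tends to infinity. *)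
Lemma L2_complete : cmeas fast_limit /\
  forall n, L2le mu (9 / 4 * 9^-1 ^+ n) (fun w => x_ n w - fast_limit w).
Proof.
have ml := cmeas_fast_limit; split => // n.
have md := cmeasB (mx n) ml; split => //.
apply: (@fatou_bound _ _ _ mu (fun m w => (nc (x_ n w - x_ (n + m)%N w) ^+ 2)%:E)).
- by move=> m; apply: measurable_nc2E; exact: cmeasB.
- by move=> m w; rewrite lee_fin sqr_ge0.
- exact: measurable_nc2E.
- by move=> w; rewrite lee_fin sqr_ge0.
- apply: (ae_imp fast_limitP) => w [h1 h2].
  apply: cvg_EFin; first exact: nearW.
  have sq (z : R[i]) : nc z ^+ 2 = complex.Re z * complex.Re z + complex.Im z * complex.Im z.
    by rewrite nc_sqr -!expr2.
  rewrite sq; under eq_fun do rewrite /= sq.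
  have sh (a : nat -> R) l : a k @[k --> \oo] --> l -> a (n + k)%N @[k --> \oo] --> l.
    by move=> ha; exact: (cvg_comp _ _ (cvg_addnl n) ha).
  have c1 : complex.Re (x_ n w - x_ (n + k)%N w) @[k --> \oo] --> complex.Re (x_ n w - fast_limit w).
    by rewrite ReD ReN; under eq_fun do rewrite ReD ReN; apply: cvgB; [exact: cvg_cst|exact: sh h1].
  have c2 : complex.Im (x_ n w - x_ (n + k)%N w) @[k --> \oo] --> complex.Im (x_ n w - fast_limit w).
    by rewrite ImD ImN; under eq_fun do rewrite ImD ImN; apply: cvgB; [exact: cvg_cst|exact: sh h2].
  by apply: cvgD; apply: cvgM.
- by move=> m; exact: (cauchy (leq_addr m n)).2.
Qed.

End L2_complete.

Section L2_module.
Context {disp} {T : measurableType disp} {R : realType}.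
Variable mu : {measure set T -> \bar R}.

Lemma realZE (a : R) (z : Rcomplex R) : (a *: z : Rcomplex R) = (a%:C)%C * (z : R[i]).
Proof. by case: z => x y; apply: complex_eqP; rewrite /= mul0r ?subr0 ?addr0. Qed.

Definition square_integrable : {pred (T -> Rcomplex R)} := fun f => `[< exists N, L2le mu N f >].

Lemma square_integrableP (f : T -> R[i]) : reflect (exists N, L2le mu N f) ((f : T -> Rcomplex R) \in square_integrable).
Proof. by apply: (iffP idP) => h; apply/asboolP. Qed.

Lemma square_integrable_submod : submod_closed square_integrable.
Proof.
split.
  apply/square_integrableP; exists 0; split; first exact: (cmeas_cst 0).
  by rewrite integral0_eq// => x _; rewrite [X in nc X]/= nc0 expr0n.
move=> a f g /square_integrableP[N Lf] /square_integrableP[M Lg].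
have mf := Lf.1; have mg := Lg.1.
have m : cmeas (fun x => (a%:C)%C * f x + g x).
  by apply: cmeasD => //; apply: cmeasM => //; exact: cmeas_cst.
have LZ : L2le mu (a ^+ 2 * N) (fun x => (a%:C)%C * f x).
  split; first by apply: cmeasM => //; exact: cmeas_cst.
  under eq_integral do rewrite Normc.normcM nc_real exprMn real_normK ?num_real// EFinM.
  rewrite ge0_integralZl; [|exact: measurableT|exact: measurable_nc2E
    |by move=> x _; rewrite lee_fin sqr_ge0|by rewrite lee_fin sqr_ge0].
  by rewrite [X in (_ <= X)%E]EFinM; apply: lee_wpmul2l; [rewrite lee_fin sqr_ge0|exact: Lf.2].
have mono (L L' : R) (k : T -> R[i]) : L <= L' -> L2le mu L k -> L2le mu L' k.
  by move=> LL' [mk bk]; split => //; apply: le_trans bk _; rewrite lee_fin.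
have LgN : L2le mu M (fun x => - g x).
  split; first exact: cmeasN.
  by under eq_integral do rewrite ncN; exact: Lg.2.
apply/square_integrableP; exists (4 * Num.max (a ^+ 2 * N) M).
have := L2leB (mono _ _ _ _ LZ) (mono _ _ _ _ LgN).
move=> /(_ (Num.max (a ^+ 2 * N) M)); rewrite !le_max !lexx orbT => /(_ isT isT).
rewrite (_ : (fun x => _ - - g x) = a *: f + g)//.
by apply/funext => x; rewrite opprK; congr (_ + _); rewrite -realZE.
Qed.

HB.instance Definition _ := GRing.isSubmodClosed.Build R (T -> Rcomplex R) square_integrable
  square_integrable_submod.

(** Functions rather than classes: the inner product is then only semidefinite,
    which is all that the abstract arguments need, and no choice of
    representatives is involved. The module structure is over the reals. *)
Record L2_space := L2_elem { L2_fun : T -> Rcomplex R; L2_funP : L2_fun \in square_integrable }.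

(** The values are viewed in the complex numbers rather than in their copy
    carrying the real module structure. *)
Definition L2_val (f : L2_space) : T -> R[i] := L2_fun f.
Coercion L2_val : L2_space >-> Funclass.

HB.instance Definition _ := [isSub for L2_fun].
HB.instance Definition _ := [Choice of L2_space by <:].
HB.instance Definition _ := [SubChoice_isSubLmodule of L2_space by <:].

Definition L2_ip (f g : L2_space) : R :=
  complex.Re (integralC mu setT (fun x => f x * conjc (g x))).

Lemma L2_cint (f g : L2_space) : cint mu (fun x => f x * conjc (g x)).
Proof.
have /square_integrableP[N Lf] := L2_funP f; have /square_integrableP[M Lg] := L2_funP g.
exact: L2le_cint_mul Lf (L2le_conj Lg).
Qed.

Lemma L2_ipC f g : L2_ip f g = L2_ip g f.
Proof.
transitivity (complex.Re (conjc (integralC mu setT (fun x => f x * conjc (g x))))).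
  by rewrite /L2_ip; case: (integralC _ _ _).
rewrite -(intC_conj (L2_cint f g)); congr complex.Re; apply: eq_intC => x.
by rewrite conjM conjcK mulrC.
Qed.

Lemma L2_ipD f g h : L2_ip (f + g) h = L2_ip f h + L2_ip g h.
Proof.
rewrite /L2_ip -ReD -intCD; [|exact: L2_cint|exact: L2_cint].
by congr complex.Re; apply: eq_intC => x; rewrite -mulrDl.
Qed.

Lemma L2_ipZ a f h : L2_ip (a *: f) h = a * L2_ip f h.
Proof.
have -> : a * L2_ip f h = complex.Re ((a%:C)%C * integralC mu setT (fun x => f x * conjc (h x))).
  by rewrite ReM mul0r subr0.
rewrite -intCZ; last exact: L2_cint.
by congr complex.Re; apply: eq_intC => x; rewrite mulrA -realZE.
Qed.

Lemma L2_ipE (f : L2_space) : (L2_ip f f)%:E = (\int[mu]_x (nc (f x) ^+ 2)%:E)%E.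
Proof.
have /square_integrableP[N Lf] := L2_funP f.
have -> : L2_ip f f = \int[mu]_x (nc (f x) ^+ 2).
  rewrite /L2_ip -[RHS]/(complex.Re ((\int[mu]_x (nc (f x) ^+ 2))%:C)%C) -intC_real.
  by congr complex.Re; apply: eq_intC => x; rewrite mul_conj.
rewrite fineK// ge0_fin_numE; first exact: L2le_lty Lf.
by apply: integral_ge0 => x _; rewrite lee_fin sqr_ge0.
Qed.

Lemma L2_ip_ge0 f : 0 <= L2_ip f f.
Proof. by rewrite -lee_fin L2_ipE; apply: integral_ge0 => x _; rewrite lee_fin sqr_ge0. Qed.

Lemma L2_ip_le N (f : L2_space) : L2_ip f f <= N -> L2le mu N f.
Proof.
have /square_integrableP[M Lf] := L2_funP f.
by move=> h; split; [exact: Lf.1|rewrite -L2_ipE lee_fin].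
Qed.

Local Notation nrm := (nrm L2_ip).

Lemma nrm_L2le N (f : L2_space) : 0 <= N -> nrm f <= N -> L2le mu (N ^+ 2) f.
Proof.
move=> N0 h; apply: L2_ip_le; rewrite -(nrm_sqr L2_ipC L2_ip_ge0).
by rewrite lerXn2r// ?nnegrE// sqrtr_ge0.
Qed.

Lemma L2le_nrm N (f : L2_space) : 0 <= N -> L2le mu (N ^+ 2) f -> nrm f <= N.
Proof.
move=> N0 [_ h]; rewrite -[leRHS]ger0_norm// -sqrtr_sqr; apply: ler_wsqrtr.
by rewrite -lee_fin L2_ipE.
Qed.

Lemma L2_space_complete (x_ : nat -> L2_space) :
  (forall n, nrm (x_ n.+1 - x_ n) <= 3^-1 ^+ n) ->
  exists x, forall n, nrm (x_ n - x) <= 3 / 2 * 3^-1 ^+ n.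
Proof.
move=> hx; have p3 n : 0 <= 3^-1 ^+ n :> R by rewrite exprn_ge0.
have tri := nrm_triangle L2_ipC L2_ipD L2_ipZ L2_ip_ge0.
have step m n : nrm (x_ n - x_ (n + m)%N) <= 3 / 2 * (3^-1 ^+ n - 3^-1 ^+ (n + m)).
  elim: m => [|m IH].
    have -> : x_ n - x_ (n + 0)%N = 0 *: x_ n by rewrite addn0 subrr scale0r.
    by rewrite (nrmZ L2_ipC L2_ipZ) normr0 mul0r addn0 subrr mulr0.
  have -> : x_ n - x_ (n + m.+1)%N = (x_ n - x_ (n + m)%N) + (-1) *: (x_ (n + m).+1 - x_ (n + m)%N).
    by rewrite scaleN1r opprB addnS addrA subrK.
  apply: le_trans (tri _ _) _; rewrite (nrmZ L2_ipC L2_ipZ) normrN1 mul1r.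
  have := hx (n + m)%N; move: IH; rewrite addnS exprS.
  generalize (nrm (x_ n - x_ (n + m)%N)) (nrm (x_ (n + m).+1 - x_ (n + m)%N)) (3^-1 ^+ (n + m) : R)
    (3^-1 ^+ n : R) => a b c e; lra.
have e2 n : (3 / 2 * 3^-1 ^+ n) ^+ 2 = 9 / 4 * 9^-1 ^+ n :> R.
  rewrite exprMn -exprM mulnC exprM; congr (_ * _); first by field.
  by congr (_ ^+ _); rewrite exprVn; congr (_^-1); ring.
have mx n : cmeas (x_ n) by have /square_integrableP[N []] := L2_funP (x_ n).
have fast n : L2le mu (9^-1 ^+ n) (fun w => x_ n.+1 w - x_ n w).
  have -> : 9^-1 ^+ n = (3^-1 ^+ n) ^+ 2 :> R.
    rewrite -exprM mulnC exprM; congr (_ ^+ _); rewrite exprVn; congr (_^-1); ring.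
  exact: (nrm_L2le (p3 n) (hx n)).
have cauchy n m : (n <= m)%N -> L2le mu (9 / 4 * 9^-1 ^+ n) (fun w => x_ n w - x_ m w).
  move=> nm; rewrite -e2; have := step (m - n)%N n; rewrite subnKC// => h.
  apply: (@nrm_L2le _ (x_ n - x_ m)); first by have := p3 n; lra.
  by apply: le_trans h _; have := p3 m; lra.
have [ml Ll] := L2_complete mx fast cauchy.
have lim_sq : (fast_limit x_ : T -> Rcomplex R) \in square_integrable.
  have L0 : ((fun w => x_ 0 w - fast_limit x_ w) : T -> Rcomplex R) \in square_integrable.
    by apply/square_integrableP; exists (9 / 4 * 9^-1 ^+ 0).
  have -> : (fast_limit x_ : T -> Rcomplex R) =
      (L2_fun (x_ 0) - ((fun w => x_ 0 w - fast_limit x_ w) : T -> Rcomplex R)).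
    by apply/funext => w; rewrite -[RHS]/(x_ 0 w - (x_ 0 w - fast_limit x_ w)) subKr.
  by apply: rpredB => //; exact: L2_funP.
exists (L2_elem lim_sq) => n; apply: L2le_nrm; first by have := p3 n; lra.
by rewrite e2; exact: Ll.
Qed.

End L2_module.

Section L2_weak.
Context {disp} {T : measurableType disp} {R : realType}.
Variable mu : {sigma_finite_measure set T -> \bar R}.

Definition to_L2 N (f : T -> R[i]) (Lf : L2le mu N f) : L2_space mu :=
  L2_elem (introT (square_integrableP mu f) (ex_intro _ N Lf)).

Local Notation ip := (@L2_ip _ _ _ mu).
Local Notation J := ((0 +i* 1)%C : R[i]).

Lemma ncJ : nc J = 1.
Proof. by rewrite /= expr0n expr1n add0r sqrtr1. Qed.

Lemma L2le_J N (h : T -> R[i]) : L2le mu N h -> L2le mu N (fun x => J * h x).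
Proof.
by apply: L2le_bM => [|x]; [exact: cmeas_cst|rewrite ncJ].
Qed.

Lemma L2_ip_Re N (f h : T -> R[i]) (u : L2_space mu) (Lh : L2le mu N h) :
  (L2_val u = f) ->
  ip u (to_L2 (L2le_conj Lh)) = complex.Re (integralC mu setT (fun x => f x * h x)).
Proof. by move=> <-; congr complex.Re; apply: eq_intC => x; rewrite /= conjcK. Qed.

(** Multiplying the test function by i exchanges real and imaginary parts, so
    that the real inner product recovers the complex pairing. *)
Lemma L2_ip_Im N (f h : T -> R[i]) (u : L2_space mu) (Lh : L2le mu N h) :
  (L2_val u = f) ->
  ip u (to_L2 (L2le_conj (L2le_J Lh))) =
  - complex.Im (integralC mu setT (fun x => f x * h x)).
Proof.
move=> uf; rewrite (L2_ip_Re (L2le_J Lh) uf).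
have /square_integrableP[M Lf] := L2_funP u.
have iF : cint mu (fun x => f x * h x).
  by rewrite -uf; exact: L2le_cint_mul Lf Lh.
have -> : integralC mu setT (fun x => f x * (J * h x)) = J * integralC mu setT (fun x => f x * h x).
  by rewrite -intCZ//; apply: eq_intC => x; rewrite mulrCA.
by rewrite ReM mul0r mul1r sub0r.
Qed.

Lemma L2_bounded_of_weakly_bounded (f_ : nat -> T -> R[i]) :
  (forall n, exists N, L2le mu N (f_ n)) ->
  (forall M h, L2le mu M h -> exists B, forall n,
     nc (integralC mu setT (fun x => f_ n x * h x)) <= B) ->
  exists B, forall n, L2le mu B (f_ n).
Proof.
move=> /choice[N LN] hB; pose u n := to_L2 (LN n).
have [|B bB] := uniform_boundedness (@L2_ipC _ _ _ mu) (@L2_ipD _ _ _ mu) (@L2_ipZ _ _ _ mu)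
  (@L2_ip_ge0 _ _ _ mu) (@L2_space_complete _ _ _ mu) (g_ := u).
  move=> x; have /square_integrableP[M Lx] := L2_funP x.
  have [B bB] := hB _ _ (L2le_conj Lx); exists B => n.
  by apply: le_trans (bB n); exact: le_Re_nc.
by exists B => n; exact: (@L2_ip_le _ _ _ mu B (u n)).
Qed.

Lemma L2_weak_compactness N (f_ : nat -> T -> R[i]) : (forall n, L2le mu N (f_ n)) ->
  exists (phi : nat -> nat) (f : T -> R[i]),
    [/\ forall n, (n <= phi n)%N, L2le mu N f &
        weakly_null mu (fun n x => f_ (phi n) x - f x)].
Proof.
move=> Lf; pose u n := to_L2 (Lf n).
have bu n : ip (u n) (u n) <= N.
  by rewrite -lee_fin L2_ipE; exact: (Lf n).2.
have [phi [v [phin vN vc]]] := weak_compactness (@L2_ipC _ _ _ mu) (@L2_ipD _ _ _ mu)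
  (@L2_ipZ _ _ _ mu) (@L2_ip_ge0 _ _ _ mu) (@L2_space_complete _ _ _ mu) bu.
have Lv := L2_ip_le vN.
exists phi, (L2_val v); split => // M h Lh.
apply/cvgrPdist_le => e e0; have e2 : 0 < e / 2 by lra.
have [N1 h1] := vc (to_L2 (L2le_conj Lh)) _ e2.
have [N2 h2] := vc (to_L2 (L2le_conj (L2le_J Lh))) _ e2.
exists (maxn N1 N2) => // n Nn; have {Nn} : (maxn N1 N2 <= n)%N := Nn.
rewrite geq_max => /andP[/h1 k1 /h2 k2].
have uE : L2_val (u (phi n)) = f_ (phi n) by [].
rewrite !(L2_ip_Re Lh (erefl _)) uE in k1; rewrite !(L2_ip_Im Lh (erefl _)) uE in k2.
have i1 := L2le_cint_mul (Lf (phi n)) Lh; have i2 := L2le_cint_mul Lv Lh.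
rewrite (_ : integralC mu setT _ =
    integralC mu setT (fun x => f_ (phi n) x * h x) - integralC mu setT (fun x => L2_val v x * h x)); last first.
  by rewrite -intCB//; apply: eq_intC => x; rewrite mulrBl.
move: k1 k2; generalize (integralC mu setT (fun x => f_ (phi n) x * h x))
  (integralC mu setT (fun x => L2_val v x * h x)) => a b k1 k2.
rewrite sub0r normrN (ger0_norm (nc_ge0 _)).
apply: le_trans (le_nc_ReIm _) _; rewrite ReD ImD ReN ImN.
by move: k2; rewrite -opprD normrN => k2; lra.
Qed.

End L2_weak.

(** * Scaling, weakly convergent signals and a test signal *)

Section scaling.
Context {R : realType} {d : nat}.
Local Notation E := (euclidean R d).
Local Notation lam := (leb R d).
Local Notation leb2 := (prodm lam lam).
Local Notation nu := (@unit_measure R).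

Definition real_scale (c : R) (f : E -> R[i]) (x : E) : R[i] := (c%:C)%C * f x.

Lemma L2le_real_scale c N f : L2le lam N f -> L2le lam (c ^+ 2 * N) (real_scale c f).
Proof.
move=> [mf bf]; split; first by apply: cmeasM => //; exact: cmeas_cst.
under eq_integral do rewrite Normc.normcM nc_real exprMn real_normK ?num_real// EFinM.
rewrite ge0_integralZl; [|exact: measurableT|exact: measurable_nc2E
  |by move=> x _; rewrite lee_fin sqr_ge0|by rewrite lee_fin sqr_ge0].
by rewrite [X in (_ <= X)%E]EFinM; apply: lee_wpmul2l; rewrite ?lee_fin ?sqr_ge0.
Qed.

Lemma wigner_real_scale c tau f N z : tau != 0 -> tau != 1 -> L2le lam N f ->
  wigner tau (real_scale c f) z = ((c ^+ 2)%:C)%C * wigner tau f z.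
Proof.
move=> t0 t1 Lf; rewrite !wignerE /ft -intCZ; last first.
  exact: cint_ft_kernel (cint_wigner_kernel _ t0 t1 Lf).1.
apply: eq_intC => y; rewrite /wigner_kernel /real_scale conjM.
have -> : conjc ((c%:C)%C : R[i]) = (c%:C)%C by apply: complex_eqP; rewrite /= ?oppr0.
have -> : ((c ^+ 2)%:C)%C = (c%:C)%C * (c%:C)%C :> R[i] by rewrite -rmorphM expr2.
by ring.
Qed.

(** The L^2 bound for the average of |W_tau f| makes this average finite almost
    everywhere. *)
Lemma ae_cint_wigner f N : L2le lam N f ->
  {ae leb2, forall z, cint nu (fun tau => wigner tau f z)}.
Proof.
move=> Lf; have mj := cmeas_wigner_joint Lf.1.
have n2 : (2 : R) != 0 by [].
have i0 z : (0 <= \int[nu]_tau (nc (wigner tau f z))%:E)%E.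
  by apply: integral_ge0 => t _; rewrite lee_fin nc_ge0.
have h : {ae leb2, forall z, ((\int[nu]_tau (nc (wigner tau f z))%:E) `^ 2 < +oo)%E}.
  apply: ae_ltey.
  - have mi := @measurable_int_nc2 _ _ (measurableTypeR R) (E * E)%type R nu _ mj.
    exact: (measurableT_comp (measurable_poweR 2) mi).
  - by move=> z; exact: poweR_ge0.
  - apply: le_lt_trans (born_jordan_abs_Lq (lexx 2) _ Lf) _; last by rewrite ltry.
    by rewrite subrr mul0r mulr0 ltr01.
apply: (ae_imp h) => z hz; split; first exact: cmeas_wigner_tau Lf.1.
exact: lty_poweRy n2 hz.
Qed.

(** Only almost everywhere: where the integral over tau does not converge,
    linearity is not available. *)
Lemma born_jordan_real_scale c f N : L2le lam N f ->
  {ae leb2, forall z, born_jordan (real_scale c f) z = ((c ^+ 2)%:C)%C * born_jordan f z}.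
Proof.
move=> Lf; have Lc := L2le_real_scale c Lf.
apply: (ae_imp (ae_cint_wigner Lf)) => z iz.
rewrite (born_jordanE z Lc.1) (born_jordanE z Lf.1) -intCZ//.
apply: intC_ae_eq.
- exact: cmeas_wigner_tau Lc.1.
- by apply: cmeasM; [exact: cmeas_cst|exact: cmeas_wigner_tau Lf.1].
- by apply: (ae_imp ae_unit_neq) => tau [t0 t1]; exact: wigner_real_scale t0 t1 Lf.
Qed.

End scaling.

Section weak_convergence.
Context {R : realType} {d : nat}.
Local Notation E := (euclidean R d).
Local Notation lam := (leb R d).

(** A weakly convergent sequence is bounded, by the uniform boundedness
    principle. *)
Lemma weakly_converges_bounded (f_ : nat -> E -> R[i]) (f : E -> R[i]) :
  (forall n, inL2 (f_ n)) -> inL2 f -> weakly_converges f_ f ->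
  exists N, [/\ forall n, L2le lam N (f_ n), L2le lam N f &
    weakly_null lam (fun n x => f_ n x - f x)].
Proof.
move=> fn2 f2 wf.
have Lf := inL2_L2le f2; have Lfn n := inL2_L2le (fn2 n).
have pc M (h : E -> R[i]) : L2le lam M h ->
    nc (integralC lam setT (fun x => f_ n x * h x) - integralC lam setT (fun x => f x * h x))
      @[n --> \oo] --> (0 : R).
  move=> Lh; have := wf _ (L2le_inL2 (L2le_conj Lh)).
  have iE (g : E -> R[i]) : innerL2 g (fun x => conjc (h x)) = integralC lam setT (fun x => g x * h x).
    by apply: eq_intC => x; rewrite conjcK.
  move=> /cvgrPdist_le H; apply/cvgrPdist_le => e e0.
  have e0' : 0 < (e%:C)%C :> R[i] by rewrite ltcR.
  have := H _ e0'; apply: filterS => n; rewrite !iE sub0r normrN (ger0_norm (nc_ge0 _)).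
  generalize (integralC lam setT (fun x => f x * h x)) (integralC lam setT (fun x => f_ n x * h x)) => a b.
  by rewrite -ncN opprB => hab; rewrite -lecR.
have wn : weakly_null lam (fun n x => f_ n x - f x).
  move=> M h Lh; have := pc _ _ Lh; apply: cvg_trans; apply: near_eq_cvg; apply: nearW => n.
  rewrite -intCB; [|exact: L2le_cint_mul (Lfn n) Lh|exact: L2le_cint_mul Lf Lh].
  by congr nc; apply: eq_intC => x; rewrite mulrBl.
have [| |N0 LN0] := L2_bounded_of_weakly_bounded (mu := lam) (f_ := f_).
- by move=> n; exists (fine (\int[lam]_x (nc (f_ n x) ^+ 2)%:E)%E).
- move=> M h Lh; have := pc _ _ Lh => H.
  have [B [_ hB]] := cvg_seq_bounded (cvgP _ H).
  exists (B + 1 + nc (integralC lam setT (fun x => f x * h x))) => n.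
  have B1 : B < B + 1 by rewrite ltrDl.
  have k2 := le_trans (ler_norm _) (hB _ B1 n I).
  rewrite -[X in nc X <= _](subrK (integralC lam setT (fun x => f x * h x))).
  by apply: le_trans (ncD _ _) _; rewrite lerD2r.
exists (Num.max N0 (fine (\int[lam]_x (nc (f x) ^+ 2)%:E)%E)); split => // [n|].
  split; first exact: (LN0 n).1.
  by apply: le_trans (LN0 n).2 _; rewrite lee_fin le_max lexx.
split; first exact: Lf.1.
by apply: le_trans Lf.2 _; rewrite lee_fin le_max lexx orbT.
Qed.

Lemma nonzeroL2_gt0 (f : E -> R[i]) : cmeas f ->
  nonzeroL2 f <-> (0 < \int[lam]_x (nc (f x) ^+ 2)%:E)%E.
Proof.
move=> mf; have m2 := measurable_nc2E mf.
have i0 : (0 <= \int[lam]_x (nc (f x) ^+ 2)%:E)%E.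
  by apply: integral_ge0 => x _; rewrite lee_fin sqr_ge0.
rewrite lt0e i0 andbT; split => [nz|/eqP nz f0].
  apply/eqP => h; apply: nz.
  have [h1 _] := ae_eq_integral_abs lam measurableT m2.
  have : (\int[lam]_x `|(nc (f x) ^+ 2)%:E| = 0)%E.
    by rewrite -[RHS]h; apply: eq_integral => x _; rewrite gee0_abs// lee_fin sqr_ge0.
  move=> /h1 ae0; apply: (ae_imp ae0) => x /(_ I) [] /eqP.
  by rewrite sqrf_eq0 => /eqP; exact: nc_eq0.
apply: nz; transitivity (\int[lam]_x (cst 0%E x))%E; last by rewrite integral0.
apply: ae_eq_integral => //.
by apply: (ae_imp f0) => x -> _; rewrite [nc _]nc0 expr0n.
Qed.

(** Its indicator is a nonzero signal, which shows that the set of quotients is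
    not empty; it is also the maximizer in the degenerate case when the
    supremum vanishes. *)
Definition unit_box : set E := [set x | forall i, `[0, 1]%classic (tnth x i)].

Lemma measurable_unit_box : measurable unit_box.
Proof.
rewrite (_ : unit_box = \bigcap_(i in [set: 'I_d]) ((fun x : E => tnth x i) @^-1` `[0, 1]%classic)).
  apply: fin_bigcap_measurable => // i _.
  rewrite -[X in measurable X]setTI; apply: (measurable_tnth i) => //.
by apply/seteqP; split=> x /= Ax i; [move=> _|]; exact: Ax.
Qed.

Lemma leb_unit_box : lam unit_box = 1%E.
Proof.
rewrite (@leb_box R d (fun=> `[0, 1]%classic))//.
rewrite big1// => i _; rewrite lebesgue_measure_itv /= lte_fin ltr01.
by rewrite oppr0 addr0.
Qed.

Lemma unit_box_L2 : L2le lam 1 (cindic unit_box) /\ nonzeroL2 (cindic unit_box : E -> R[i]).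
Proof.
have mB := measurable_unit_box; have LB := L2le_cindic (mu := lam) mB leb_unit_box.
split => //; apply/(nonzeroL2_gt0 LB.1).
apply: (@lt_le_trans _ _ 1%E) => //; rewrite -leb_unit_box le_eqVlt; apply/orP; left; apply/eqP.
transitivity (\int[lam]_x (\1_unit_box x : R)%:E)%E; first by rewrite integral_indic// setIT.
apply: eq_integral => x _.
by rewrite nc_cindic indicE; case: (x \in unit_box); rewrite ?expr1n ?expr0n.
Qed.

End weak_convergence.

(** * Existence of a maximizer *)

Section maximizer.
Context {R : realType} {d : nat}.
Local Notation E := (euclidean R d).
Local Notation lam := (leb R d).
Local Notation leb2 := (prodm lam lam).
Variables (Omega : set (phase_space R d)) (A : set (E * E)) (p m q : R).
Hypothesis mO : measurable Omega.
Hypothesis mA : measurable A.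
Hypothesis sA : Omega `<=` A.
Hypothesis Am : leb2 A = m%:E.
Hypothesis AO : leb_phase R d ((A : set (phase_space R d)) `\` Omega) = 0%E.
Hypothesis p1 : 1 <= p.
Hypothesis pq : p < q.
Hypothesis q2 : 2 <= q.
Hypothesis qd : d%:R / 2 * ((q - 2) / q) < 1.
Implicit Types f g : E -> R[i].

Let JE f : cmeas f -> J_BJ Omega p f = Lp_norm leb2 A p (fun z => nc (born_jordan f z)).
Proof. by move=> mf; exact: (J_BJE mO mA sA AO p1 mf). Qed.

Lemma J_BJ_ge0 f : (0 <= J_BJ Omega p f)%E.
Proof. exact: Lnorm_ge0. Qed.

Lemma J_BJ_real_scale c f N : 0 <= c -> L2le lam N f ->
  J_BJ Omega p (real_scale c f) = ((c ^+ 2)%:E * J_BJ Omega p f)%E.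
Proof.
move=> c0 Lf; have Lc := L2le_real_scale c Lf; rewrite (JE Lc.1) (JE Lf.1).
have p0 : 0 < p by apply: lt_le_trans p1.
have mb g : cmeas g -> measurable_fun setT (fun z => nc (born_jordan g z)).
  by move=> mg; exact: measurable_nc (cmeas_born_jordan mg).
rewrite /Lp_norm.
transitivity ((((c ^+ 2) `^ p)%:E * Lp_mass leb2 A p (fun z => nc (born_jordan f z))) `^ p^-1)%E.
  congr (_ `^ _)%E.
  have mf := measurable_Lp_mass mA p (mb _ Lf.1).
  have F0 z : (0 <= (\1_A z * nc (born_jordan f z) `^ p)%:E)%E.
    by rewrite lee_fin mulr_ge0// powR_ge0.
  rewrite /Lp_mass -(ge0_integralZl leb2 measurableT mf (fun z _ => F0 z)); last first.
    by rewrite lee_fin powR_ge0.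
  apply: ge0_ae_eq_integral.
  - exact: measurableT.
  - exact: (measurable_Lp_mass mA p (mb _ Lc.1)).
  - exact: (emeasurable_funM (measurable_cst _) mf).
  - by move=> z _; rewrite lee_fin mulr_ge0// powR_ge0.
  - by move=> z _; rewrite mule_ge0// lee_fin powR_ge0.
  - apply: (ae_imp (born_jordan_real_scale c Lf)) => z -> _.
    rewrite Normc.normcM nc_real (ger0_norm (sqr_ge0 c)) powRM ?sqr_ge0 ?nc_ge0//.
    by rewrite -EFinM mulrCA.
rewrite poweRM ?Lp_mass_ge0 ?lee_fin ?powR_ge0//; congr (_ * _)%E.
by rewrite poweR_EFin -powRrM mulfV ?gt_eqF// powRr1// sqr_ge0.
Qed.

(** The L^2 and L^q bounds both vanish, so the interpolation inequality leaves
    only the term proportional to eta. *)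
Lemma J_BJ_null f : L2le lam 0 f -> J_BJ Omega p f = 0%E.
Proof.
move=> Lf; rewrite (JE Lf.1) /Lp_norm.
have q0 : 0 < q by apply: lt_le_trans q2.
have p0 : 0 < p by apply: lt_le_trans p1.
suff -> : Lp_mass leb2 A p (fun z => nc (born_jordan f z)) = 0%E.
  by rewrite poweR0r// invr_eq0 gt_eqF.
have m0 : 0 <= m by rewrite -lee_fin -Am.
have mb := measurable_nc (cmeas_born_jordan Lf.1).
have b2 : (\int[leb2]_z (\1_A z * nc (born_jordan f z) ^+ 2)%:E <= 0)%E.
  have Lb := born_jordan_L2 Lf; rewrite expr0n mulr0 in Lb.
  apply: le_trans Lb.2; apply: ge0_le_integral.
  - exact: measurableT.
  - by move=> z _; rewrite lee_fin mulr_ge0// sqr_ge0.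
  - under eq_fun do rewrite EFinM.
    apply: emeasurable_funM; last exact: measurable_nc2E Lb.1.
    by apply/measurable_EFinP; exact: measurable_indic.
  - exact: measurable_nc2E Lb.1.
  - by move=> z _; rewrite lee_fin ler_piMl ?sqr_ge0// indicE lern1 leq_b1.
have bq := born_jordan_Lq q2 qd Lf; rewrite powR0 ?gt_eqF// mulr0 in bq.
apply/eqP; rewrite eq_le Lp_mass_ge0 andbT; apply/lee_addgt0Pr => e e0; rewrite add0e.
have m1 : 0 < m + 1 by rewrite ltr_wpDl.
have em : 0 < e / (m + 1) by rewrite divr_gt0.
have [C C0 ineq] := powR_interpolation p1 pq em.
apply: le_trans (Lp_mass_le mA Am (ltW em) C0 ineq mb (fun z => nc_ge0 _) bq b2) _.
rewrite mule0 adde0 addr0 lee_fin; exact: ler_div_add1 (ltW e0) m0.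
Qed.

Lemma BJ_quotientE f (r : R) : (\int[lam]_x (nc (f x) ^+ 2)%:E)%E = r%:E -> r != 0 ->
  BJ_quotient Omega p f = (r^-1%:E * J_BJ Omega p f)%E.
Proof. by move=> fr r0; rewrite /BJ_quotient normL2_sqr fr inver (negbTE r0) muleC. Qed.

(** The functional is homogeneous of degree two under positive scaling. *)
Lemma BJ_quotient_unit f : inL2 f -> nonzeroL2 f ->
  exists g, L2le lam 1 g /\ J_BJ Omega p g = BJ_quotient Omega p f.
Proof.
move=> f2 nz; have Lf := inL2_L2le f2; have /inL2P[mf ff] := f2.
have f0 := (nonzeroL2_gt0 mf).1 nz.
set r := fine _ in Lf.
have rE : (\int[lam]_x (nc (f x) ^+ 2)%:E)%E = r%:E.
  by rewrite /r fineK// ge0_fin_numE// ltW.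
have r0 : 0 < r by rewrite -lte_fin -rE.
have c0 : 0 <= (Num.sqrt r)^-1 by rewrite invr_ge0 sqrtr_ge0.
have c2 : (Num.sqrt r)^-1 ^+ 2 = r^-1 by rewrite exprVn sqr_sqrtr// ltW.
exists (real_scale (Num.sqrt r)^-1 f); split.
  by have := L2le_real_scale (Num.sqrt r)^-1 Lf; rewrite c2 mulVf// gt_eqF.
by rewrite (J_BJ_real_scale c0 Lf) c2 (BJ_quotientE rE)// gt_eqF.
Qed.

(** Normalize a maximizing sequence and let g be a weak limit of a subsequence.
    The functional at g equals the supremum, which is thus finite. If g is not
    null, then |g| <= 1 makes the quotient at g at least this value; if g is
    null, the supremum is 0 and every signal is a maximizer. *)
Lemma BJ_supremum : (ereal_sup (BJ_quotients Omega p) < +oo)%E /\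
  exists f, [/\ inL2 f, nonzeroL2 f &
    BJ_quotient Omega p f = ereal_sup (BJ_quotients Omega p)].
Proof.
have [Lb nzb] := @unit_box_L2 R d.
set S := BJ_quotients Omega p.
have Sb : S (BJ_quotient Omega p (cindic unit_box)).
  by exists (cindic unit_box) => //; split; [exact: L2le_inL2 Lb|].
have Sn : S != set0 by apply/set0P; exists (BJ_quotient Omega p (cindic unit_box)).
have [u uS uc] := ereal_sup_seq Sn.
have ex n : exists g, L2le lam 1 g /\ J_BJ Omega p g = u n.
  by have [f [f2 nz] <-] := uS n; exact: BJ_quotient_unit.
have {ex} [g_ gP] := choice ex.
have [phi [g [phin Lg wg]]] := L2_weak_compactness (fun n => (gP n).1).
have Jc := J_BJ_cvg mO mA sA Am AO p1 pq q2 qd (fun n => (gP (phi n)).1) Lg wg.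
have phic : phi n @[n --> \oo] --> \oo.
  move=> P [N _ NP]; exists N => // n Nn; apply: NP; exact: leq_trans (phin n).
have Js : J_BJ Omega p g = ereal_sup S.
  apply: (cvg_unique _ Jc) => //=.
  have := cvg_comp _ _ phic uc; apply: cvg_trans; apply: near_eq_cvg.
  by apply: nearW => n; rewrite /= (gP _).2.
have Jfin := J_BJ_fin mO mA sA Am AO p1 pq q2 qd Lg.
split; first by rewrite -Js.
have /inL2P[mg gfin] := L2le_inL2 Lg.
have i0 : (0 <= \int[lam]_x (nc (g x) ^+ 2)%:E)%E.
  by apply: integral_ge0 => x _; rewrite lee_fin sqr_ge0.
have [g0|g0] := eqVneq (\int[lam]_x (nc (g x) ^+ 2)%:E)%E 0%E.
  exists (cindic unit_box); split; [exact: L2le_inL2 Lb|by []|].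
  have s0 : ereal_sup S = 0%E.
    by rewrite -Js; apply: J_BJ_null; split; [exact: mg|rewrite g0].
  apply/eqP; rewrite eq_le ereal_sup_ubound//= s0.
  by rewrite /BJ_quotient mule_ge0 ?J_BJ_ge0// inve_ge0 normL2_sqr; apply: integral_ge0 => x _; rewrite lee_fin sqr_ge0.
have gpos : (0 < \int[lam]_x (nc (g x) ^+ 2)%:E)%E by rewrite lt0e g0.
have nzg : nonzeroL2 g by apply/(nonzeroL2_gt0 mg).
have g2 := L2le_inL2 Lg.
exists g; split => //; apply/eqP; rewrite eq_le; apply/andP; split.
  by apply: ereal_sup_ubound; exists g.
pose r := fine (\int[lam]_x (nc (g x) ^+ 2)%:E)%E.
have rE : (\int[lam]_x (nc (g x) ^+ 2)%:E)%E = r%:E by rewrite fineK// ge0_fin_numE.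
have r0 : 0 < r by rewrite -lte_fin -rE.
have r1 : r <= 1 by rewrite -lee_fin -rE; exact: Lg.2.
rewrite (BJ_quotientE rE) ?gt_eqF// -Js -[leLHS]mul1e.
by apply: lee_wpmul2r; rewrite ?J_BJ_ge0// lee_fin invf_ge1.
Qed.

End maximizer.

Theorem theorem1p4 (R : realType) (d : nat) (d_ge2 : (2 <= d)%N)
    (Omega : set (phase_space R d)) (mOmega : measurable Omega)
    (Omega_gt0 : (0 < leb_phase R d Omega)%E)
    (Omega_fin : (leb_phase R d Omega < +oo)%E)
    (p : R) (p_ge1 : 1 <= p) (p_lt : (p%:E < critical_exponent R d)%E) :
  [/\ (forall f : euclidean R d -> R[i], inL2 f ->
         inLp (leb_phase R d) Omega p (born_jordan f)),
      (forall (f_ : nat -> euclidean R d -> R[i]) (f : euclidean R d -> R[i]),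
         (forall n, inL2 (f_ n)) -> inL2 f -> weakly_converges f_ f ->
         J_BJ Omega p (f_ n) @[n --> \oo] --> J_BJ Omega p f),
      (ereal_sup (BJ_quotients Omega p) < +oo)%E
    & exists f : euclidean R d -> R[i],
        [/\ inL2 f, nonzeroL2 f
          & BJ_quotient Omega p f = ereal_sup (BJ_quotients Omega p)]].
Proof.
have [q [pq q2 qd]] := subcritical_exponent d_ge2 p_ge1 p_lt.
pose M2 : {measure set (euclidean R d * euclidean R d) -> \bar R} := (leb R d \x leb R d)%E.
have [A [mA sA AE AO]] := measurable_hull (mu := M2) mOmega Omega_fin.
pose m := fine (leb_phase R d Omega).
have Am : prodm (leb R d) (leb R d) A = m%:E.
  by rewrite fineK ?ge0_fin_numE//; exact: AE.
have [Sfin Smax] := BJ_supremum mOmega mA sA Am AO p_ge1 pq q2 qd.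
split; [move=> f f2|move=> f_ f fn2 f2 wf|exact: Sfin|exact: Smax].
- have Lf := inL2_L2le f2; have [m1 m2] := cmeas_born_jordan Lf.1.
  have mR (h : euclidean R d * euclidean R d -> R) : measurable_fun setT h ->
      measurable_fun Omega (h : phase_space R d -> R).
    move=> mh; apply: measurable_funTS => _ Y mY.
    exact: (completion_measurable M2 (mh measurableT Y mY)).
  split; [exact: mR m1|exact: mR m2|].
  exact: (J_BJ_fin mOmega mA sA Am AO p_ge1 pq q2 qd Lf).
- have [N [Lfn Lf wn]] := weakly_converges_bounded fn2 f2 wf.
  exact: (J_BJ_cvg mOmega mA sA Am AO p_ge1 pq q2 qd Lfn Lf wn).
Qed.
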